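(* Let $n,m\ge 1$ and let $\mathbf g=[g_1,\dots,g_m]$ with $g_1,\dots,g_m\in\mathbb R[\mathbf x]=\mathbb R[x_1,\dots,x_n]$ be such that $S_{\mathbf g}=\{x\in\mathbb R^n: g_j(x)\ge 0,\ j=1,\dots,m\}$ is nonempty and compact, and $1-\|\mathbf x\|_2^2\in \mathcal Q(\mathbf g)$. Then there are constants $C_{\mathbf g}>0$ and $C'_{\mathbf g}>0$ depending only on $\mathbf g$ such that for every $f\in\mathbb R[\mathbf x]$ with $\deg f=d$ and $f>0$ on $S_{\mathbf g}$, one has $$f\in\mathcal Q(\mathbf g)_{rn}\quad\text{whenever}\quad r\ \ge\ C_{\mathbf g}\,\log(n)\,d^{4\mathbf L_{\mathbf g}+2}\,\kappa_{S_{\mathbf g}}(f)^{2\mathbf L_{\mathbf g}}+C'_{\mathbf g}\,d^{2\mathbf L_{\mathbf g}}\,\kappa_{S_{\mathbf g}}(f)^{\mathbf L_{\mathbf g}}.$$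
   Context: $\Sigma[\mathbf x]$ is the cone of sums of squares of polynomials in $\mathbb R[\mathbf x]$. For real $r\ge 0$ the truncated quadratic module is $\mathcal Q(\mathbf g)_r=\{\sum_{j=0}^m\sigma_j g_j:\ \sigma_j\in\Sigma[\mathbf x],\ \deg(\sigma_jg_j)\le r,\ j=0,\dots,m\}$ with $g_0:=1$, and $\mathcal Q(\mathbf g)=\bigcup_{r\ge 0}\mathcal Q(\mathbf g)_r$. For $f>0$ on $S_{\mathbf g}$: $f_{\min}=\min_{x\in S_{\mathbf g}}f(x)$, $\|f\|_{\sup}=\sup_{x\in[-1,1]^n}|f(x)|$, and $\kappa_{S_{\mathbf g}}(f)=\|f\|_{\sup}/f_{\min}$. Łojasiewicz exponent: let $\operatorname{dist}(x,S_{\mathbf g})$ be the Euclidean distance and $G(x)=\max_{j=1,\dots,m}\max\{0,-g_j(x)\}$. $\mathbf L_{\mathbf g}$ is the smallest real $L>0$ for which there is a constant $c\ge 0$ with $\operatorname{dist}(x,S_{\mathbf g})^{L}\le c\,G(x)$ for all $x\in[-1,1]^n$. (In the degenerate case where no smallest such exponent exists, which happens only if $[-1,1]^n\subseteq S_{\mathbf g}$ or $[-1,1]^n\cap S_{\mathbf g}=\emptyset$, set $\mathbf L_{\mathbf g}=1$.) *)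

(* Defs.v *)
From HB Require Import structures.
From mathcomp Require Import all_boot all_order all_algebra.
From mathcomp Require Import all_classical all_reals all_analysis.
(* The notations of mpoly clash with those of mathcomp-analysis; hence
   [mpoly n R] is {mpoly R[n]}, [meval] is evaluation, and
   [mpolyX R (mnm1 i)] is the variable 'X_i. *)
From mathcomp Require Import -(notations) mpoly.

Set Implicit Arguments.
Unset Strict Implicit.
Unset Printing Implicit Defensive.

Import Order.TTheory GRing.Theory Num.Theory.
Import numFieldNormedType.Exports.
Local Open Scope classical_set_scope.
Local Open Scope ring_scope.

Section Definitions.
Context {R : realType} {n : nat}.

Definition peval (p : mpoly n R) (x : 'rV[R]_n) : R := meval (x ord0) p.

(* Since msize p = 1 + deg p for p != 0 and msize 0 = 0, the zero polynomial is
   given degree 0; so "pdeg p <= r" holds for p = 0 whenever r >= 0, as it does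
   under the convention deg 0 = -oo. *)
Definition pdeg (p : mpoly n R) : nat := (msize p).-1.

Definition sos : set (mpoly n R) :=
  [set s | exists q : seq (mpoly n R), s = \sum_(p <- q) p ^+ 2].

(* The library norm on 'rV[R]_n is the sup norm. *)
Definition norm2 (x : 'rV[R]_n) : R := Num.sqrt (\sum_(i < n) x ord0 i ^+ 2).

Definition dist2 (x : 'rV[R]_n) (A : set 'rV[R]_n) : R :=
  inf [set norm2 (x - y) | y in A].

Definition cube : set 'rV[R]_n :=
  [set x | forall i : 'I_n, -1 <= x ord0 i <= 1].

Section Constraints.
Context {m : nat} (g : 'I_m -> mpoly n R).

Definition Sset : set 'rV[R]_n :=
  [set x | forall j : 'I_m, 0 <= peval (g j) x].

(* The term for g_0 = 1 is split off. *)
Definition qmodule_trunc (r : R) : set (mpoly n R) :=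
  [set p | exists (s0 : mpoly n R) (s : 'I_m -> mpoly n R),
    [/\ sos s0 /\ (forall j, sos (s j)),
        (pdeg s0)%:R <= r,
        (forall j, (pdeg (s j * g j))%:R <= r)
      & p = s0 + \sum_(j < m) s j * g j]].

Definition qmodule : set (mpoly n R) :=
  \bigcup_(r in [set r : R | 0 <= r]) qmodule_trunc r.

Definition fmin (f : mpoly n R) : R := inf [set peval f x | x in Sset].

Definition supnorm (f : mpoly n R) : R := sup [set `|peval f x| | x in cube].

Definition kappa (f : mpoly n R) : R := supnorm f / fmin f.

(* The maximum over j of nonnegative quantities, so the default value 0 of the
   iterated maximum is harmless. *)
Definition violation (x : 'rV[R]_n) : R :=
  \big[Num.max/0]_(j < m) Num.max 0 (- peval (g j) x).

Definition loj_admissible : set R :=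
  [set L | 0 < L /\
    exists2 c : R, 0 <= c &
      forall x, cube x -> (dist2 x Sset) `^ L <= c * violation x].

(* The least admissible exponent, or 1 if there is none. *)
Definition loj_exponent : R :=
  xget 1 (loj_admissible `&` lbound loj_admissible).

End Constraints.
End Definitions.

(* Main.v *)
Require Import Defs.
From HB Require Import structures.
From mathcomp Require Import all_boot all_order all_algebra.
From mathcomp Require Import all_classical all_reals all_analysis.
From mathcomp Require Import -(notations) mpoly.
From mathcomp Require Import ring lra zify.
From mathcomp Require qe_rcf ordered_qelim polyrcf.
From mathcomp Require Import -(notations) complex.
Set Implicit Arguments.
Unset Strict Implicit.
Unset Printing Implicit Defensive.
Import Order.TTheory GRing.Theory Num.Theory.
Import numFieldNormedType.Exports.
Local Open Scope classical_set_scope.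
Local Open Scope ring_scope.

(** Why the theorem holds. Write [L] for the Lojasiewicz exponent of the
constraints, [mu] for the minimum of [f] on the feasible set, and [w] for
[1 - |x|^2].

The proof first makes [f] positive on the whole cube [[-1, 1]^n]
([positive_perturbation]). It subtracts from [f] the sum of the products
[lam * h(g_j / G0) * g_j], where [G0] bounds the constraints on the cube, [lam]
is a scale of order [N mu], and [h] is a sum of squares in one variable that is of order one on
[[-1, 0]] but satisfies [t * h t = O(1 / N)] on [[0, 1]] ([step_poly]). Where a
constraint is violated, the subtracted term is negative and lifts [f]; where the
constraints hold, it changes [f] by little. The violation at distance [delta]
from the feasible set is at least of order [delta ^ L], while [f] can lose half
of [mu] only at a distance of order [mu / (d^2 |f|)], by Markov's inequality
([markov], [cube_lipschitz]). Comparing the two shows that [N] of order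
[X0 = d^(2L) kappa^L] suffices. The result [q] has degree [X] of order [X0], and
its maximum and minimum on the cube have a ratio of at most [X].

It remains to certify [q] with degree [O(X^2)], which is what the first term of
the bound allows ([ball_qmodule_positive_on_cube]). Everything here happens in
the quadratic module of the single polynomial [w]. Having one generator, it is
closed under products, and by hypothesis it is contained in the quadratic module
of the constraints, up to a shift in degree that depends only on them
([ball_qmodule_sub]). After scaling, [q] takes values in [[a, 1]] with
[a >= 1 / X]. Let [tau] be a Chebyshev polynomial of degree of order [X],
reflected so as to be bounded by one on [[a, 1]] and to grow fast to the left of
[a]. The polynomial [t - a / 2 + tau t / Z] is positive on the whole line, so its
value at [q] is a sum of squares; thus [q] equals a sum of squares plus [a / 2] minus
[tau(q) / Z]. The error [tau(q)] is bounded by one on the cube, and such a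
polynomial is bounded modulo [w] by its degree to the power [n], up to constants
([cube_bounded]): expand it in a tensor Lagrange basis at nodes that nearly
maximize the Vandermonde determinant, so that every basis polynomial is bounded
by 2. As [Z] grows doubly exponentially in the number of doublings, it absorbs
this loss.

When [n = 1] the term with [ln n] vanishes and only [O(X0)] is allowed; then
factoring the univariate [q] into linear and quadratic factors gives a
certificate of degree linear in that of [q] ([ball_qmodule_positive_on_interval]).

Finally the exponent [L] has to be attained and at least one
([loj_exponent_admissible]). The least violation at distance at least [t] is a
definable function of [t], by quantifier elimination over the reals. Such a
function is squeezed between two multiples of one power of [t] near zero
([definable_growth_order]), because its graph lies in the zero set of a
polynomial in two variables, where two monomials must be of the same size. This
power is the least admissible exponent, and the Lipschitz bound on the violation
makes it at least one. *)

(** * Factors of positive real polynomials *)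
Section PosPoly.
Variable R : rcfType.
Implicit Types (p : {poly R}).

(** A complex root [a + bi] of [p] that is not real kills the quadratic. The
remainder of [p] modulo this quadratic is a real polynomial of degree at most
one that vanishes at [a + bi], hence zero. *)
Lemma real_or_quadratic_factor p : (1 < size p)%N ->
  (exists a, root p a) \/
  (exists a b : R, b != 0 /\ ('X - a%:P) ^+ 2 + (b ^+ 2)%:P %| p).
Proof.
move=> sp.
have : size (map_poly (complex.real_complex R) p) != 1%N.
  by rewrite size_map_poly; case: (size p) sp => [|[]].
move=> /closed_rootP [[a b]] rz.
have [b0|b0] := eqVneq b 0.
  left; exists a; move: rz; rewrite b0 -[complex.Complex a 0]/(complex.real_complex R a).
  by rewrite fmorph_root.
right; exists a, b; split=> //.
set m := _ + _.
have sm : size m = 3%N.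
  rewrite /m expr2 size_polyDl size_Mmonic ?size_XsubC ?monicXsubC ?polyXsubC_eq0 //.
  by rewrite (leq_ltn_trans (size_polyC_leq1 _)).
have m0 : m != 0 by rewrite -size_poly_gt0 sm.
rewrite /dvdp.
have sr : (size (p %% m)%R <= 2)%N by rewrite -ltnS -sm ltn_modp.
set z := complex.Complex a b in rz.
have mz : (map_poly (complex.real_complex R) m).[z] = 0.
  rewrite /m rmorphD rmorphXn rmorphB /= map_polyX !map_polyC /= !hornerE /=.
  by apply/eqP; rewrite complex.eq_complex /=; apply/andP; split; apply/eqP; ring.
have : (map_poly (complex.real_complex R) (p %% m)).[z] = 0.
  move: rz; rewrite /root {1}(divp_eq p m) rmorphD rmorphM /= hornerD hornerM mz mulr0 add0r.
  by move/eqP.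
set r := p %% m in sr *.
have -> : r = (r`_1) *: 'X + (r`_0)%:P.
  apply/polyP => i; rewrite coefD coefZ coefX coefC.
  case: i => [|[|i]] /=; rewrite ?mulr0 ?mulr1 ?addr0 ?add0r //.
  by rewrite nth_default // (leq_trans sr).
rewrite rmorphD /= map_polyZ map_polyX map_polyC /= !hornerE /=.
move/eqP; rewrite complex.eq_complex /= !(mul0r, subr0, addr0).
rewrite mulf_eq0 (negPf b0) orbF => /andP[+ /eqP r1].
by rewrite r1 !mul0r add0r => /eqP ->; rewrite scale0r polyC0 addr0.
Qed.

(** None of the real roots of [p] lies in [I], so every linear factor keeps its
sign on [I] and can be taken positive there. The line and the segment
[[-1, 1]] are the two instances of [I] below. *)
Lemma pos_poly_ind (I : R -> Prop) (K : {poly R} -> Prop) :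
  (exists x, I x) ->
  (forall a, I a \/ (forall x, I x -> a < x) \/ (forall x, I x -> x < a)) ->
  (forall c : R, 0 < c -> K c%:P) ->
  (forall p q : {poly R}, p != 0 -> q != 0 -> K p -> K q -> K (p * q)) ->
  (forall a b : R, b != 0 -> K (('X - a%:P) ^+ 2 + (b ^+ 2)%:P)) ->
  (forall a, (forall x, I x -> a < x) -> K ('X - a%:P)) ->
  (forall a, (forall x, I x -> x < a) -> K (a%:P - 'X)) ->
  forall p, (forall x, I x -> 0 < p.[x]) -> K p.
Proof.
move=> [x0 Ix0] tri Kc KM Kq Kl Kr p.
have [n sp] := ubnP (size p); elim: n p sp => // n IH p sp pp.
have p0 : p != 0.
  by apply: contraTneq (pp _ Ix0) => ->; rewrite horner0 ltxx.
have step q u : p = q * u -> (1 < size q)%N -> K q -> (forall x, I x -> 0 < q.[x]) -> K p.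
  move=> pE sq Kq' qp.
  have q0 : q != 0 by rewrite -size_poly_gt0 ltnW.
  have u0 : u != 0 by apply: contra_neq p0 => u0; rewrite pE u0 mulr0.
  rewrite pE; apply: KM => //; apply: IH => [|x Ix].
    move: sp; rewrite pE size_mul //; case: (size q) sq => [|[|k]] // _.
    by rewrite !addSn /= !ltnS; apply: leq_trans; rewrite ltnS leq_addl.
  by have := pp _ Ix; rewrite pE hornerM pmulr_rgt0 // qp.
have [s1|s1] := leqP (size p) 1.
  have := pp _ Ix0; rewrite (size1_polyC s1) hornerC; exact: Kc.
have [[a ra]|[a [b [b0 dv]]]] := real_or_quadratic_factor s1.
  have [Ia|[la|ra']] := tri a.
  - by have := pp _ Ia; rewrite (rootP ra) ltxx.
  - have /factor_theorem [u pE] := ra.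
    apply: (step ('X - a%:P) u); rewrite ?size_XsubC // 1?mulrC //; first exact: Kl.
    by move=> x Ix; rewrite !hornerE subr_gt0 la.
  - have /factor_theorem [u pE] := ra.
    apply: (step (a%:P - 'X) (- u)).
    + by rewrite mulrN -mulNr opprB mulrC.
    + by rewrite -size_polyN opprB size_XsubC.
    + exact: Kr.
    + by move=> x Ix; rewrite !hornerE subr_gt0 ra'.
have /dvdpP [u pE] := dv.
apply: (step (('X - a%:P) ^+ 2 + (b ^+ 2)%:P) u); rewrite 1?mulrC //.
- rewrite expr2 size_polyDl size_Mmonic ?size_XsubC ?monicXsubC ?polyXsubC_eq0 //.
  by rewrite (leq_ltn_trans (size_polyC_leq1 _)).
- exact: Kq.
- move=> x _; rewrite !hornerE; apply: ltr_wpDl; first by rewrite sqr_ge0.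
  by rewrite exprn_even_gt0.
Qed.
End PosPoly.

(** * Chebyshev polynomials of degree 2^k *)
Section Doubling.
Variable R : realType.
(** The Chebyshev polynomials of degree [2 ^ k] are the iterates of
[2 y^2 - 1], which doubles the angle. *)
Definition dbl (y : R) : R := 2 * y ^+ 2 - 1.
Definition cheb2 k : {poly R} := iter k (fun p => 2%:P * p ^+ 2 - 1) 'X.

Lemma horner_cheb2 k x : (cheb2 k).[x] = iter k dbl x.
Proof.
elim: k => [|k IH]; first by rewrite hornerX.
by rewrite /cheb2 !iterS -/(cheb2 k) /dbl !hornerE IH.
Qed.

Lemma size_cheb2 k : (size (cheb2 k) <= (2 ^ k).+1)%N.
Proof.
elim: k => [|k IH]; first by rewrite size_polyX.
rewrite /cheb2 iterS -/(cheb2 k) (leq_trans (size_polyD _ _)) // geq_max.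
rewrite size_polyN size_poly1 andbT mul_polyC (leq_trans (size_scale_leq _ _)) //.
rewrite expr2 (leq_trans (size_polyMleq _ _)) //.
rewrite expnS; move: (size _) IH => s IH.
by case: s IH => [|s] IH //; rewrite addnS /= mul2n -addnn -addSn leq_add.
Qed.

Lemma iter_dbl_norm_le1 k y : `|y| <= 1 -> `|iter k dbl y| <= 1.
Proof.
move=> y1; elim: k => [//|k]; rewrite iterS; move: (iter _ _ _) => z z1.
have : z ^+ 2 <= 1 by rewrite -real_normK ?num_real // expr_le1.
have := sqr_ge0 z; rewrite /dbl ler_norml; move: (z ^+ 2) => u u0 u1.
by apply/andP; split; lra.
Qed.

Lemma iter_dbl_geN1 k y : -1 <= iter k.+1 dbl y.
Proof. by rewrite iterS /dbl; have := sqr_ge0 (iter k dbl y); lra. Qed.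

(** The tangent at 1 has slope [4 ^ k] and stays below the graph. *)
Lemma iter_dbl_ge k (d : R) : 0 <= d -> 1 + 4 ^+ k * d <= iter k dbl (1 + d).
Proof.
move=> d0; elim: k => [|k]; first by rewrite expr0 mul1r.
rewrite iterS exprS -mulrA; set D := _ * d; move: (iter _ _ _) => z Dz.
have D0 : 0 <= D by rewrite mulr_ge0 // exprn_ge0.
by rewrite /dbl; nra.
Qed.

(** The growth beyond 1 remains linear up to the distance [4 ^- k]. This makes
extrapolation cost only the square of the degree in Markov's inequality. *)
Lemma iter_dbl_le k (d : R) : 0 <= d -> 4 ^+ k * d <= 1 ->
  iter k dbl (1 + d) <= 1 + 2 * (4 ^+ k * d).
Proof.
move=> d0 kd.
(* The bound 1 + D (1 + D) is stable under doubling of the angle, unlike 1 + 2 D. *)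
suff : iter k dbl (1 + d) <= 1 + (4 ^+ k * d) * (1 + 4 ^+ k * d).
  have : 0 <= 4 ^+ k * d by rewrite mulr_ge0 // exprn_ge0.
  by move: (_ * d) kd => D ? ? ?; nra.
elim: k kd => [|k IH] kd; first by rewrite expr0 mul1r /=; nra.
rewrite iterS exprS -mulrA -mulrA in kd *.
have := iter_dbl_ge k d0.
have : 0 <= 4 ^+ k * d by rewrite mulr_ge0 // exprn_ge0.
move: (iter k dbl (1 + d)) (4 ^+ k * d) kd IH => z D kd IH D0 zD.
have D1 : D <= 1 by lra. have {}IH := IH D1.
have : z ^+ 2 <= (1 + D * (1 + D)) ^+ 2 by rewrite ler_sqr ?nnegrE; nra.
have DD : D ^+ 2 <= D by nra.
have D3 : D ^+ 3 <= D ^+ 2 by rewrite exprS ler_piMl ?sqr_ge0//; nra.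
have D4 : D ^+ 4 <= D ^+ 2 by rewrite -[4%N]/(2 + 2)%N exprD ler_piMl ?sqr_ge0//; nra.
rewrite /dbl; have -> : (1 + D * (1 + D)) ^+ 2 = 1 + 2 * D + 3 * D ^+ 2 + 2 * D ^+ 3 + D ^+ 4 by ring.
nra.
Qed.

(** Past 2, each doubling more than squares the value. The factor [y] is kept
apart because the use below compares it with a linear term. *)
Lemma iter_dbl_big k y : 2 <= y -> y * 2 ^+ (2 ^ k).-1 <= iter k dbl y.
Proof.
move=> y2; suff : y ^+ (2 ^ k) <= iter k dbl y.
  apply: le_trans; have : (0 < 2 ^ k)%N by rewrite expn_gt0.
  case: (2 ^ k)%N => // m _; rewrite exprS ler_wpM2l //; first lra.
  by rewrite lerXn2r ?nnegrE //; lra.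
elim: k => [//|k IH]; rewrite iterS expnS mulnC exprM.
have y1 : 1 <= y ^+ (2 ^ k) by rewrite exprn_ege1 //; lra.
by rewrite /dbl; move: (y ^+ _) (iter _ _ _) y1 IH => u z; nra.
Qed.

Lemma iter_dbl_cos k t : iter k dbl (cos t) = cos (2 ^+ k * t).
Proof.
elim: k => [|k IH]; first by rewrite mul1r.
by rewrite iterS IH exprS -mulrA /dbl [2 * (_ * _)]mulr_natl mulr2n cosD -!expr2 sin2cos2; ring.
Qed.

End Doubling.

(** * Extrapolation and Markov's inequality *)
Section Lagrange.
Variable R : realType.
Variables (n : nat) (x : nat -> R).
Hypothesis n0 : (0 < n)%N.
Hypothesis x_inj : injective x.

Lemma horner_lagrange (i : 'I_n) y :
  (tnth (n.-lagrange x) i : {poly R}).[y] =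
  \prod_(j < n | j != i) ((y - x j) / (x i - x j)).
Proof.
rewrite lagrangeE //= hornerM hornerC !horner_prod -prodfV -big_split /=.
by apply: eq_bigr => j _; rewrite !hornerE mulrC.
Qed.

Lemma lagrange_interp (p : {poly R}) y : (size p <= n)%N ->
  p.[y] = \sum_(i < n) p.[x i] * (tnth (n.-lagrange x) i : {poly R}).[y].
Proof.
move=> sp; rewrite {1}(lagrange_gen n0 x_inj sp) horner_sum.
by apply: eq_bigr => i _; rewrite hornerM hornerC.
Qed.

Hypothesis x_decr : forall i j, (i < j)%N -> x j < x i.

Lemma prod_sign_ord (i : 'I_n) :
  (-1) ^+ i = \prod_(j < n | j != i) ((-1) ^+ (j < i)%N) :> R.
Proof.
rewrite -expr_sum; congr (_ ^+ _).
rewrite (bigID (fun j : 'I_n => (j < i)%N)) /= [X in (_ + X)%N]big1 ?addn0; last first.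
  by move=> j /andP[_ /negbTE ->].
rewrite -[LHS]card_ord -sum1_card (big_ord_widen n (fun=> 1%N)); last exact: ltnW.
apply: eq_big => [j|j ->] //.
by case: (ltngtP j i) => //; rewrite ?andbT ?andbF // => ji; apply/esym/eqP => jE; rewrite jE ltnn in ji.
Qed.

(** To the right of all nodes only the [i] denominators with [j < i] are
negative. *)
Lemma lagrange_sign (i : 'I_n) y : x 0%N <= y ->
  0 <= (-1) ^+ i * (tnth (n.-lagrange x) i : {poly R}).[y].
Proof.
move=> xy; rewrite horner_lagrange prod_sign_ord -big_split /=.
apply: prodr_ge0 => j ji.
have yj : 0 <= y - x j.
  rewrite subr_ge0 (le_trans _ xy) //; case: (nat_of_ord j) => // k.
  exact/ltW/x_decr.
case: (ltngtP j i) ji => [ji _|ij _|ji]; last by rewrite (val_inj ji) eqxx.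
- by rewrite expr1 mulN1r -mulrN -invrN opprB mulr_ge0 // invr_ge0 subr_ge0 ltW ?x_decr.
- by rewrite expr0 mul1r mulr_ge0 // invr_ge0 subr_ge0 ltW ?x_decr.
Qed.

(** The increments of the Lagrange basis between [x 0] and [y] alternate in
sign, so among the polynomials bounded by [M] at the nodes the increment is
largest for the one with alternating values, [M * T]. *)
Lemma lagrange_extrapolation (p T : {poly R}) (M y : R) :
  (size p <= n)%N -> (size T <= n)%N ->
  (forall i, (i < n)%N -> `|p.[x i]| <= M) ->
  (forall i, (i < n)%N -> T.[x i] = (-1) ^+ i) ->
  x 0%N <= y -> `|p.[y] - p.[x 0%N]| <= M * (T.[y] - T.[x 0%N]).
Proof.
move=> sp sT pM Tx xy.
have diffE (q : {poly R}) : (size q <= n)%N -> q.[y] - q.[x 0%N] = \sum_(i < n) q.[x i] *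
    ((tnth (n.-lagrange x) i : {poly R}).[y] - (tnth (n.-lagrange x) i : {poly R}).[x 0%N]).
  move=> sq; rewrite (lagrange_interp y sq) (lagrange_interp (x 0%N) sq) -sumrB.
  by apply: eq_bigr => i _; rewrite mulrBr.
rewrite !diffE // mulr_sumr (le_trans (ler_norm_sum _ _ _)) //.
apply: ler_sum => i _; rewrite normrM Tx // ler_pM //; first exact: pM.
set l := tnth _ i; have := @lagrange_sign i y xy; rewrite -/l.
have -> : (l : {poly R}).[x 0%N] = (i == 0%N :> nat)%:R.
  have := @lagrange_sample _ _ _ n0 x_inj i (Ordinal n0).
  by rewrite -/l /= => ->; rewrite -val_eqE.
have [i0|i0] := posnP i; last by rewrite subr0 => h; rewrite -[X in _ <= X]ger0_norm // normrM normrX normrN1 expr1n mul1r.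
rewrite i0 !expr0 !mul1r => _; rewrite ger0_norm // subr_ge0 /l horner_lagrange.
have -> : true%:R = \prod_(j < n | j != i) 1 :> R by rewrite big1_eq.
apply: ler_prod => j ji; rewrite ler01 /= i0.
have j0 : (0 < j)%N by rewrite lt0n; apply: contra_neq ji => j0; apply/val_inj; rewrite /= j0 i0.
by rewrite ler_pdivlMr ?subr_gt0 ?x_decr // mul1r lerB.
Qed.
End Lagrange.

Section Markov.
Variable R : realType.

(** The extrema of the Chebyshev polynomial of degree [2 ^ k]. Beyond them the
sequence only has to remain decreasing, hence injective. *)
Definition cheb_node (k i : nat) : R :=
  if (i <= 2 ^ k)%N then cos (i%:R * pi / 2 ^+ k) else - i%:R.

Lemma cheb_node_decr k i j : (i < j)%N -> cheb_node k j < cheb_node k i.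
Proof.
have angle m : (m <= 2 ^ k)%N -> m%:R * pi / 2 ^+ k \in `[0, pi : R].
  move=> mk; rewrite in_itv /= mulr_ge0 ?invr_ge0 ?exprn_ge0 ?mulr_ge0 ?pi_ge0 //=.
  by rewrite ler_pdivrMr ?exprn_gt0 // mulrC ler_wpM2l ?pi_ge0 // -natrX ler_nat.
move=> ij; rewrite /cheb_node; have [jk|kj] := leqP j (2 ^ k).
  have ik := leq_trans (ltnW ij) jk; rewrite ik ltr_cos ?angle //.
  by rewrite ltr_pM2r ?invr_gt0 ?exprn_gt0 // ltr_pM2r ?pi_gt0 // ltr_nat.
have j1 : 1 < j%:R :> R by rewrite ltr1n (leq_ltn_trans _ kj) // expn_gt0.
have [ik|ki] := leqP i (2 ^ k); last by rewrite ltrN2 ltr_nat.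
by rewrite (lt_le_trans _ (cos_geN1 _)) // ltrN2.
Qed.

Lemma cheb_node_inj k : injective (cheb_node k).
Proof.
move=> i j ij; case: (ltngtP i j) => // /(cheb_node_decr k); by rewrite ij ltxx.
Qed.

Lemma horner_cheb2_node k i : (i <= 2 ^ k)%N -> (cheb2 R k).[cheb_node k i] = (-1) ^+ i.
Proof.
move=> ik; rewrite horner_cheb2 /cheb_node ik iter_dbl_cos.
have -> : 2 ^+ k * (i%:R * pi / 2 ^+ k) = pi *+ i :> R.
  by rewrite mulrC divfK ?expf_neq0 // mulr_natl.
elim: {ik}i => [|i IH]; first by rewrite mulr0n cos0.
by rewrite mulrSr cosDpi IH exprS mulN1r.
Qed.

Lemma markov_endpoint (p : {poly R}) k (M h : R) : (size p <= (2 ^ k).+1)%N ->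
  (forall x, -1 <= x <= 1 -> `|p.[x]| <= M) -> 0 <= h -> 4 ^+ k * h <= 1 ->
  `|p.[1 + h] - p.[1]| <= 2 * M * (4 ^+ k * h).
Proof.
move=> sp pM h0 kh.
have M0 : 0 <= M by apply: le_trans (pM 1 _) => //; rewrite lexx andbT; lra.
have node0 : cheb_node k 0 = 1 by rewrite /cheb_node mul0r mul0r cos0.
have bound i : (i < (2 ^ k).+1)%N -> `|p.[cheb_node k i]| <= M.
  by rewrite ltnS => ik; apply: pM; rewrite /cheb_node ik cos_geN1 cos_le1.
have := @lagrange_extrapolation R _ _ (ltn0Sn (2 ^ k)) (@cheb_node_inj k)
  (@cheb_node_decr k) p (cheb2 R k) M (1 + h) sp (size_cheb2 R k) bound
  (@horner_cheb2_node k).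
rewrite node0 => /(_ ltac:(by rewrite lerDl)) /le_trans -> //.
rewrite [2 * M]mulrC -mulrA ler_wpM2l // !horner_cheb2.
have := iter_dbl_le h0 kh; have := iter_dbl_ge k (lexx (0 : R)).
rewrite mulr0 addr0; lra.
Qed.

Lemma size_comp_affine (p : {poly R}) (a b : R) :
  (size (p \Po (a *: 'X + b%:P)) <= size p)%N.
Proof.
have [->|p0] := eqVneq p 0; first by rewrite comp_poly0 size_poly0.
rewrite (leq_trans (size_comp_poly_leq _ _)) //.
rewrite -[X in (_ <= X)%N]prednK ?size_poly_gt0 // ltnS -[X in (_ <= X)%N]muln1 leq_mul2l.
apply/orP; right; rewrite -[1%N]/(2.-1) -!subn1 leq_sub2r //.
rewrite (leq_trans (size_polyD _ _)) // geq_max (leq_trans (size_scale_leq _ _)) ?size_polyX //=.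
by rewrite (leq_trans (size_polyC_leq1 _)).
Qed.

(** An affine map carrying [[-1, 1]] to [[-1, x]] moves the endpoint to [x]; its
ratio is at least [1 / 4]. When [y - x] is too large for [markov_endpoint], the
trivial bound [2 M] is already smaller than the claim. *)
Lemma markov_right (p : {poly R}) k (M x y : R) : (size p <= (2 ^ k).+1)%N ->
  (forall x, -1 <= x <= 1 -> `|p.[x]| <= M) -> - 2^-1 <= x -> x <= y -> y <= 1 ->
  `|p.[y] - p.[x]| <= 8 * M * 4 ^+ k * (y - x).
Proof.
move=> sp pM x2 xy y1.
have M0 : 0 <= M by apply: le_trans (pM 1 _) => //; rewrite lexx andbT; lra.
pose c := (x + 1) / 2; have c0 : 0 < c by rewrite /c; lra.
pose P := p \Po (c *: 'X + ((x - 1) / 2)%:P).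
have PE u : P.[u] = p.[c * u + (x - 1) / 2].
  by rewrite horner_comp !hornerE.
have sP : (size P <= (2 ^ k).+1)%N by exact: leq_trans (size_comp_affine _ _ _) sp.
pose h := (y - x) / c.
have hE : c * h = y - x by rewrite /h mulrC divfK // gt_eqF.
have c4 : 4^-1 <= c by rewrite /c; lra.
have h4 : h <= 4 * (y - x) by rewrite /h ler_pdivrMr //; have := ler_wpM2l (_ : 0 <= y - x) c4; rewrite subr_ge0 => /(_ xy); lra.
have h0 : 0 <= h by rewrite divr_ge0 ?subr_ge0 // ltW.
have k0 : 0 < 4 ^+ k :> R by rewrite exprn_gt0.
have B : 2 * M * (4 ^+ k * h) <= 8 * M * 4 ^+ k * (y - x).
  have -> : 8 * M * 4 ^+ k * (y - x) = 2 * M * (4 ^+ k * (4 * (y - x))) by ring.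
  by rewrite ler_wpM2l ?mulr_ge0 // ler_wpM2l // ltW.
apply: le_trans B.
have [kh|kh] := leP (4 ^+ k * h) 1.
  have := markov_endpoint sP _ h0 kh.
  rewrite !PE mulrDr hE mulr1.
  have -> : c + (y - x) + (x - 1) / 2 = y by rewrite /c; field.
  have -> : c + (x - 1) / 2 = x by rewrite /c; field.
  apply=> u /andP[u1 u2]; rewrite PE; apply: pM; rewrite /c; apply/andP; split; nra.
have px : `|p.[x]| <= M by apply: pM; lra.
have py : `|p.[y]| <= M by apply: pM; lra.
rewrite (le_trans (ler_normB _ _)) //; nra.
Qed.

(** Markov's inequality, integrated and with a worse constant: no derivative
occurs, the degree is rounded up to a power of two, and reflection reduces to
points away from [-1], except when [x] and [y] are far apart. *)
Lemma markov (p : {poly R}) d (M x y : R) : (0 < d)%N -> (size p <= d.+1)%N ->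
  (forall x, -1 <= x <= 1 -> `|p.[x]| <= M) -> -1 <= x <= 1 -> -1 <= y <= 1 ->
  `|p.[y] - p.[x]| <= 32 * M * d%:R ^+ 2 * `|y - x|.
Proof.
move=> d0 sp pM xI yI.
have M0 : 0 <= M by apply: le_trans (pM 1 _) => //; rewrite lexx andbT; lra.
wlog xy : x y xI yI / x <= y.
  move=> H; have [xy|/ltW yx] := leP x y; first exact: H.
  by rewrite distrC (distrC y); apply: H.
have [k kd] : exists k, (d <= 2 ^ k)%N /\ (2 ^ k <= 2 * d)%N.
  exists (up_log 2 d); split; first exact: up_logP.
  case: (ltnP 1 d) => d1; last by have -> : d = 1%N by case: (d) d0 d1 => [|[]].
  have := @up_log_bounds 2 d isT d1; case: up_log => [|m] /=; first lia.
  by rewrite expnS => /andP[/ltnW ? _]; rewrite leq_mul2l.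
have sp' : (size p <= (2 ^ k).+1)%N by rewrite (leq_trans sp) // ltnS kd.1.
have k4 : 4 ^+ k <= 4 * d%:R ^+ 2 :> R.
  have -> : 4 ^+ k = (2 ^ k)%:R ^+ 2 :> R by rewrite natrX -exprM mulnC exprM; congr (_ ^+ _); ring.
  have -> : 4 * d%:R ^+ 2 = (2 * d)%:R ^+ 2 :> R by rewrite natrM; ring.
  by rewrite ler_sqr ?nnegrE // ler_nat kd.2.
rewrite (ger0_norm (_ : 0 <= y - x)) ?subr_ge0 //.
have : 8 * M * 4 ^+ k * (y - x) <= 32 * M * d%:R ^+ 2 * (y - x).
  rewrite ler_wpM2r ?subr_ge0 //.
  have -> : 32 * M * d%:R ^+ 2 = 8 * M * (4 * d%:R ^+ 2) by ring.
  by rewrite ler_wpM2l // mulr_ge0.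
apply: le_trans.
have [x2|x2] := leP (- 2^-1) x; first by apply: markov_right => //; lra.
have [y2|y2] := leP y 2^-1.
  pose P := p \Po (- 'X).
  have PE u : P.[u] = p.[- u] by rewrite horner_comp !hornerE.
  have sP : (size P <= (2 ^ k).+1)%N.
    by have := size_comp_affine p (-1) 0; rewrite scaleN1r addr0 => /leq_trans ->.
  have PM u : -1 <= u <= 1 -> `|P.[u]| <= M by move=> uI; rewrite PE pM //; lra.
  have := @markov_right P k M (- y) (- x) sP PM _ _ _.
  rewrite !PE !opprK distrC [- x + y]addrC; apply; lra.
have px : `|p.[x]| <= M by apply: pM.
have py : `|p.[y]| <= M by apply: pM.
rewrite (le_trans (ler_normB _ _)) //.
have : 1 <= 4 ^+ k :> R by rewrite exprn_ege1 //; lra.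
have : M <= M * (y - x) by rewrite ler_peMr //; lra.
nra.
Qed.
End Markov.

(** * Peak polynomials and polynomial steps *)
Section Peak.
Variable R : realType.

Lemma horner_comp_affine (p : {poly R}) (a b x : R) :
  (p \Po (a *: 'X + b%:P)).[x] = p.[a * x + b].
Proof. by rewrite horner_comp !hornerE. Qed.

(** The Chebyshev polynomials of degree [3 ^ k] are the iterates of
[4 y^3 - 3 y]. Being odd, they are divisible by the variable, and the quotient
is large at 0, where it equals [3 ^ k] up to sign, but bounded on [[-1, 1]] by
the inverse of the variable. *)
Definition tpl (y : R) : R := y * (4 * y ^+ 2 - 3).
Definition cheb3 k : {poly R} := iter k (fun p => p * (4%:P * p ^+ 2 - 3%:P)) 'X.
Definition cheb3_div k : {poly R} := \prod_(i < k) (4%:P * cheb3 i ^+ 2 - 3%:P).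

Lemma horner_cheb3 k x : (cheb3 k).[x] = iter k tpl x.
Proof.
elim: k => [|k IH]; first by rewrite hornerX.
by rewrite /cheb3 !iterS -/(cheb3 k) /tpl !hornerE IH.
Qed.

Lemma cheb3_divE k : cheb3 k = 'X * cheb3_div k.
Proof.
elim: k => [|k IH]; first by rewrite /cheb3_div big_ord0 mulr1.
by rewrite /cheb3_div big_ord_recr /= mulrA -/(cheb3_div k) -IH.
Qed.

Lemma horner_cheb3_divS k x :
  (cheb3_div k.+1).[x] = (cheb3_div k).[x] * (4 * (iter k tpl x) ^+ 2 - 3).
Proof. by rewrite /cheb3_div big_ord_recr /= hornerM !hornerE horner_cheb3. Qed.

Lemma size_cheb3_div k : (size (cheb3_div k) <= 3 ^ k)%N.
Proof.
elim: k => [|k IH]; first by rewrite /cheb3_div big_ord0 size_poly1.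
have sT : (size (cheb3 k) <= (3 ^ k).+1)%N.
  by rewrite cheb3_divE mulrC (leq_trans (size_polyMleq _ _)) // size_polyX addn2.
rewrite /cheb3_div big_ord_recr /= (leq_trans (size_polyMleq _ _)) // -/(cheb3_div k).
have : (size (4%:P * cheb3 k ^+ 2 - 3%:P)%R <= (2 * 3 ^ k).+1)%N.
  rewrite (leq_trans (size_polyD _ _)) // geq_max size_polyN (leq_trans (size_polyC_leq1 _)) ?andbT //.
  rewrite mul_polyC (leq_trans (size_scale_leq _ _)) // expr2 (leq_trans (size_polyMleq _ _)) //.
  lia.
rewrite expnS; lia.
Qed.

Lemma iter_tpl_norm_le1 k (x : R) : `|x| <= 1 -> `|iter k tpl x| <= 1.
Proof.
move=> x1; elim: k => [//|k]; rewrite iterS; move: (iter _ _ _) => z z1.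
rewrite ler_norml in z1; case/andP: z1 => z1 z2.
have e1 : 1 - tpl z = (1 - z) * (2 * z + 1) ^+ 2 by rewrite /tpl; ring.
have e2 : 1 + tpl z = (1 + z) * (2 * z - 1) ^+ 2 by rewrite /tpl; ring.
have p1 : 0 <= 1 - tpl z by rewrite e1 mulr_ge0 ?sqr_ge0 //; lra.
have p2 : 0 <= 1 + tpl z by rewrite e2 mulr_ge0 ?sqr_ge0 //; lra.
by rewrite ler_norml; apply/andP; split; lra.
Qed.

Lemma cheb3_div_le k (x : R) : `|x| <= 1 -> `|(cheb3_div k).[x]| <= 3 ^+ k.
Proof.
move=> x1; elim: k => [|k IH]; first by rewrite /cheb3_div big_ord0 !hornerE normr1.
rewrite horner_cheb3_divS normrM [3 ^+ k.+1]exprSr ler_pM //.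
have := iter_tpl_norm_le1 k x1; move: (iter _ _ _) => z; rewrite ler_norml => /andP[z1 z2].
by rewrite ler_norml; apply/andP; split; nra.
Qed.

Lemma cheb3_div_decay k (x : R) : `|x| <= 1 -> `|(cheb3_div k).[x]| * `|x| <= 1.
Proof.
move=> x1; rewrite -normrM mulrC.
have -> : x * (cheb3_div k).[x] = (cheb3 k).[x] by rewrite cheb3_divE hornerM hornerX.
by rewrite horner_cheb3 iter_tpl_norm_le1.
Qed.

(** The quotient behaves like [sin u / u] with [u = 3 ^ k x], and the induction is
on the Taylor bound [1 - u^2 / 6]: multiplying it by [3 - 4 v^2], where
[v = u / 3], gives the same bound for [u] with a remainder in [v^4]. *)
Lemma cheb3_div_ge k (x : R) : 3 ^+ k * `|x| <= 1 -> 3 ^+ k * (5 / 6) <= `|(cheb3_div k).[x]|.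
Proof.
move=> kx; suff : 3 ^+ k * (1 - 6^-1 * (3 ^+ k * `|x|) ^+ 2) <= `|(cheb3_div k).[x]|.
  apply: le_trans; rewrite ler_wpM2l ?exprn_ge0 //.
  have : (3 ^+ k * `|x|) ^+ 2 <= 1 by rewrite expr_le1 // mulr_ge0 // exprn_ge0.
  lra.
elim: k kx => [|k IH] kx.
  have -> : (cheb3_div 0).[x] = 1 by rewrite /cheb3_div big_ord0 hornerE.
  by rewrite normr1 expr0 !mul1r gerBl mulr_ge0 ?sqr_ge0.
have v0 : 0 <= 3 ^+ k * `|x| by rewrite mulr_ge0 // exprn_ge0.
rewrite exprS -mulrA in kx; have {}IH := IH ltac:(lra).
rewrite horner_cheb3_divS normrM.
have : `|iter k tpl x| <= 3 ^+ k * `|x|.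
  have x1 : `|x| <= 1.
    apply: le_trans kx; rewrite mulrA -exprS ler_peMl // exprn_ege1 //; lra.
  elim: k {IH v0 kx} => [|k IH]; first by rewrite mul1r.
  have -> : 3 ^+ k.+1 * `|x| = 3 ^+ k * `|x| * 3 by rewrite exprS; ring.
  rewrite iterS normrM ler_pM //.
  have := iter_tpl_norm_le1 k x1; move: (iter _ _ _) => z; rewrite ler_norml => /andP[z1 z2].
  by rewrite ler_norml; apply/andP; split; nra.
rewrite exprS; move: (iter _ _ _) => z; set v := 3 ^+ k * `|x| in v0 kx IH *.
have -> : 3 * 3 ^+ k * `|x| = 3 * v by rewrite /v; ring.
move=> zv; have z2 : z ^+ 2 <= v ^+ 2 by rewrite -[z ^+ 2]real_normK ?num_real // ler_sqr ?nnegrE.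
have v2 : v ^+ 2 <= 9^-1 by rewrite expr2; nra.
have -> : `|4 * z ^+ 2 - 3| = 3 - 4 * z ^+ 2 by rewrite ler0_norm; lra.
set A : R := 3 ^+ k in IH *; have A0 : 0 < A by rewrite exprn_gt0.
apply: le_trans (ler_pM _ _ IH (_ : 3 - 4 * v ^+ 2 <= _)); last lra.
- have -> : A * (1 - 6^-1 * v ^+ 2) * (3 - 4 * v ^+ 2) =
    3 * A * (1 - 6^-1 * (3 * v) ^+ 2) + A * (2 / 3 * v ^+ 2 ^+ 2) by field.
  have A1 : 0 <= A by exact: ltW.
  by rewrite lerDl; apply: mulr_ge0 => //; apply: mulr_ge0; rewrite ?sqr_ge0 //; lra.
- by rewrite mulr_ge0 ?ltW //; lra.
- lra.
Qed.

(** The square of this polynomial is a peak at 0 of height one and width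
[3 ^- k], with tails that decrease quadratically. *)
Definition peak k : {poly R} := (3 ^- k) *: cheb3_div k.

Lemma peak_le1 k (x : R) : `|x| <= 1 -> (peak k).[x] ^+ 2 <= 1.
Proof.
move=> x1; rewrite -[_ ^+ 2]real_normK ?num_real // expr_le1 // /peak hornerZ normrM.
rewrite ger0_norm ?invr_ge0 ?exprn_ge0 // mulrC ler_pdivrMr ?exprn_gt0 // mul1r.
exact: cheb3_div_le.
Qed.

Lemma peak_decay k (x : R) : `|x| <= 1 -> (peak k).[x] ^+ 2 * (3 ^+ k * x) ^+ 2 <= 1.
Proof.
move=> x1; rewrite -exprMn -[_ ^+ 2]real_normK ?num_real // expr_le1 // /peak hornerZ.
rewrite mulrACA mulVf ?expf_neq0 // mul1r normrM.
exact: cheb3_div_decay.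
Qed.

Lemma peak_ge k (x : R) : 3 ^+ k * `|x| <= 1 -> 2^-1 <= (peak k).[x] ^+ 2.
Proof.
move=> /cheb3_div_ge h; rewrite -[_ ^+ 2]real_normK ?num_real //.
have : 5 / 6 <= `|(peak k).[x]|.
  rewrite /peak hornerZ normrM ger0_norm ?invr_ge0 ?exprn_ge0 // [3 ^- k * _]mulrC.
  by rewrite ler_pdivlMr ?exprn_gt0 // [5 / 6 * _]mulrC.
move: `|_| => u; nra.
Qed.

(** A bounded increasing function whose unit steps dominate [(1 + |u|) ^- 2], so
that sums of the tails of translated peaks telescope. *)
Definition sigmoid (u : R) := u / (1 + `|u|).

Lemma sigmoid_step (u : R) : (`|u| + 1) ^- 2 <= 2 * (sigmoid (u + 1) - sigmoid u).
Proof.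
rewrite /sigmoid; have [u0|u0] := leP 0 u.
  rewrite !ger0_norm //; last lra.
  rewrite -subr_ge0.
  have -> : 2 * ((u + 1) / (1 + (u + 1)) - u / (1 + u)) - (u + 1) ^- 2 =
     u / ((u + 1) ^+ 2 * (u + 2)) by field; do ?[apply/andP; split]; apply: lt0r_neq0; lra.
  by rewrite divr_ge0 // mulr_ge0 ?sqr_ge0; lra.
have [u1|u1] := leP u (-1).
  rewrite !ler0_norm; try lra.
  rewrite -[u]opprK; set v := - u; have v1 : 1 <= v by rewrite /v; lra.
  rewrite opprK -subr_ge0.
  have -> : 2 * ((- v + 1) / (1 + - (- v + 1)) - - v / (1 + v)) - (v + 1) ^- 2 =
     (2 + v) / ((1 + v) ^+ 2 * v) by field; do ?[apply/andP; split]; apply: lt0r_neq0; lra.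
  by rewrite divr_ge0 ?mulr_ge0 ?sqr_ge0 //; lra.
rewrite (ler0_norm (ltW u0)) ger0_norm; last lra.
have h1 : 2^-1 * (u + 1) <= (u + 1) / (1 + (u + 1)) by rewrite ler_pdivlMr; nra.
apply: (@le_trans _ _ (2 * (2^-1 * (u + 1) - u / (1 - u)))); last by lra.
rewrite -subr_ge0 -[u]opprK; set v := - u; have v0 : 0 < v by rewrite /v; lra.
have v1 : v < 1 by rewrite /v; lra.
have -> : 2 * (2^-1 * (- v + 1) - - v / (1 - - v)) - (- - v + 1) ^- 2 =
   v * (3 + v - v ^+ 2) / (1 + v) ^+ 2 by field; do ?[apply/andP; split]; apply: lt0r_neq0; lra.
rewrite divr_ge0 ?sqr_ge0 // mulr_ge0; nra.
Qed.

Lemma sigmoid_norm_le1 (u : R) : `|sigmoid u| <= 1.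
Proof.
rewrite /sigmoid normrM normfV [`|1 + _|]ger0_norm ?addr_ge0 // ler_pdivrMr ?mul1r ?lerDr // ltr_pwDl.
Qed.

(** The peaks of width [1 / N], [N = 3 ^ k], centred at the points [- j / N] for
[j <= N] cover [[-1, 0]], which gives the lower bound. Their tails add up to a
bounded quantity everywhere, and to [O(1 / (N t))] at [t > 0]. *)
Lemma step_poly k : exists ps : seq {poly R},
  [/\ forall p, p \in ps -> (size p <= 3 ^ k)%N,
      forall t : R, -1 <= t <= 0 -> 2^-1 <= \sum_(p <- ps) p.[t] ^+ 2,
      forall t : R, -1 <= t <= 1 -> \sum_(p <- ps) p.[t] ^+ 2 <= 36 &
      forall t : R, 0 <= t <= 1 -> t * \sum_(p <- ps) p.[t] ^+ 2 <= 18 / 3 ^+ k].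
Proof.
set N := (3 ^ k)%N; have NE : 3 ^+ k = N%:R :> R by rewrite /N natrX.
have N0 : 0 < N%:R :> R by rewrite -NE exprn_gt0.
(* As t + j / N ranges over [-1, 2], it is halved to stay in [-1, 1]. *)
pose arg (j : nat) (t : R) := 2^-1 * t + 2^-1 * (j%:R / N%:R).
pose pj j := peak k \Po (2^-1 *: 'X + (2^-1 * (j%:R / N%:R))%:P).
have pjE j t : (pj j).[t] = (peak k).[arg j t] by exact: horner_comp_affine.
exists [seq pj j | j <- iota 0 N.+1].
have sumE t : \sum_(p <- [seq pj j | j <- iota 0 N.+1]) p.[t] ^+ 2 =
    \sum_(j < N.+1) (peak k).[arg j t] ^+ 2.
  by rewrite big_map -[iota 0 N.+1]/(index_iota 0 N.+1) big_mkord; under eq_bigr do rewrite pjE.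
have argN j t : N%:R * arg j t = 2^-1 * (N%:R * t + j%:R).
  by rewrite /arg; field; rewrite gt_eqF.
have arg1 (j : 'I_N.+1) t : -1 <= t <= 1 -> `|arg j t| <= 1.
  move=> tI; have : 0 <= (j%:R / N%:R : R) <= 1.
    by rewrite divr_ge0 ?ler0n //= ler_pdivrMr // mul1r ler_nat -ltnS ltn_ord.
  by rewrite /arg ler_norml => jN; lra.
have key (F v : R) : 0 <= F -> 0 <= v -> F <= 1 -> F * (2^-1 ^+ 2 * v ^+ 2) <= 1 ->
    F * (v + 1) ^+ 2 <= 9.
  move=> F0 v0 F1 Fv; have [v2|v2] := leP v 2.
    have v9 : (v + 1) ^+ 2 <= 9 by nra.
    by apply: le_trans v9; rewrite ler_piMl // sqr_ge0.
  have : (v + 1) ^+ 2 <= 9 / 4 * v ^+ 2 by nra.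
  by move=> /(ler_wpM2l F0); lra.
have term (j : 'I_N.+1) t : -1 <= t <= 1 ->
    (peak k).[arg j t] ^+ 2 <= 18 * (sigmoid (N%:R * t + j.+1%:R) - sigmoid (N%:R * t + j%:R)).
  move=> tI; set u := N%:R * t + j%:R.
  have -> : N%:R * t + j.+1%:R = u + 1 by rewrite /u -addrA natr1.
  apply: (@le_trans _ _ (9 * (`|u| + 1) ^- 2)); last by have := sigmoid_step u; lra.
  rewrite ler_pdivlMr ?exprn_gt0 ?ltr_pwDr //.
  move: (peak_decay k (arg1 j t tI)) (peak_le1 k (arg1 j t tI)) => dec le1.
  move: dec.
  rewrite NE argN -/u exprMn -[u ^+ 2]real_normK ?num_real //.
  by apply: key; rewrite ?sqr_ge0 ?normr_ge0.
have bound t : -1 <= t <= 1 -> \sum_(j < N.+1) (peak k).[arg j t] ^+ 2 <=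
    18 * (sigmoid (N%:R * t + N.+1%:R) - sigmoid (N%:R * t)).
  move=> tI; apply: le_trans (ler_sum _ (fun j _ => term j t tI)) _.
  rewrite -mulr_sumr ler_wpM2l //.
  rewrite -(big_mkord xpredT (fun j => sigmoid (N%:R * t + j.+1%:R) - sigmoid (N%:R * t + j%:R))).
  by rewrite telescope_sumr // addr0.
split.
- move=> p /mapP[j _ ->]; rewrite /pj (leq_trans (size_comp_affine _ _ _)) //.
  by rewrite (leq_trans (size_scale_leq _ _)) // size_cheb3_div.
- move=> t tI; rewrite sumE.
  have tN0 : 0 <= - t * N%:R by rewrite mulr_ge0 ?ler0n //; lra.
  have /andP[j1 j2] := truncn_itv tN0.
  set j := Num.truncn (- t * N%:R) in j1 j2.
  have jN : (j < N.+1)%N.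
    by rewrite ltnS -(ler_nat R) (le_trans j1) // ler_piMl // ?ler0n //; lra.
  rewrite (bigD1 (Ordinal jN)) //= (@le_trans _ _ ((peak k).[arg j t] ^+ 2)) ?peak_ge //.
    rewrite NE -{1}(ger0_norm (ltW N0)) -normrM argN ler_norml.
    by rewrite -natr1 in j2; apply/andP; split; lra.
  by rewrite lerDl sumr_ge0 // => i _; rewrite sqr_ge0.
- move=> t tI; rewrite sumE (le_trans (bound t tI)) //.
  have := sigmoid_norm_le1 (N%:R * t + N.+1%:R); have := sigmoid_norm_le1 (N%:R * t).
  by rewrite !ler_norml => ? ?; lra.
- move=> t tI; rewrite sumE NE ler_pdivlMr //.
  have /bound : -1 <= t <= 1 by lra.
  have := sigmoid_norm_le1 (N%:R * t + N.+1%:R); rewrite ler_norml => /andP[_ s1].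
  have u0 : 0 <= N%:R * t by rewrite mulr_ge0 //; lra.
  have : N%:R * t * (1 - sigmoid (N%:R * t)) <= 1.
    rewrite /sigmoid ger0_norm //.
    have -> : 1 - N%:R * t / (1 + N%:R * t) = (1 + N%:R * t)^-1 by field; rewrite gt_eqF //; lra.
    by rewrite ler_pdivrMr; lra.
  move: (sigmoid (N%:R * t)) (sigmoid _) s1 => s s' s1 us; move: (\sum_(j < _) _) => S Sb.
  have -> : t * S * N%:R = N%:R * t * S by ring.
  apply: le_trans (ler_wpM2l u0 Sb) _.
  have : N%:R * t * (18 * (s' - s)) <= N%:R * t * (18 * (1 - s)) by rewrite ler_wpM2l //; lra.
  nra.
Qed.
End Peak.

(** * Near-Fekete nodes *)
Section Fekete.
Variables (R : realType) (n : nat).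
Hypothesis n0 : (0 < n)%N.

Definition node_prod (x : nat -> R) (y : R) (i : 'I_n) : R :=
  \prod_(j < n | j != i) `|y - x j|.
Definition vandermonde_sq (x : nat -> R) : R := \prod_(i < n) node_prod x (x i) i.

Lemma vandermonde_sqD1 x (i : 'I_n) : vandermonde_sq x =
  node_prod x (x i) i ^+ 2 *
  \prod_(a < n | a != i) \prod_(j < n | (j != a) && (j != i)) `|x a - x j|.
Proof.
rewrite /vandermonde_sq (bigD1 i) //= expr2 -mulrA; congr (_ * _).
rewrite -big_split /=; apply: eq_bigr => a ai.
by rewrite {1}/node_prod (bigD1 i) 1?eq_sym //= distrC.
Qed.

(** Moving the node [x i] to [y] multiplies the squared Vandermonde determinant
by the square of the basis polynomial [i] at [y]. If the squared determinant
exceeds half of its supremum, this factor is less than 2; exact maximizers would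
give the bound 1. *)
Lemma fekete_nodes : exists x : nat -> R,
  [/\ injective x, forall i, (i < n)%N -> -1 <= x i <= 1 &
      forall (i : 'I_n) (y : R), -1 <= y <= 1 ->
        `|(tnth (n.-lagrange x) i : {poly R}).[y]| <= 2].
Proof.
pose P (x : nat -> R) := forall i, (i < n)%N -> -1 <= x i <= 1.
pose E := [set vandermonde_sq x | x in P].
have dist2 (a b : R) : -1 <= a <= 1 -> -1 <= b <= 1 -> 0 <= `|a - b| <= 2.
  by move=> aI bI; rewrite normr_ge0 ler_norml; lra.
pose x0 (i : nat) : R := i.+1%:R^-1.
have x0I : P x0.
  move=> i _; rewrite /x0; have : 0 < i.+1%:R^-1 :> R by rewrite invr_gt0.
  have : i.+1%:R^-1 <= 1 :> R by rewrite invf_le1 ?ler1n.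
  by move: (_^-1) => u u1 u0; lra.
have V0 : 0 < vandermonde_sq x0.
  apply: prodr_gt0 => i _; apply: prodr_gt0 => j ji; rewrite normr_gt0 subr_eq0 /x0.
  by rewrite (inj_eq invr_inj) eqr_nat eqSS eq_sym.
have supE : has_sup E.
  split; first by exists (vandermonde_sq x0), x0.
  exists (\prod_(i < n) \prod_(j < n | j != i) 2) => _ [x xI <-].
  apply: ler_prod => i _; rewrite prodr_ge0 //=; apply: ler_prod => j _.
  by apply: dist2; apply: xI.
have sup0 : 0 < sup E by apply: (lt_le_trans V0); apply: ub_le_sup; [exact: supE.2|exists x0].
have half : 0 < sup E / 2 by lra.
have [_ [x xI <-] xE] := sup_adherent half supE.
have Vx : sup E < 2 * vandermonde_sq x by lra.
have Vx0 : 0 < vandermonde_sq x by lra.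
have xneq i j : (i < n)%N -> (j < n)%N -> i != j -> x i != x j.
  move=> iN jN ij; apply: contraTneq Vx0 => xij.
  rewrite /vandermonde_sq (bigD1 (Ordinal iN)) //= /node_prod (bigD1 (Ordinal jN)) /=; last first.
    by rewrite -val_eqE /= eq_sym.
  by rewrite xij subrr normr0 !mul0r ltxx.
(* Beyond the first n nodes the sequence only has to remain injective. *)
pose z (i : nat) : R := if (i < n)%N then x i else i.+2%:R.
have zx i : (i < n)%N -> z i = x i by rewrite /z => ->.
have big i : 1 < i.+2%:R :> R by rewrite ltr1n.
have z_inj : injective z.
  move=> i j; rewrite /z; case: ltnP => iN; case: ltnP => jN.
  - by move=> xij; apply/eqP; apply: contraTT isT => ij; have := xneq _ _ iN jN ij; rewrite xij eqxx.
  - by move=> xij; exfalso; have := xI _ iN; have := big j; rewrite xij; move: (_.+2%:R) => u; lra.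
  - by move=> xij; exfalso; have := xI _ jN; have := big i; rewrite -xij; move: (_.+2%:R) => u; lra.
  - by move/eqP; rewrite eqr_nat => /eqP[].
exists z; split => // [i iN|i y yI]; first by rewrite zx // xI.
have A0 : 0 < node_prod x (x i) i.
  by apply: prodr_gt0 => j ji; rewrite normr_gt0 subr_eq0 xneq // -?val_eqE //= eq_sym.
have -> : `|(tnth (n.-lagrange z) i : {poly R}).[y]| = node_prod x y i / node_prod x (x i) i.
  rewrite horner_lagrange // normr_prod /node_prod -prodfV -big_split /=.
  by apply: eq_bigr => j _; rewrite normrM normfV !zx.
rewrite ler_pdivrMr //.
pose x' (j : nat) := if j == i :> nat then y else x j.
have x'I : P x' by move=> j jN; rewrite /x'; case: ifP => // _; exact: xI.
have : vandermonde_sq x' <= sup E by apply: ub_le_sup; [exact: supE.2|exists x'].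
rewrite (vandermonde_sqD1 x' i).
have -> : node_prod x' (x' i) i = node_prod x y i.
  by rewrite /node_prod {1}/x' eqxx; apply: eq_bigr => j ji; rewrite /x' (negbTE (_ : j != i :> nat)).
move: Vx; rewrite (vandermonde_sqD1 x i).
under [X in _ -> _ * X <= _ -> _]eq_bigr => a ai do under eq_bigr => j /andP[_ ji] do
  rewrite /x' (negbTE (_ : a != i :> nat)) // (negbTE (_ : j != i :> nat)) //.
set B := \prod_(a < n | _) _ => h1 h2.
have B0 : 0 < B by have := Vx0; rewrite (vandermonde_sqD1 x i) -/B pmulr_rgt0 // exprn_gt0.
have := le_lt_trans h2 h1; rewrite mulrA ltr_pM2r // => h3.
have y0 : 0 <= node_prod x y i by exact: prodr_ge0.
by rewrite -ler_sqr ?nnegrE ?mulr_ge0 ?(ltW A0) // exprMn; have := sqr_ge0 (node_prod x (x i) i); lra.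
Qed.
End Fekete.

(** * Evaluation, degree and substitution *)
Arguments pdeg {R n}%_nat_scope p%_ring_scope.
Section MpolyDegree.
Variables (R : realType) (n : nat).
Implicit Types (p q : mpoly n R) (c : R).

Lemma pevalD p q x : peval (p + q) x = peval p x + peval q x.
Proof. exact: mevalD. Qed.
Lemma pevalB p q x : peval (p - q) x = peval p x - peval q x.
Proof. exact: mevalB. Qed.
Lemma pevalM p q x : peval (p * q) x = peval p x * peval q x.
Proof. exact: mevalM. Qed.
Lemma pevalZ c p x : peval (c *: p) x = c * peval p x.
Proof. exact: mevalZ. Qed.
Lemma pevalC c x : peval (mpolyC n c) x = c.
Proof. exact: mevalC. Qed.
Lemma pevalX (i : 'I_n) x : peval (mpolyX R (mnm1 i)) x = x ord0 i.
Proof. exact: mevalXU. Qed.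
Lemma peval_sum I (r : seq I) (P : pred I) (F : I -> mpoly n R) x :
  peval (\sum_(i <- r | P i) F i) x = \sum_(i <- r | P i) peval (F i) x.
Proof. exact: (raddf_sum (meval (x ord0))). Qed.

Lemma pdeg0 : pdeg (0 : mpoly n R) = 0%N.
Proof. by rewrite /pdeg mmeasure0. Qed.

Lemma pdegC c : pdeg (mpolyC n c) = 0%N.
Proof. by rewrite /pdeg msizeC; case: (c != 0). Qed.

Lemma pdegX (i : 'I_n) : pdeg (mpolyX R (mnm1 i) : mpoly n R) = 1%N.
Proof. by rewrite /pdeg msizeX mdeg1. Qed.

Lemma pdegD p q k : (pdeg p <= k)%N -> (pdeg q <= k)%N -> (pdeg (p + q) <= k)%N.
Proof.
rewrite /pdeg => pk qk; have := msizeD_le p q; rewrite -!subn1 !leq_subLR !add1n in pk qk *.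
by move=> /leq_trans -> //; rewrite geq_max pk qk.
Qed.

Lemma pdegM p q : (pdeg (p * q) <= pdeg p + pdeg q)%N.
Proof.
have [->|p0] := eqVneq p 0; first by rewrite mul0r pdeg0.
have [->|q0] := eqVneq q 0; first by rewrite mulr0 pdeg0.
rewrite /pdeg msizeM //; have := msize_poly_eq0 p; have := msize_poly_eq0 q.
rewrite (negbTE p0) (negbTE q0); move: (mmeasure _ p) (mmeasure _ q) => [|a] [|b] //= _ _.
by rewrite addnS.
Qed.

Lemma pdegZ c p : (pdeg (c *: p) <= pdeg p)%N.
Proof. by rewrite -mul_mpolyC (leq_trans (pdegM _ _)) // pdegC. Qed.

Lemma pdegXn p k : (pdeg (p ^+ k) <= k * pdeg p)%N.
Proof.
elim: k => [|k IH]; first by rewrite expr0 -mpolyC1 pdegC.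
by rewrite exprS mulSn (leq_trans (pdegM _ _)) // leq_add2l.
Qed.

Lemma pdeg_sum I (r : seq I) (P : pred I) (F : I -> mpoly n R) k :
  (forall i, P i -> (pdeg (F i) <= k)%N) -> (pdeg (\sum_(i <- r | P i) F i) <= k)%N.
Proof.
move=> Fk; elim/big_rec: _ => [|i p Pi IH]; first by rewrite pdeg0.
by apply: pdegD => //; apply: Fk.
Qed.

Definition psubst (q : mpoly n R) (p : {poly R}) : mpoly n R := horner_alg q p.

Lemma psubstC q c : psubst q c%:P = mpolyC n c.
Proof. by rewrite /psubst horner_algC alg_mpolyC. Qed.
Lemma psubstX q : psubst q 'X = q.
Proof. exact: horner_algX. Qed.
Lemma psubstD q a b : psubst q (a + b) = psubst q a + psubst q b.
Proof. exact: rmorphD. Qed.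
Lemma psubstB q a b : psubst q (a - b) = psubst q a - psubst q b.
Proof. exact: rmorphB. Qed.
Lemma psubstM q a b : psubst q (a * b) = psubst q a * psubst q b.
Proof. exact: rmorphM. Qed.
Lemma psubstXn q a k : psubst q (a ^+ k) = psubst q a ^+ k.
Proof. exact: rmorphXn. Qed.
Lemma psubst_sum q I (r : seq I) (P : pred I) (F : I -> {poly R}) :
  psubst q (\sum_(i <- r | P i) F i) = \sum_(i <- r | P i) psubst q (F i).
Proof. exact: (raddf_sum (horner_alg q)). Qed.
Lemma psubstZ q c a : psubst q (c *: a) = c *: psubst q a.
Proof. by rewrite -mul_polyC psubstM psubstC mul_mpolyC. Qed.

Lemma peval_psubst q (p : {poly R}) x : peval (psubst q p) x = p.[peval q x].
Proof.
elim/poly_ind: p => [|p c IH].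
  by rewrite /psubst rmorph0 horner0; exact: meval0.
by rewrite psubstD psubstM psubstX psubstC pevalD pevalM pevalC IH !hornerE.
Qed.

Lemma pdeg_psubst q (p : {poly R}) : (pdeg (psubst q p) <= (size p).-1 * pdeg q)%N.
Proof.
rewrite -{1}[p]coefK poly_def psubst_sum; apply: pdeg_sum => i _.
rewrite psubstZ (leq_trans (pdegZ _ _)) // psubstXn psubstX (leq_trans (pdegXn _ _)) //.
by rewrite leq_mul2r; apply/orP; right; case: (size p) i => [[]|k i] //=; rewrite -ltnS.
Qed.

End MpolyDegree.

(** * Sums of squares *)
Section SumsOfSquares.
Variables (R : realType) (n : nat).
Implicit Types (p q : mpoly n R) (c : R).

Lemma sos0 : sos (0 : mpoly n R).
Proof. by exists [::]; rewrite big_nil. Qed.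

Lemma sosD p q : sos p -> sos q -> sos (p + q).
Proof. by move=> [s ->] [t ->]; exists (s ++ t); rewrite big_cat. Qed.

Lemma sos_sqr p : sos (p ^+ 2).
Proof. by exists [:: p]; rewrite big_seq1. Qed.

Lemma sosM p q : sos p -> sos q -> sos (p * q).
Proof.
move=> [s ->] [t ->]; exists [seq a * b | a <- s, b <- t].
rewrite big_allpairs_dep mulr_suml; apply: eq_bigr => a _.
by rewrite mulr_sumr; apply: eq_bigr => b _; rewrite exprMn.
Qed.

Lemma sosC c : 0 <= c -> sos (mpolyC n c).
Proof.
by move=> c0; rewrite -[c]sqr_sqrtr // expr2 mpolyCM -expr2; exact: sos_sqr.
Qed.

Lemma sosZ c p : 0 <= c -> sos p -> sos (c *: p).
Proof. by move=> c0 sp; rewrite -mul_mpolyC; apply: sosM => //; exact: sosC. Qed.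

Lemma sos_sum I (r : seq I) (P : pred I) (F : I -> mpoly n R) :
  (forall i, P i -> sos (F i)) -> sos (\sum_(i <- r | P i) F i).
Proof. by move=> sF; elim/big_rec: _ => [|i p Pi IH]; [exact: sos0|apply: sosD => //; exact: sF]. Qed.

Lemma sos_ge0 p x : sos p -> 0 <= peval p x.
Proof.
move=> [s ->]; rewrite peval_sum sumr_ge0 // => q _.
by rewrite expr2 pevalM -expr2 sqr_ge0.
Qed.

(** A positive univariate polynomial is a product of positive constants and of
sums of two squares. *)
Lemma sos_psubst q (p : {poly R}) : (forall x, 0 < p.[x]) -> sos (psubst q p).
Proof.
move=> p0; refine (@pos_poly_ind R (fun=> True) (fun p : {poly R} => sos (psubst q p)) _ _ _ _ _ _ _ p _) => //.
- by exists 0.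
- by move=> a; left.
- by move=> c c0; rewrite psubstC; apply: sosC; exact: ltW.
- by move=> a b _ _ sa sb; rewrite psubstM; exact: sosM.
- move=> a b _; rewrite psubstD psubstXn psubstC; apply: sosD; first exact: sos_sqr.
  by apply: sosC; exact: sqr_ge0.
- by move=> a /(_ a I); rewrite ltxx.
- by move=> a /(_ a I); rewrite ltxx.
Qed.
End SumsOfSquares.

(** * The quadratic module of the unit ball *)
Section BallModule.
Variables (R : realType) (n : nat).
Notation P := (mpoly n R).
Implicit Types (p q a b : P) (c : R).

Definition ball_poly : P := 1 - \sum_(i < n) mpolyX R (mnm1 i) ^+ 2.

Definition ball_qmodule (E : nat) : set P :=
  [set p | exists a b, [/\ sos a, sos b, (pdeg a <= E)%N,
     (pdeg (b * ball_poly) <= E)%N & p = a + b * ball_poly]].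

Lemma ball_qmodule_sos E p : sos p -> (pdeg p <= E)%N -> ball_qmodule E p.
Proof.
move=> sp pE; exists p, 0; split => //; first exact: sos0.
  by rewrite mul0r pdeg0.
by rewrite mul0r addr0.
Qed.

Lemma ball_qmoduleC E c : 0 <= c -> ball_qmodule E (mpolyC n c).
Proof. by move=> c0; apply: ball_qmodule_sos; [exact: sosC|rewrite pdegC]. Qed.

Lemma ball_qmodule_le E E' p : (E <= E')%N -> ball_qmodule E p -> ball_qmodule E' p.
Proof.
by move=> EE [a [b [sa sb da db ->]]]; exists a, b; split => //; apply: leq_trans EE.
Qed.

Lemma ball_qmoduleD E p q : ball_qmodule E p -> ball_qmodule E q -> ball_qmodule E (p + q).
Proof.
move=> [a [b [sa sb da db ->]]] [a' [b' [sa' sb' da' db' ->]]].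
exists (a + a'), (b + b'); split; try exact: sosD; try exact: pdegD.
- by rewrite mulrDl; exact: pdegD.
- by rewrite mulrDl addrACA.
Qed.

(** With a single generator [w], the product of the two terms in [w] has the
factor [w ^ 2] and is a sum of squares: the module is a preordering. *)
Lemma ball_qmoduleM E E' p q : ball_qmodule E p -> ball_qmodule E' q ->
  ball_qmodule (E + E') (p * q).
Proof.
move=> [a [b [sa sb da db ->]]] [a' [b' [sa' sb' da' db' ->]]].
set w := ball_poly in db db' *.
exists (a * a' + b * b' * w ^+ 2), (a * b' + b * a'); split.
- by apply: sosD; [exact: sosM|apply: sosM; [exact: sosM|exact: sos_sqr]].
- by apply: sosD; exact: sosM.
- apply: pdegD; first by rewrite (leq_trans (pdegM _ _)) // leq_add.
  have -> : b * b' * w ^+ 2 = (b * w) * (b' * w) by ring.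
  by rewrite (leq_trans (pdegM _ _)) // leq_add.
- rewrite mulrDl; apply: pdegD.
    by rewrite -mulrA (leq_trans (pdegM _ _)) // leq_add.
  by rewrite mulrAC (leq_trans (pdegM _ _)) // leq_add.
- by rewrite -/w; ring.
Qed.

Lemma ball_qmoduleZ E c p : 0 <= c -> ball_qmodule E p -> ball_qmodule E (c *: p).
Proof.
move=> c0 Qp; rewrite -mul_mpolyC -[E]add0n.
by apply: ball_qmoduleM => //; exact: ball_qmoduleC.
Qed.

(** [2 (1 + x_i) = (1 + x_i)^2 + sum_(j != i) x_j^2 + (1 - |x|^2)], and likewise
for [- x_i]. *)
Lemma ball_qmodule_half_line (s : bool) i :
  ball_qmodule 2 (1 + (-1) ^+ s *: mpolyX R (mnm1 i)).
Proof.
set x := mpolyX R (mnm1 i).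
have dx : pdeg x = 1%N by exact: pdegX.
have d2 k : (pdeg (mpolyX R (mnm1 k) ^+ 2 : P) <= 2)%N by rewrite (leq_trans (pdegXn _ _)) // pdegX.
have dw : (pdeg ball_poly <= 2)%N.
  rewrite /ball_poly -mulN1r; apply: pdegD; first by rewrite -mpolyC1 pdegC.
  rewrite (leq_trans (pdegM _ _)) //  -mpolyCN pdegC add0n.
  exact: pdeg_sum.
pose a : P := (1 + (-1) ^+ s *: x) ^+ 2 + \sum_(j < n | j != i) mpolyX R (mnm1 j) ^+ 2.
have dl : (pdeg (1 + (-1) ^+ s *: x) <= 1)%N.
  by apply: pdegD; rewrite -?mpolyC1 ?pdegC // (leq_trans (pdegZ _ _)) // dx.
have xx : ((-1) ^+ s *: x) ^+ 2 = x ^+ 2.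
  by rewrite exprZn -exprM mulnC exprM sqrrN expr1n expr1n scale1r.
have wE : ball_poly = 1 - (x ^+ 2 + \sum_(j < n | j != i) mpolyX R (mnm1 j) ^+ 2).
  by rewrite /ball_poly (bigD1 i).
have -> : 1 + (-1) ^+ s *: x = 2^-1 *: (a + 1 * ball_poly).
  rewrite wE /a; set S := \sum_(j < n | _) _.
  have -> : (1 + (-1) ^+ s *: x) ^+ 2 + S + 1 * (1 - (x ^+ 2 + S)) =
    (1 + (-1) ^+ s *: x) *+ 2 by rewrite mulr2n -xx; move: (_ *: x) => u; ring.
  by rewrite -(@scaler_nat R (mpoly n R)) scalerA mulVf ?scale1r //.
apply: ball_qmoduleZ => //; exists a, 1; split => //.
- by apply: sosD; [exact: sos_sqr|apply: sos_sum => j _; exact: sos_sqr].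
- by rewrite -(expr1n _ 2); exact: sos_sqr.
- apply: pdegD; last exact: pdeg_sum.
  by rewrite (leq_trans (pdegXn _ _)) // (leq_trans (_ : 2 * _ <= 2 * 1)%N) // leq_mul2l.
- by rewrite mul1r.
Qed.

(** In the factorization of [p] each linear factor is a nonnegative constant
plus [1 + x_i] or [1 - x_i], hence costs the degree 2. *)
Lemma ball_qmodule_interval (i : 'I_n) (p : {poly R}) :
  (forall x, -1 <= x <= 1 -> 0 < p.[x]) ->
  ball_qmodule (2 * (size p).-1) (psubst (mpolyX R (mnm1 i)) p).
Proof.
set x := mpolyX R (mnm1 i) => p0.
refine (@pos_poly_ind R (fun x => -1 <= x <= 1)
  (fun p : {poly R} => ball_qmodule (2 * (size p).-1) (psubst x p)) _ _ _ _ _ _ _ p p0).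
- by exists 0; lra.
- move=> a; case: (leP (-1) a) => a1; last by right; left => y; lra.
  by case: (leP a 1) => a2; [left|right; right => y; lra].
- by move=> c c0; rewrite psubstC; apply: ball_qmoduleC; exact: ltW.
- move=> p1 p2 n1 n2 H1 H2; rewrite psubstM size_mul //.
  have -> : (2 * (size p1 + size p2).-2 = 2 * (size p1).-1 + 2 * (size p2).-1)%N.
    by move: n1 n2; rewrite -!size_poly_gt0; lia.
  exact: ball_qmoduleM.
- move=> a b b0.
  have -> : size (('X - a%:P) ^+ 2 + (b ^+ 2)%:P)%R = 3%N.
    rewrite expr2 size_polyDl size_Mmonic ?size_XsubC ?monicXsubC ?polyXsubC_eq0 //.
    by rewrite (leq_ltn_trans (size_polyC_leq1 _)).
  rewrite psubstD psubstXn psubstC; apply: ball_qmodule_sos.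
    by apply: sosD; [exact: sos_sqr|apply: sosC; exact: sqr_ge0].
  apply: pdegD; last by rewrite pdegC.
  rewrite (leq_trans (pdegXn _ _)) // (leq_trans (_ : _ <= 2 * 1)%N) // leq_mul2l /=.
  by rewrite (leq_trans (pdeg_psubst _ _)) // size_XsubC pdegX.
- move=> a /(_ (-1)); rewrite lexx => /(_ ltac:(lra)) a1; rewrite size_XsubC.
  have -> : psubst x ('X - a%:P) = (1 + (-1) ^+ false *: x) + mpolyC n (- 1 - a).
    by rewrite psubstB psubstX psubstC mpolyCB mpolyCN mpolyC1 expr0 scale1r; ring.
  apply: ball_qmoduleD; first exact: ball_qmodule_half_line.
  by apply: ball_qmoduleC; lra.
- move=> a /(_ 1); rewrite lexx => /(_ ltac:(lra)) a1.
  have -> : size (a%:P - 'X)%R = 2%N by rewrite -size_polyN opprB size_XsubC.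
  have -> : psubst x (a%:P - 'X) = (1 + (-1) ^+ true *: x) + mpolyC n (a - 1).
    by rewrite psubstB psubstX psubstC mpolyCB mpolyC1 expr1 scaleN1r; ring.
  apply: ball_qmoduleD; first exact: ball_qmodule_half_line.
  by apply: ball_qmoduleC; lra.
Qed.
End BallModule.

(** * Boundedness modulo the ball *)
Section CubeCertificate.
Variables (R : realType) (n : nat).
Notation P := (mpoly n R).
Implicit Types (p q u v : P) (c : R) (E : nat).

(** The algebraic form of the inequality [|u| <= c] on the ball. *)
Definition ball_bounded E c u :=
  ball_qmodule E (mpolyC n c - u) /\ ball_qmodule E (mpolyC n c + u).

(** [2 (c c' - u v) = (c - u) (c' + v) + (c + u) (c' - v)]. *)
Lemma ball_boundedM E E' c c' u v : ball_bounded E c u -> ball_bounded E' c' v ->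
  ball_bounded (E + E') (c * c') (u * v).
Proof.
move=> [u1 u2] [v1 v2]; split.
- have -> : mpolyC n (c * c') - u * v =
    2^-1 *: ((mpolyC n c - u) * (mpolyC n c' + v) + (mpolyC n c + u) * (mpolyC n c' - v)).
    rewrite mpolyCM; have -> : forall a b : P, (a - u) * (b + v) + (a + u) * (b - v) = (a * b - u * v) *+ 2.
      by move=> a b; ring.
    by rewrite -(@scaler_nat R P) scalerA mulVf ?scale1r.
  by apply: ball_qmoduleZ => //; apply: ball_qmoduleD; exact: ball_qmoduleM.
- have -> : mpolyC n (c * c') + u * v =
    2^-1 *: ((mpolyC n c - u) * (mpolyC n c' - v) + (mpolyC n c + u) * (mpolyC n c' + v)).
    rewrite mpolyCM; have -> : forall a b : P, (a - u) * (b - v) + (a + u) * (b + v) = (a * b + u * v) *+ 2.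
      by move=> a b; ring.
    by rewrite -(@scaler_nat R P) scalerA mulVf ?scale1r.
  by apply: ball_qmoduleZ => //; apply: ball_qmoduleD; exact: ball_qmoduleM.
Qed.

(** [c + a u] is a convex combination of [c + u] and [c - u]. *)
Lemma ball_boundedZ E c u (a : R) : `|a| <= 1 -> ball_bounded E c u -> ball_bounded E c (a *: u).
Proof.
rewrite ler_norml => /andP[a1 a2] [u1 u2].
have cE : mpolyC n c = (1 + a) / 2 *: mpolyC n c + (1 - a) / 2 *: mpolyC n c.
  by rewrite -scalerDl -[LHS]scale1r; congr (_ *: _); field.
have uE : a *: u = (1 + a) / 2 *: u - (1 - a) / 2 *: u.
  by rewrite -scalerBl; congr (_ *: _); field.
split.
- have -> : mpolyC n c - a *: u =
    (1 + a) / 2 *: (mpolyC n c - u) + (1 - a) / 2 *: (mpolyC n c + u).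
    by rewrite {1}cE uE scalerBr scalerDr; ring.
  by apply: ball_qmoduleD; apply: ball_qmoduleZ => //; lra.
- have -> : mpolyC n c + a *: u =
    (1 + a) / 2 *: (mpolyC n c + u) + (1 - a) / 2 *: (mpolyC n c - u).
    by rewrite {1}cE uE scalerBr scalerDr; ring.
  by apply: ball_qmoduleD; apply: ball_qmoduleZ => //; lra.
Qed.

Lemma ball_bounded0 E c : 0 <= c -> ball_bounded E c 0.
Proof. by move=> c0; split; rewrite ?subr0 ?addr0; exact: ball_qmoduleC. Qed.

Lemma ball_boundedD E c c' u v : ball_bounded E c u -> ball_bounded E c' v ->
  ball_bounded E (c + c') (u + v).
Proof.
move=> [u1 u2] [v1 v2]; split; rewrite mpolyCD.
  by rewrite opprD addrACA; exact: ball_qmoduleD.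
by rewrite addrACA; exact: ball_qmoduleD.
Qed.

Lemma ball_bounded_sum (I : finType) E c (F : I -> P) :
  (forall i, ball_bounded E c (F i)) -> ball_bounded E (#|I|%:R * c) (\sum_i F i).
Proof.
move=> H; rewrite cardE -big_enum /=; elim: (enum I) => [|i s IH].
  by rewrite big_nil mul0r; exact: ball_bounded0.
by rewrite big_cons /= mulrS mulrDl mul1r; exact: ball_boundedD (H i) IH.
Qed.

Lemma ball_bounded_prod k E c (F : 'I_k -> P) :
  (forall i, ball_bounded E c (F i)) -> ball_bounded (k * E) (c ^+ k) (\prod_i F i).
Proof.
elim: k F => [|k IH] F H.
  rewrite big_ord0 expr0 mul0n; split; rewrite mpolyC1 ?subrr.
    by apply: ball_qmodule_sos; [exact: sos0|rewrite pdeg0].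
  by have -> : 1 + 1 = mpolyC n 2 :> P; [rewrite mpolyC_nat|exact: ball_qmoduleC].
rewrite big_ord_recr exprSr mulSn addnC; apply: ball_boundedM => //.
exact: IH.
Qed.

(** Both sides are linear in [e], and for a monomial the identity is the product
over the variables of univariate interpolation. *)
Lemma mpoly_lagrange E (x : nat -> R) e : injective x -> (pdeg e <= E)%N ->
  e = \sum_(f : {ffun 'I_n -> 'I_E.+1}) peval e (\row_i x (f i)) *:
        \prod_(i < n) psubst (mpolyX R (mnm1 i)) (tnth (E.+1.-lagrange x) (f i)).
Proof.
move=> x_inj eE.
pose B (f : {ffun 'I_n -> 'I_E.+1}) : P := \prod_(i < n)
   psubst (mpolyX R (mnm1 i)) (tnth (E.+1.-lagrange x) (f i)).
rewrite -[RHS]/(\sum_(f : {ffun 'I_n -> 'I_E.+1}) peval e (\row_i x (f i)) *: B f).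
have mono (m : multinom n) : (mdeg m <= E)%N ->
    mpolyX R m = \sum_(f : {ffun 'I_n -> 'I_E.+1}) peval (mpolyX R m) (\row_i x (f i)) *: B f.
  move=> mE; rewrite {1}mpolyXE_id.
  have mi i : (m i <= E)%N by rewrite (leq_trans _ mE) // mdegE (bigD1 i) //= leq_addr.
  transitivity (\prod_(i < n) \sum_(j < E.+1) (x j ^+ m i) *:
       psubst (mpolyX R (mnm1 i)) (tnth (E.+1.-lagrange x) j)).
    apply: eq_bigr => i _; rewrite -{1}[mpolyX R (mnm1 i)]psubstX -psubstXn.
    have sX : (size ('X^(m i) : {poly R}) <= E.+1)%N by rewrite size_polyXn ltnS.
    rewrite {1}(lagrange_gen (ltn0Sn E) x_inj sX) psubst_sum; apply: eq_bigr => j _.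
    by rewrite mul_polyC psubstZ hornerXn.
  rewrite bigA_distr_bigA /=; apply: eq_bigr => f _.
  rewrite /peval mevalX -mul_mpolyC.
  under eq_bigr do rewrite -mul_mpolyC.
  rewrite big_split /=; congr (_ * _); rewrite -rmorph_prod /=; congr mpolyC.
  by apply: eq_bigr => i _; rewrite mxE.
rewrite {1}[e]mpolyE.
rewrite (eq_big_seq (fun m => \sum_(f : {ffun 'I_n -> 'I_E.+1})
  (mcoeff m e * peval (mpolyX R m) (\row_i x (f i))) *: B f)); last first.
  move=> m me; rewrite {1}mono; last first.
    by have := msize_mdeg_lt me; move: eE; rewrite /pdeg; case: mmeasure => //= k; rewrite ltnS => kE /leq_trans -> .
  by rewrite scaler_sumr; apply: eq_bigr => f _; rewrite scalerA.
rewrite exchange_big /=; apply: eq_bigr => f _.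
rewrite -scaler_suml; congr (_ *: _); rewrite [in RHS](mpolyE e) peval_sum.
by apply: eq_bigr => m _; rewrite pevalZ.
Qed.

(** In the tensor Lagrange basis the coefficients are values on the cube, at most
one in absolute value. Each univariate basis polynomial is at most 2 on
[[-1, 1]], so adding or subtracting it from 3 leaves a positive polynomial,
certified by factorization. *)
Lemma cube_bounded E e : (pdeg e <= E)%N -> (forall x, cube x -> `|peval e x| <= 1) ->
  ball_bounded (n * (2 * E)) ((E.+1 ^ n)%:R * 3 ^+ n) e.
Proof.
move=> eE e1; have [x [x_inj xI x2]] := @fekete_nodes R E.+1 isT.
rewrite (mpoly_lagrange x_inj eE).
have := @ball_bounded_sum {ffun 'I_n -> 'I_E.+1} (n * (2 * E)) (3 ^+ n)
  (fun f => peval e (\row_i x (f i)) *: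
        \prod_(i < n) psubst (mpolyX R (mnm1 i)) (tnth (E.+1.-lagrange x) (f i))).
rewrite card_ffun !card_ord; apply => f; apply: ball_boundedZ.
  by apply: e1 => i; rewrite mxE xI.
apply: ball_bounded_prod => i; set l := tnth _ _.
have sl : size (l : {poly R}) = E.+1 by apply: size_lagrange_.
have cert (p : {poly R}) : (size p <= E.+1)%N -> (forall y, -1 <= y <= 1 -> 0 < p.[y]) ->
    ball_qmodule (2 * E) (psubst (mpolyX R (mnm1 i)) p : P).
  move=> sp p0; apply: ball_qmodule_le (ball_qmodule_interval i p0).
  by rewrite leq_mul2l /=; case: (size p) sp.
have sc (s : {poly R}) : size s = E.+1 -> (size (3%:P + s)%R <= E.+1)%N.
  by move=> ss; rewrite (leq_trans (size_polyD _ _)) // geq_max ss leqnn (leq_trans (size_polyC_leq1 _)).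
split; rewrite -(psubstC (mpolyX R (mnm1 i))) -?psubstB -?psubstD.
- apply: cert; first by rewrite sc // size_polyN.
  move=> y yI; have := x2 (f i) y yI; rewrite -/l ler_norml hornerD hornerN hornerC => /andP[_ l2].
  lra.
- apply: cert; first by rewrite sc.
  move=> y yI; have := x2 (f i) y yI; rewrite -/l ler_norml hornerD hornerC => /andP[l2 _].
  lra.
Qed.

End CubeCertificate.

(** * Certificates of positivity on the cube *)
Section PositiveOnCube.
Variables (R : realType) (n : nat).
Notation P := (mpoly n R).

Lemma exp2_ge_quadratic : (n ^ 2 + 12 * n + 4 <= 2 ^ (n + 4))%N.
Proof.
elim: n => [//|k IH]; have := expnS 2 (k + 4); rewrite -addSn.
by case: k IH => [//|k] IH; lia.
Qed.

(** With [Y = 2 ^ l], the loss [(E + 1) ^ n * 3 ^ n * 2 X] is less than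
[2 ^ (2 ^ (n + 4) * Y)], since [X], [D] and [Y] are crudely at most powers of
[2 ^ Y]. Hence the number of additional doublings depends only on [n]. *)
Lemma growth_budget (l D X k1 k2 E : nat) : (0 < n)%N -> (X <= 4 ^ l)%N -> (D <= X)%N ->
  k1 = l.+1 -> k2 = (l + (n + 4))%N -> E = (2 ^ (k2 + k1) * D)%N ->
  (E.+1 ^ n * 3 ^ n * (2 * X) <= 2 ^ (2 ^ k2).-1)%N.
Proof.
move=> n0 Xl DX -> -> ->.
set c := (n + 4)%N; set Y := (2 ^ l)%N.
have Y0 : (0 < Y)%N by rewrite expn_gt0.
have YY : (Y <= 2 ^ Y)%N by apply/ltnW/ltn_expl.
have l4 : (4 ^ l = Y ^ 2)%N by rewrite /Y -expnM mulnC expnM.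
have c2 : (n * (c + 8) + 4 <= 2 ^ c)%N by have := exp2_ge_quadratic; rewrite /c; nia.
have E1 : ((2 ^ (l + c + l.+1) * D).+1 <= 2 ^ (c + 2 + 4 * Y))%N.
  have -> : (l + c + l.+1 = l * 2 + (c + 1))%N by lia.
  rewrite expnD expnM -/Y.
  have -> : (c + 2 + 4 * Y = (c + 1) + 1 + Y * 4)%N by lia.
  rewrite (expnD 2 _ (Y * 4)) (expnM 2 Y 4) (expnD 2 (c + 1) 1) expn1.
  have D4 : (D <= Y ^ 2)%N by rewrite -l4 (leq_trans DX).
  have : (Y ^ 2 * 2 ^ (c + 1) * D <= 2 ^ (c + 1) * (2 ^ Y) ^ 4)%N.
    rewrite mulnAC mulnC leq_mul2l; apply/orP; right.
    rewrite -[4%N]/(2 + 2)%N expnD; apply: leq_mul; last apply: leq_trans D4 _; by rewrite leq_exp2r.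
  have : (0 < 2 ^ (c + 1) * (2 ^ Y) ^ 4)%N by rewrite muln_gt0 !expn_gt0.
  rewrite [(_ * 2 * _)%N]mulnAC; move: (_ * (2 ^ Y) ^ 4)%N (Y ^ 2 * _ * D)%N => u v; lia.
have e1 : ((2 ^ (l + c + l.+1) * D).+1 ^ n <= 2 ^ ((c + 2 + 4 * Y) * n))%N.
  by rewrite expnM leq_exp2r.
have e2 : (3 ^ n <= 2 ^ (2 * n))%N by rewrite expnM leq_exp2r.
have e3 : (2 * X <= 2 ^ (1 + 2 * Y))%N.
  rewrite expnD expn1 leq_mul2l /= mulnC expnM (leq_trans Xl) // l4.
  by rewrite leq_exp2r.
apply: leq_trans (leq_mul (leq_mul e1 e2) e3) _.
rewrite -!expnD leq_exp2l // -ltnS prednK ?expn_gt0 // expnD -/Y.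
nia.
Qed.

(** The Chebyshev polynomial has degree [2 ^ (k1 + k2)], of order [4 ^ l], that
is of order [X]; after substitution of [q] this gives [X * D]. *)
Lemma degree_budget (l D X : nat) : (4 ^ l <= 4 * X)%N -> (D <= X)%N ->
  (2 ^ (l + (n + 4) + l.+1) * D <= 2 ^ (n + 4) * (8 * X ^ 2))%N.
Proof.
move=> lX DX.
have -> : (l + (n + 4) + l.+1 = (n + 4) + (1 + 2 * l))%N by lia.
rewrite expnD -mulnA leq_mul2l; apply/orP; right.
rewrite expnD expn1 expnM -[(2 ^ 2)%N]/4%N -mulnn.
have := leq_mul lX DX; lia.
Qed.

(** Below [a / 2] the Chebyshev term dominates the linear one: [k1] doublings
bring the iterate above 2, and the remaining [k2] make it exceed [Z * (a - t)].
Between [a / 2] and [a] the Chebyshev term is positive, and beyond [a] it is at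
least [- 1 / Z], which exceeds [- a / 2]. *)
Lemma damped_linear_gt0 (k1 k2 : nat) (a t : R) (Z := 2 ^+ (2 ^ k2).-1 : R) :
  (0 < k1)%N -> 2 <= 4 ^+ k1 * a -> 2 < Z * a ->
  0 < t - a / 2 + Z^-1 * iter (k2 + k1) (@dbl R) (1 + (a - t)).
Proof.
move=> k10 ka Za; have Z0 : 0 < Z by rewrite exprn_gt0.
have k1R : 0 < 4 ^+ k1 :> R by rewrite exprn_gt0.
have a0 : 0 < a by rewrite -(pmulr_rgt0 _ k1R); lra.
have ZV0 : 0 < Z^-1 by rewrite invr_gt0.
have [ta|ta] := leP t (a / 2).
  have d0 : 0 <= a - t by lra.
  have big : 1 <= 4 ^+ k1 * (a - t).
    have : 4 ^+ k1 * (a / 2) <= 4 ^+ k1 * (a - t) by apply: ler_wpM2l; [exact: ltW|lra].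
    lra.
  have : (a - t) * Z <= iter (k2 + k1) (@dbl R) (1 + (a - t)).
    rewrite iterD; apply: le_trans (iter_dbl_big k2 (_ : 2 <= iter k1 (@dbl R) (1 + (a - t)))).
      rewrite -/Z; apply: ler_wpM2r; first exact: ltW.
      have h4 : 1 <= 4 ^+ k1 :> R by rewrite exprn_ege1 //; lra.
      by have := iter_dbl_ge k1 d0; have := ler_wpM2r d0 h4; lra.
    by apply: le_trans (iter_dbl_ge k1 d0); lra.
  by move=> /(ler_wpM2l (ltW ZV0)); rewrite mulrCA mulVf ?gt_eqF // mulr1; lra.
have kE : (k2 + k1 = (k2 + k1).-1.+1)%N by rewrite prednK // addn_gt0 k10 orbT.
have : -1 <= iter (k2 + k1) (@dbl R) (1 + (a - t)) by rewrite kE iter_dbl_geN1.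
move=> /(ler_wpM2l (ltW ZV0)).
have ZV : Z^-1 < a / 2 by rewrite -[Z^-1]mul1r ltr_pdivrMr // mulrAC ltr_pdivlMr //; lra.
have [ta'|ta'] := leP t a; last by lra.
have d0 : 0 <= a - t by lra.
have : 1 <= iter (k2 + k1) (@dbl R) (1 + (a - t)).
  apply: le_trans (iter_dbl_ge (k2 + k1) d0).
  by rewrite lerDl mulr_ge0 ?exprn_ge0.
by move=> /(ler_wpM2l (ltW ZV0)); lra.
Qed.

(** After scaling by [M], [q] takes values in [[a, 1]]. Then [sigma(q)] is a sum
of squares because [sigma] is positive on the line, and the difference
[a / 2 - tau(q) / Z] is in the module because [tau(q)], bounded by one on the
cube, is bounded by [B] modulo the ball while [B / Z <= a / 2]. *)
Lemma ball_qmodule_positive_on_cube : (0 < n)%N -> exists C : nat,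
  forall (q : P) (D X : nat) (mu M : R), (pdeg q <= D)%N -> (0 < X)%N -> (D <= X)%N ->
    0 < mu -> M <= X%:R * mu -> (forall x, cube x -> mu <= peval q x <= M) ->
    ball_qmodule (C * X ^ 2) q.
Proof.
move=> n0; exists (n * (2 * (2 ^ (n + 4) * 8)))%N => q D X mu M qD X0 DX mu0 MX qM.
have /qM /andP[m1 m2] : @cube R n 0 by move=> i; rewrite mxE; lra.
have muM := le_trans m1 m2; have M0 : 0 < M by exact: lt_le_trans muM.
pose l := up_log 4 X.
have Xl : (X <= 4 ^ l)%N by exact: up_logP.
have lX : (4 ^ l <= 4 * X)%N.
  rewrite /l; case: (ltnP 1 X) => X1; last by have -> : X = 1%N by case: (X) X0 X1 => [|[]].
  have := @up_log_bounds 4 X isT X1; case: up_log => [|k] /=; first by rewrite expn0; lia.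
  by rewrite expnS => /andP[/ltnW ? _]; rewrite leq_mul2l.
pose k1 := l.+1; pose k2 := (l + (n + 4))%N; pose k := (k2 + k1)%N; pose E := (2 ^ k * D)%N.
have budget : (E.+1 ^ n * 3 ^ n * (2 * X) <= 2 ^ (2 ^ k2).-1)%N by exact: (growth_budget n0 Xl DX erefl erefl erefl).
pose Z : R := 2 ^+ (2 ^ k2).-1; have Z0 : 0 < Z by rewrite exprn_gt0.
pose B : R := (E.+1 ^ n)%:R * 3 ^+ n.
have B3 : 3 <= B.
  rewrite /B -natrX -natrM -[3]/(3%:R) ler_nat (leq_trans (_ : 3 <= 3 ^ n)%N) //.
    by rewrite -{1}(expn1 3) leq_exp2l.
  by rewrite leq_pmull // expn_gt0.
have XR : 1 <= X%:R :> R by rewrite ler1n.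
pose a := mu / M; have a0 : 0 < a by rewrite divr_gt0.
have a1 : a <= 1 by rewrite ler_pdivrMr // mul1r.
have aX : 1 <= X%:R * a by rewrite /a mulrA ler_pdivlMr // mul1r.
have BZ : B * 2 <= Z * a.
  have : B * (2 * X%:R) <= Z.
    by rewrite /B /Z -!natrX -!natrM ler_nat.
  nra.
pose tau : {poly R} := cheb2 R k \Po ((-1) *: 'X + (1 + a)%:P).
have tauE t : tau.[t] = iter k (@dbl R) (1 + (a - t)).
  by rewrite horner_comp_affine horner_cheb2; congr (iter _ _ _); ring.
have stau : (size tau <= (2 ^ k).+1)%N.
  exact: leq_trans (size_comp_affine _ _ _) (size_cheb2 _ _).
pose sigma : {poly R} := 'X - (a / 2)%:P + Z^-1 *: tau.
have sigma0 t : 0 < sigma.[t].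
  rewrite /sigma !hornerE /= tauE; apply: damped_linear_gt0 => //; last first.
    by rewrite -/Z; move: BZ B3; clear; lra.
  have X4 : X%:R <= 4 ^+ l :> R by rewrite -natrX ler_nat.
  have := ler_wpM2r (ltW a0) X4; rewrite /k1 exprS; move: aX; clear; lra.
pose u : P := M^-1 *: q.
have du : (pdeg u <= D)%N by exact: leq_trans (pdegZ _ _) qD.
pose e := psubst u tau.
have sE (p : {poly R}) : (size p <= (2 ^ k).+1)%N -> (pdeg (psubst u p) <= E)%N.
  move=> sp; rewrite (leq_trans (pdeg_psubst _ _)) // leq_mul //.
  by case: (size p) sp.
have e1 x : cube x -> `|peval e x| <= 1.
  move=> /qM /andP[q1 q2]; rewrite peval_psubst tauE; apply: iter_dbl_norm_le1.
  have u1 : a <= peval u x by rewrite /u pevalZ /a mulrC ler_wpM2l // invr_ge0 ltW.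
  have u2 : peval u x <= 1 by rewrite /u pevalZ mulrC ler_pdivrMr // mul1r.
  by rewrite ler_norml; apply/andP; split; lra.
have [Be _] := cube_bounded (sE _ stau) e1; rewrite -/B -/e in Be.
have qE : q = M *: (psubst u sigma + (Z^-1 *: (mpolyC n B - e) + mpolyC n (a / 2 - Z^-1 * B))).
  rewrite /sigma psubstD psubstB psubstX psubstC psubstZ -/e.
  rewrite mpolyCB [mpolyC n (Z^-1 * B)]mpolyCM mul_mpolyC scalerBr.
  have -> : u - mpolyC n (a / 2) + Z^-1 *: e + (Z^-1 *: mpolyC n B - Z^-1 *: e +
    (mpolyC n (a / 2) - Z^-1 *: mpolyC n B)) = u by ring.
  by rewrite /u scalerA mulfV ?scale1r // gt_eqF.
rewrite qE; apply: ball_qmoduleZ; first exact: ltW.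
apply: (@ball_qmodule_le _ _ (n * (2 * E))).
  have EX : (E <= 2 ^ (n + 4) * (8 * X ^ 2))%N by exact: degree_budget.
  by rewrite -!mulnA !leq_mul2l EX !orbT.
apply: ball_qmoduleD.
  apply: ball_qmodule_sos; first exact: sos_psubst.
  apply: leq_trans (sE _ _) _; last by rewrite mulnA leq_pmull // muln_gt0 n0.
  rewrite (leq_trans (size_polyD _ _)) // geq_max (leq_trans (size_scale_leq _ _)) // andbT.
  by rewrite size_XsubC ltnS expn_gt0.
apply: ball_qmoduleD; first by apply: ball_qmoduleZ => //; rewrite invr_ge0 ltW.
apply: ball_qmoduleC; rewrite subr_ge0 mulrC ler_pdivrMr //; lra.
Qed.

End PositiveOnCube.

(** In one variable, factorization avoids the square of the degree. The
hypothesis [n = 1] is an equation so that it applies to a polynomial of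
variable dimension. *)
Lemma ball_qmodule_positive_on_interval (R : realType) (n : nat) (q : mpoly n R) (D : nat) :
  n = 1%N -> (pdeg q <= D)%N -> (forall x, cube x -> 0 < peval q x) -> ball_qmodule (2 * D) q.
Proof.
move=> n1; subst n => qD q0; set X := mpolyX R (mnm1 (ord0 : 'I_1)).
pose p : {poly R} := \sum_(m <- msupp q) mcoeff m q *: 'X^(m ord0).
have qE : q = psubst X p.
  rewrite {1}[q]mpolyE psubst_sum; apply: eq_bigr => m _.
  by rewrite psubstZ psubstXn psubstX mpolyXE_id big_ord1.
have sp : (size p <= D.+1)%N.
  rewrite /p big_seq; elim/big_rec: _ => [|m r mq IH]; first by rewrite size_poly0.
  rewrite (leq_trans (size_polyD _ _)) // geq_max IH andbT (leq_trans (size_scale_leq _ _)) //.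
  rewrite size_polyXn ltnS; have := msize_mdeg_lt mq; rewrite mdegE big_ord1.
  by move: qD; rewrite /pdeg; case: mmeasure => //= k kD; rewrite ltnS => /leq_trans -> .
rewrite qE; apply: (@ball_qmodule_le _ _ (2 * (size p).-1)).
  by rewrite leq_mul2l /=; case: (size p) sp.
apply: ball_qmodule_interval => x xI.
have := q0 (\row__ x); rewrite qE peval_psubst pevalX mxE; apply => i; by rewrite mxE.
Qed.

(** * Lipschitz bounds on the cube *)
Section Lipschitz.
Variables (R : realType) (n : nat).
Implicit Types (f : mpoly n R) (x y : 'rV[R]_n).

Definition coord_restrict f (v : 'I_n -> R) (i : 'I_n) : {poly R} :=
  \sum_(m <- msupp f) (mcoeff m f * \prod_(j < n | j != i) v j ^+ m j) *: 'X^(m i).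

Lemma horner_coord_restrict f v i t :
  (coord_restrict f v i).[t] = meval (fun j => if j == i then t else v j) f.
Proof.
rewrite /coord_restrict horner_sum mevalE; apply: eq_bigr => m _.
rewrite hornerZ hornerXn [in RHS](bigD1 i) //= ?eqxx mulrAC -mulrA; congr (_ * (_ * _)).
by apply: eq_bigr => j /negbTE ->.
Qed.

Lemma size_coord_restrict f v i : (size (coord_restrict f v i) <= (pdeg f).+1)%N.
Proof.
rewrite /coord_restrict big_seq; elim/big_rec: _ => [|m r mf IH]; first by rewrite size_poly0.
rewrite (leq_trans (size_polyD _ _)) // geq_max IH andbT (leq_trans (size_scale_leq _ _)) //.
rewrite size_polyXn ltnS; have := msize_mdeg_lt mf.
rewrite /pdeg; case: mmeasure => //= k; rewrite ltnS; apply: leq_trans.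
by rewrite mdegE (bigD1 i) //= leq_addr.
Qed.

Definition mix (x y : 'rV[R]_n) k (i : 'I_n) : R :=
  if (i < k)%N then x ord0 i else y ord0 i.

(** The coordinates are changed one at a time, each by Markov's inequality for
the restriction to a line. *)
Lemma cube_lipschitz_l1 f d F x y : (0 < d)%N -> (pdeg f <= d)%N ->
  (forall z, cube z -> `|peval f z| <= F) -> cube x -> cube y ->
  `|peval f x - peval f y| <= 32 * F * d%:R ^+ 2 * \sum_(i < n) `|x ord0 i - y ord0 i|.
Proof.
move=> d0 fd fF cx cy.
have mixI k i : -1 <= mix x y k i <= 1 by rewrite /mix; case: ifP => _; [exact: cx|exact: cy].
have -> : peval f x = meval (mix x y n) f.
  by apply: meval_eq => i; rewrite /mix ltn_ord.
have -> : peval f y = meval (mix x y 0) f.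
  by apply: meval_eq => i; rewrite /mix.
rewrite -(telescope_sumr (fun k => meval (mix x y k) f) (leq0n n)) big_mkord.
rewrite (le_trans (ler_norm_sum _ _ _)) // mulr_sumr; apply: ler_sum => i _.
have restr t : (coord_restrict f (mix x y i) i).[t] =
    meval (fun j => if j == i then t else mix x y i j) f by exact: horner_coord_restrict.
have -> : meval (mix x y i.+1) f = (coord_restrict f (mix x y i) i).[x ord0 i].
  rewrite restr; apply: meval_eq => j; rewrite /mix ltnS leq_eqVlt -val_eqE.
  by have [/= /val_inj ->|] := eqVneq (val j) (val i).
have -> : meval (mix x y i) f = (coord_restrict f (mix x y i) i).[y ord0 i].
  rewrite restr; apply: meval_eq => j; have [->|//] := eqVneq j i.
  by rewrite /mix ltnn.
apply: markov => //; first by rewrite (leq_trans (size_coord_restrict _ _ _)).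
move=> t tI; rewrite restr.
pose z : 'rV[R]_n := \row_j (if j == i then t else mix x y i j).
have -> : meval (fun j => if j == i then t else mix x y i j) f = peval f z.
  by apply: meval_eq => j; rewrite mxE.
by apply: fF => j; rewrite mxE; case: ifP.
Qed.

Lemma coord_le_norm2 x i : `|x ord0 i| <= norm2 x.
Proof.
rewrite /norm2 -sqrtr_sqr ler_sqrt; last by rewrite sumr_ge0 // => j _; exact: sqr_ge0.
by rewrite (bigD1 i) //= lerDl sumr_ge0 // => j _; exact: sqr_ge0.
Qed.

Lemma cube_lipschitz f d F x y : (0 < d)%N -> (pdeg f <= d)%N ->
  (forall z, cube z -> `|peval f z| <= F) -> cube x -> cube y ->
  `|peval f x - peval f y| <= 32 * n%:R * d%:R ^+ 2 * F * norm2 (x - y).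
Proof.
move=> d0 fd fF cx cy; apply: le_trans (cube_lipschitz_l1 d0 fd fF cx cy) _.
have F0 : 0 <= F by apply: le_trans (fF _ cx).
have -> : 32 * n%:R * d%:R ^+ 2 * F * norm2 (x - y) =
  32 * F * d%:R ^+ 2 * (n%:R * norm2 (x - y)) by ring.
rewrite ler_wpM2l ?mulr_ge0 ?sqr_ge0 //.
have -> : n%:R * norm2 (x - y) = \sum_(i < n) norm2 (x - y).
  by rewrite sumr_const card_ord mulr_natl.
by apply: ler_sum => i _; have := coord_le_norm2 (x - y) i; rewrite !mxE.
Qed.

Lemma lower_bound_dist f d F mu (S : set 'rV[R]_n) x : (0 < n)%N -> (0 < d)%N -> (pdeg f <= d)%N ->
  S !=set0 -> S `<=` cube -> 0 < mu -> (forall z, cube z -> `|peval f z| <= F) ->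
  (forall y, S y -> mu <= peval f y) -> cube x ->
  mu - 32 * n%:R * d%:R ^+ 2 * F * dist2 x S <= peval f x.
Proof.
move=> n0 d0 fd [y0 Sy0] SC mu0 fF fmu cx.
have F0 : 0 < F.
  by apply: lt_le_trans (fF _ (SC _ Sy0)); apply: lt_le_trans (ler_norm _); exact: lt_le_trans (fmu _ Sy0).
set B := 32 * n%:R * d%:R ^+ 2 * F.
have B0 : 0 < B by rewrite !mulr_gt0 // ?exprn_gt0 ?ltr0n.
rewrite lerBlDr -lerBlDl mulrC -ler_pdivrMr //.
apply: lb_le_inf; first by exists (norm2 (x - y0)), y0.
move=> _ [y Sy <-]; rewrite ler_pdivrMr // [_ * B]mulrC.
have := cube_lipschitz d0 fd fF cx (SC _ Sy); rewrite -/B ler_norml => /andP[+ _].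
by have := fmu _ Sy; lra.
Qed.
End Lipschitz.

(** * Reduction to positivity on the cube *)
Section Reduction.
Variables (R : realType) (n m : nat) (g : 'I_m -> mpoly n R).

Lemma violation_attained x : violation g x = 0 \/
  exists j, peval (g j) x < 0 /\ violation g x = - peval (g j) x.
Proof.
rewrite /violation; elim/big_ind: _ => [|a b Ha Hb|j _]; first by left.
- by rewrite maxElt; case: ifP.
- rewrite maxElt oppr_gt0; case: ltP => gj; last by left.
  by right; exists j.
Qed.

Lemma violation_ge0 x : 0 <= violation g x.
Proof. by case: (violation_attained x) => [->//|[j [gj ->]]]; rewrite oppr_ge0 ltW. Qed.

(** Let [s] be the violation at [x] and [delta] the distance to the feasible set.
The subtracted sum is at most [mu / 4 - mu N s / (144 m G0)]: up to scaling,
every constraint contributes at most [18 / N], and the most violated one, where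
[h >= 1 / 2], accounts for the term in [s]. By the Lipschitz bound, [f x] is at
least [mu (1 - Z / 4)] with [Z] proportional to [delta]. If [Z <= 1] the term in
[s] is not needed; otherwise [Z <= Z ^ L], which the Lojasiewicz inequality and
the choice of [N] bound by the term in [s]. *)
Lemma positive_perturbation (G0 L c : R) (f : mpoly n R) (d k : nat) (F mu : R) :
  (0 < n)%N -> (0 < m)%N -> Sset g !=set0 -> Sset g `<=` cube ->
  0 < G0 -> (forall j x, cube x -> `|peval (g j) x| <= G0) ->
  1 <= L -> 0 <= c -> (forall x, cube x -> dist2 x (Sset g) `^ L <= c * violation g x) ->
  (0 < d)%N -> (pdeg f <= d)%N -> 0 < mu -> (forall x, Sset g x -> mu <= peval f x) ->
  (forall x, cube x -> `|peval f x| <= F) ->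
  36 * m%:R * G0 * c * (128 * n%:R * d%:R ^+ 2 * (F / mu)) `^ L <= 3 ^+ k ->
  exists t : 'I_m -> mpoly n R, [/\ forall j, sos (t j),
    forall j, (pdeg (t j) <= 2 * (3 ^ k * pdeg (g j)))%N &
    forall x, cube x ->
      mu / 2 <= peval (f - \sum_(j < m) t j * g j) x <= F + 3 ^+ k * mu / 2].
Proof.
move=> n0 m0 S0 SC G00 gG L1 c0 loj d0 fd mu0 fmu fF Nbig.
have [ps [psize ps_neg ps_le ps_pos]] := step_poly R k.
set N : R := 3 ^+ k in Nbig ps_pos *; have N0 : 0 < N by rewrite exprn_gt0.
have mR : 0 < m%:R :> R by rewrite ltr0n.
pose h (t : R) := \sum_(p <- ps) p.[t] ^+ 2.
have h0 t : 0 <= h t by rewrite sumr_ge0 // => p _; exact: sqr_ge0.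
pose lam := N * mu / (72 * m%:R * G0).
have lam0 : 0 < lam by rewrite divr_gt0 ?mulr_gt0.
exists (fun j => lam *: \sum_(p <- ps) psubst (G0^-1 *: g j) p ^+ 2); split.
- by move=> j; apply: sosZ; [exact: ltW|apply: sos_sum => p _; exact: sos_sqr].
- move=> j; rewrite (leq_trans (pdegZ _ _)) // big_seq; apply: pdeg_sum => p /psize sp.
  rewrite (leq_trans (pdegXn _ _)) // leq_mul2l /= (leq_trans (pdeg_psubst _ _)) //.
  by rewrite leq_mul ?pdegZ // (leq_trans (leq_pred _)).
move=> x cx; rewrite pevalB peval_sum.
pose ga j := peval (g j) x / G0.
have gaE j : peval (g j) x = ga j * G0 by rewrite /ga divfK // gt_eqF.
have gaI j : -1 <= ga j <= 1.
  have := gG j x cx; rewrite gaE normrM (gtr0_norm G00) -ler_pdivlMr // divff ?gt_eqF //.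
  by rewrite ler_norml.
have -> : \sum_(j < m) peval (lam *: (\sum_(p <- ps) psubst (G0^-1 *: g j) p ^+ 2) * g j) x =
    lam * G0 * \sum_(j < m) ga j * h (ga j).
  rewrite mulr_sumr; apply: eq_bigr => j _.
  rewrite pevalM pevalZ peval_sum gaE.
  under eq_bigr do rewrite expr2 pevalM peval_psubst pevalZ [_^-1 * _]mulrC -/(ga j) -expr2.
  by rewrite -/(h _); ring.
have termub j : ga j * h (ga j) <= 18 / N.
  have [ge0|lt0] := leP 0 (ga j).
    by apply: ps_pos; have := gaI j; lra.
  by apply: (@le_trans _ _ 0); [rewrite mulr_le0_ge0 // ltW|rewrite divr_ge0 // ltW].
have termlb j : -36 <= ga j * h (ga j).
  have := gaI j; move=> /andP[g1 g2]; have := ps_le _ (gaI j); rewrite -/(h _).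
  have := h0 (ga j); move: (h (ga j)) (ga j) g1 g2 => H a g1 g2 H0 H1; nra.
have LG : lam * G0 = N * mu / (72 * m%:R) by rewrite /lam; field; rewrite !gt_eqF.
have LG0 : 0 < lam * G0 by rewrite mulr_gt0.
set T := \sum_(j < m) _.
have Tlb : - 36 * m%:R <= T.
  have -> : - 36 * m%:R = \sum_(j < m) (-36 : R) by rewrite sumr_const card_ord mulr_natr.
  by apply: ler_sum.
have fx := fF x cx; rewrite ler_norml in fx; case/andP: fx => fx1 fx2.
apply/andP; split; last first.
  have : lam * G0 * (- 36 * m%:R) <= lam * G0 * T by rewrite ler_wpM2l // ltW.
  have -> : lam * G0 * (- 36 * m%:R) = - (N * mu / 2) by rewrite LG; field; rewrite gt_eqF.
  by lra.
set s := violation g x.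
have Tub : T <= 18 / N * m%:R - s / (2 * G0).
  have sum18 : \sum_(j < m) (18 / N : R) = 18 / N * m%:R by rewrite sumr_const card_ord mulr_natr.
  case: (violation_attained x) => [|[j [gj sE]]]; rewrite -/s.
    by move=> ->; rewrite mul0r subr0 -sum18; apply: ler_sum.
  have -> : 18 / N * m%:R - s / (2 * G0) = (18 / N - s / (2 * G0)) + \sum_(i < m | i != j) (18 / N).
    by rewrite -sum18 (bigD1 j) //=; ring.
  rewrite /T (bigD1 j) //=; apply: lerD; last by apply: ler_sum.
  have gn : ga j < 0 by rewrite /ga pmulr_llt0 // invr_gt0.
  have -> : s / (2 * G0) = - ga j / 2 by rewrite /s sE /ga; field; rewrite gt_eqF.
  have := ps_neg (ga j); rewrite -/(h _) (ltW gn) andbT => /(_ _).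
  have /andP[g1 _] := gaI j; rewrite g1 => /(_ isT).
  have : 0 < 18 / N by rewrite divr_gt0.
  move: (18 / N) (h (ga j)) (ga j) gn => e H a a0 e0 H0; nra.
have s0 : 0 <= s by exact: violation_ge0.
have /(ler_wpM2l (ltW LG0)) : T <= 18 / N * m%:R - s / (2 * G0) by [].
have -> : lam * G0 * (18 / N * m%:R - s / (2 * G0)) = mu / 4 - mu * (N * s / (144 * m%:R * G0)).
  by rewrite LG; field; rewrite !gt_eqF.
have := lower_bound_dist n0 d0 fd S0 SC mu0 fF fmu cx.
set di := dist2 x _.
have di0 : 0 <= di.
  apply: lb_le_inf; first by case: S0 => y Sy; exists (norm2 (x - y)), y.
  by move=> _ [y _ <-]; exact: sqrtr_ge0.
set Z := 128 * n%:R * d%:R ^+ 2 * (F / mu) * di.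
have -> : 32 * n%:R * d%:R ^+ 2 * F * di = mu * (Z / 4) by rewrite /Z; field; rewrite gt_eqF.
suff : Z / 4 <= 4^-1 + N * s / (144 * m%:R * G0).
  move=> /(ler_wpM2l (ltW mu0)); rewrite mulrDr; lra.
have Ns0 : 0 <= N * s / (144 * m%:R * G0) by rewrite divr_ge0 ?mulr_ge0 // ltW.
have [Z1|Z1] := leP Z 1; first by lra.
have F0 : 0 <= F by apply: le_trans (fF _ cx).
have B0 : 0 <= 128 * n%:R * d%:R ^+ 2 * (F / mu).
  by rewrite !mulr_ge0 ?sqr_ge0 // ?invr_ge0 // ltW.
have ZL : Z <= Z `^ L by rewrite -{1}(powRr1 (ltW (lt_trans ltr01 Z1))) ler_powR // ltW.
have : Z `^ L <= N * s / (36 * m%:R * G0).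
  rewrite /Z powRM //; apply: le_trans (ler_wpM2l (powR_ge0 _ _) (loj x cx)) _.
  rewrite -/s ler_pdivlMr ?mulr_gt0 //.
  have := ler_wpM2r s0 Nbig; lra.
have -> : N * s / (144 * m%:R * G0) = N * s / (36 * m%:R * G0) / 4 by field; rewrite !gt_eqF.
lra.
Qed.

End Reduction.

(** * From the ball to the constraints *)
Section Transfer.
Variables (R : realType) (n m : nat) (g : 'I_m -> mpoly n R).

Lemma ball_poly_neq0 : ball_poly R n != 0.
Proof.
apply/eqP => /(congr1 (fun p => peval p 0)); rewrite /ball_poly pevalB peval_sum.
rewrite -mpolyC1 pevalC big1 ?subr0 => [|i _]; last by rewrite expr2 pevalM pevalX mxE mul0r.
by rewrite /peval meval0; apply/eqP; exact: oner_neq0.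
Qed.

Lemma pdeg_mul_ball b : (pdeg b <= pdeg (b * ball_poly R n))%N.
Proof.
have [->|b0] := eqVneq b 0; first by rewrite mul0r.
rewrite /pdeg msizeM // ?ball_poly_neq0 //.
have := msize_poly_eq0 b; have := msize_poly_eq0 (ball_poly R n).
rewrite (negbTE b0) (negbTE ball_poly_neq0).
case: (mmeasure _ b) => [|k] //; case: (mmeasure _ _) => [|l] //= _ _.
by rewrite addnS /= leq_addr.
Qed.

(** Multiplying a fixed representation of the ball polynomial by the sum of
squares [b] raises degrees by a constant. *)
Lemma ball_qmodule_sub : qmodule g (ball_poly R n) ->
  exists K : nat, forall E p, ball_qmodule E p -> qmodule_trunc g (E + K)%:R p.
Proof.
move=> [r0 _ [s0 [s [[ss0 ss] _ _ wE]]]].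
exists (pdeg s0 + \sum_(j < m) pdeg (s j * g j)%R)%N => E p [a [b [sa sb da db ->]]].
have bE : (pdeg b <= E)%N by exact: leq_trans (pdeg_mul_ball b) db.
exists (a + b * s0), (fun j => b * s j); split.
- by split; [apply: sosD => //; exact: sosM|move=> j; exact: sosM].
- rewrite ler_nat; apply: pdegD; first by rewrite (leq_trans da) // leq_addr.
  by rewrite (leq_trans (pdegM _ _)) // leq_add // leq_addr.
- move=> j; rewrite ler_nat -mulrA (leq_trans (pdegM _ _)) // leq_add //.
  by rewrite (bigD1 j) //= addnCA leq_addr.
- rewrite {1}wE mulrDr addrA mulr_sumr; congr (_ + _).
  by apply: eq_bigr => j _; rewrite mulrA.
Qed.

Lemma qmodule_trunc_le r r' p : r <= r' -> qmodule_trunc g r p -> qmodule_trunc g r' p.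
Proof.
move=> rr [s0 [s [ss d0 dj ->]]]; exists s0, s; split => //.
  exact: le_trans rr.
by move=> j; exact: le_trans rr.
Qed.

Lemma qmodule_truncD r p (t : 'I_m -> mpoly n R) : (forall j, sos (t j)) ->
  (forall j, (pdeg (t j * g j))%:R <= r) -> qmodule_trunc g r p ->
  qmodule_trunc g r (p + \sum_(j < m) t j * g j).
Proof.
move=> st dt [s0 [s [[ss0 ss] d0 dj ->]]].
exists s0, (fun j => s j + t j); split => //.
- by split => // j; exact: sosD.
- move=> j; have := dj j; have := dt j; rewrite mulrDl => d1 d2.
  have := @pdegD _ _ (s j * g j) (t j * g j) (maxn (pdeg (s j * g j)) (pdeg (t j * g j))).
  rewrite leq_maxl leq_maxr => /(_ isT isT); rewrite -(ler_nat R) => /le_trans; apply.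
  by rewrite /maxn; case: ifP.
- by rewrite -addrA -big_split /=; congr (_ + _); apply: eq_bigr => j _; rewrite mulrDl.
Qed.

Lemma Sset_sub_cube : qmodule g (ball_poly R n) -> Sset g `<=` cube.
Proof.
move=> [r0 _ [s0 [s [[ss0 ss] _ _ wE]]]] x Sx i.
have : 0 <= peval (ball_poly R n) x.
  rewrite wE pevalD peval_sum addr_ge0 ?sos_ge0 // sumr_ge0 // => j _.
  by rewrite pevalM; apply: mulr_ge0; [exact: sos_ge0|exact: Sx].
rewrite /ball_poly pevalB peval_sum -mpolyC1 pevalC (bigD1 i) //= expr2 pevalM pevalX.
have : 0 <= \sum_(j < n | j != i) peval (mpolyX R (mnm1 j) ^+ 2) x.
  by apply: sumr_ge0 => j _; rewrite expr2 pevalM -expr2 sqr_ge0.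
by move: (\sum_(_ | _) _) (x ord0 i) => S t *; apply/andP; split; nra.
Qed.

End Transfer.

(** * Definable sets *)
Section Definable.
Variable R : realType.
Import ordered_qelim.

(** Sets of environments cut out by a first-order formula over the ordered
field. An environment is read with default value 0, so two environments with
the same entries cannot be told apart ([definable_same_env]). *)
Definition definable (A : seq R -> Prop) :=
  exists f : ord.formula R, forall e, A e <-> ord.holds e f.

Definition term_fun (t : seq R -> R) :=
  exists u : GRing.term R, forall e, t e = GRing.eval e u.

Lemma eq_definable A B : (forall e, A e <-> B e) -> definable A -> definable B.
Proof. by move=> AB [f fP]; exists f => e; rewrite -fP AB. Qed.

Lemma definable_same_env A e e' : definable A -> (forall i, e`_i = e'`_i) -> A e -> A e'.
Proof. by move=> [f fP] ee; rewrite !fP; exact: ord.eq_holds. Qed.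

Lemma definable_not A : definable A -> definable (fun e => ~ A e).
Proof. by move=> [f fP]; exists (ord.Not f) => e /=; rewrite fP. Qed.

Lemma definable_and A B : definable A -> definable B -> definable (fun e => A e /\ B e).
Proof. by move=> [f fP] [h hP]; exists (ord.And f h) => e /=; rewrite fP hP. Qed.

Lemma definable_imp A B : definable A -> definable B -> definable (fun e => A e -> B e).
Proof. by move=> [f fP] [h hP]; exists (ord.Implies f h) => e /=; rewrite fP hP. Qed.

Lemma definable_ex i A : definable A -> definable (fun e => exists x, A (set_nth 0 e i x)).
Proof. by move=> [f fP]; exists (ord.Exists i f) => e /=; split=> -[x]; exists x; apply/fP. Qed.

Lemma definable_all i A : definable A -> definable (fun e => forall x, A (set_nth 0 e i x)).
Proof. by move=> [f fP]; exists (ord.Forall i f) => e /=; split=> + x => /(_ x) /fP. Qed.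

Lemma definable_all_ord m (A : 'I_m -> seq R -> Prop) :
  (forall j, definable (A j)) -> definable (fun e => forall j, A j e).
Proof.
move=> Adef.
suff [f fP] : definable (fun e => forall j, j \in enum 'I_m -> A j e).
  by exists f => e; rewrite -fP; split=> + j => /(_ j); rewrite ?mem_enum // => /(_ isT).
elim: (enum 'I_m) => [|j s [f fP]]; first by exists (ord.Bool true) => e.
have [h hP] := Adef j; exists (ord.And h f) => e /=; rewrite -fP -hP; split.
  move=> H; split; first by apply: H; rewrite mem_head.
  by move=> k ks; apply: H; rewrite inE ks orbT.
by move=> [H1 H2] k; rewrite inE => /orP[/eqP ->//|]; exact: H2.
Qed.

(** Quantification over a block of variables ranges over the environments that
agree with the given one outside of the block. *)
Lemma definable_ex_block (l : seq nat) A : definable A ->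
  definable (fun e => exists e', (forall i, i \notin l -> e`_i = e'`_i) /\ A e').
Proof.
move=> Adef; elim: l => [|i l IH].
  apply: (eq_definable _ Adef) => e; split=> [Ae|[e' [ee' Ae']]]; first by exists e.
  by apply: (definable_same_env Adef _ Ae') => i; rewrite ee'.
apply: eq_definable (definable_ex i IH) => e; split.
  move=> [x [e' [ee' Ae']]]; exists e'; split => // j; rewrite inE negb_or => /andP[ji jl].
  by rewrite -ee' // nth_set_nth /= (negbTE ji).
move=> [e' [ee' Ae']]; exists e'`_i, e'; split => // j jl.
rewrite nth_set_nth /=; have [->//|ji] := eqVneq j i.
by rewrite ee' // inE negb_or ji.
Qed.

Lemma definable_all_block (l : seq nat) A : definable A ->
  definable (fun e => forall e', (forall i, i \notin l -> e`_i = e'`_i) -> A e').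
Proof.
move=> Adef; apply: eq_definable (definable_not (definable_ex_block l (definable_not Adef))) => e.
split=> [H e' ee'|H [e' [ee' nA]]]; last exact: nA (H e' ee').
by apply: contrapT => nA; apply: H; exists e'.
Qed.

Lemma term_nth i : term_fun (fun e => e`_i).
Proof. by exists (GRing.Var R i). Qed.
Lemma term_const c : term_fun (fun=> c).
Proof. by exists (GRing.Const c). Qed.
Lemma term_add s t : term_fun s -> term_fun t -> term_fun (fun e => s e + t e).
Proof. by move=> [u uP] [v vP]; exists (GRing.Add u v) => e /=; rewrite uP vP. Qed.
Lemma term_opp s : term_fun s -> term_fun (fun e => - s e).
Proof. by move=> [u uP]; exists (GRing.Opp u) => e /=; rewrite uP. Qed.
Lemma term_mul s t : term_fun s -> term_fun t -> term_fun (fun e => s e * t e).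
Proof. by move=> [u uP] [v vP]; exists (GRing.Mul u v) => e /=; rewrite uP vP. Qed.
Lemma term_exp s k : term_fun s -> term_fun (fun e => s e ^+ k).
Proof. by move=> [u uP]; exists (GRing.Exp u k) => e /=; rewrite uP. Qed.
Lemma term_sum I (r : seq I) (F : I -> seq R -> R) : (forall i, term_fun (F i)) ->
  term_fun (fun e => \sum_(i <- r) F i e).
Proof.
move=> H; elim: r => [|i r [u uP]].
  by have [u uP] := term_const 0; exists u => e; rewrite big_nil -uP.
by have [v vP] := H i; exists (GRing.Add v u) => e; rewrite big_cons /= uP vP.
Qed.
Lemma term_prod I (r : seq I) (F : I -> seq R -> R) : (forall i, term_fun (F i)) ->
  term_fun (fun e => \prod_(i <- r) F i e).
Proof.
move=> H; elim: r => [|i r [u uP]].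
  by have [u uP] := term_const 1; exists u => e; rewrite big_nil -uP.
by have [v vP] := H i; exists (GRing.Mul v u) => e; rewrite big_cons /= uP vP.
Qed.

Lemma definable_le s t : term_fun s -> term_fun t -> definable (fun e => s e <= t e).
Proof. by move=> [u uP] [v vP]; exists (ord.Le u v) => e /=; rewrite uP vP. Qed.

Lemma rterm_bivariate (u : GRing.term R) : GRing.rterm u ->
  exists P : {poly {poly R}}, forall t s, GRing.eval [:: t; s] u = P.[s%:P].[t].
Proof.
elim: u => //=.
- case=> [_|[_|i _]]; first by exists ('X%:P) => t s; rewrite !hornerE.
    by exists 'X => t s; rewrite !hornerE.
  by exists 0 => t s /=; rewrite nth_nil !hornerE.
- by move=> c _; exists (c%:P%:P) => t s; rewrite !hornerE.
- by move=> k _; exists (k%:R) => t s; rewrite -polyC_natr !hornerE -polyC_natr !hornerE.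
- move=> u IHu v IHv /andP[/IHu[P PE] /IHv[Q QE]].
  by exists (P + Q) => t s; rewrite PE QE !hornerE.
- by move=> u IHu /IHu[P PE]; exists (- P) => t s; rewrite PE !hornerE.
- by move=> u IHu k /IHu[P PE]; exists (P *+ k) => t s; rewrite PE !hornerMn.
- move=> u IHu v IHv /andP[/IHu[P PE] /IHv[Q QE]].
  by exists (P * Q) => t s; rewrite PE QE !hornerE.
- by move=> u IHu k /IHu[P PE]; exists (P ^+ k) => t s; rewrite PE !horner_exp.
Qed.

Definition same_signs (ps : seq {poly {poly R}}) (t s t' s' : R) :=
  forall p, p \in ps -> Num.sg p.[s%:P].[t] = Num.sg p.[s'%:P].[t'].

Lemma same_signs_cat ps qs t s t' s' : same_signs (ps ++ qs) t s t' s' ->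
  same_signs ps t s t' s' /\ same_signs qs t s t' s'.
Proof. by move=> H; split=> p pp; apply: H; rewrite mem_cat pp ?orbT. Qed.

Lemma qf_signs (f : ord.formula R) : ord.qf_form f -> ord.rformula f ->
  exists ps, forall t s t' s', same_signs ps t s t' s' ->
    ord.qf_eval [:: t; s] f = ord.qf_eval [:: t'; s'] f.
Proof.
elim: f => //=.
- by move=> b _ _; exists [::].
- move=> u v _ /andP[/rterm_bivariate[P PE] /rterm_bivariate[Q QE]]; exists [:: P - Q] => t s t' s' H.
  have := H _ (mem_head _ _); rewrite !PE !QE !hornerE => sg.
  by rewrite -subr_eq0 -sgr_eq0 sg sgr_eq0 subr_eq0.
- move=> u v _ /andP[/rterm_bivariate[P PE] /rterm_bivariate[Q QE]]; exists [:: P - Q] => t s t' s' H.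
  have := H _ (mem_head _ _); rewrite !PE !QE !hornerE => sg.
  by rewrite -subr_lt0 -sgr_lt0 sg sgr_lt0 subr_lt0.
- move=> u v _ /andP[/rterm_bivariate[P PE] /rterm_bivariate[Q QE]]; exists [:: P - Q] => t s t' s' H.
  have := H _ (mem_head _ _); rewrite !PE !QE !hornerE => sg.
  by rewrite -subr_le0 -sgr_le0 sg sgr_le0 subr_le0.
- move=> f1 IH1 f2 IH2 /andP[q1 q2] /andP[r1 r2].
  have [ps1 H1] := IH1 q1 r1; have [ps2 H2] := IH2 q2 r2.
  by exists (ps1 ++ ps2) => t s t' s' /same_signs_cat[/H1 -> /H2 ->].
- move=> f1 IH1 f2 IH2 /andP[q1 q2] /andP[r1 r2].
  have [ps1 H1] := IH1 q1 r1; have [ps2 H2] := IH2 q2 r2.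
  by exists (ps1 ++ ps2) => t s t' s' /same_signs_cat[/H1 -> /H2 ->].
- move=> f1 IH1 f2 IH2 /andP[q1 q2] /andP[r1 r2].
  have [ps1 H1] := IH1 q1 r1; have [ps2 H2] := IH2 q2 r2.
  by exists (ps1 ++ ps2) => t s t' s' /same_signs_cat[/H1 -> /H2 ->].
- move=> f1 IH1 q1 r1; have [ps1 H1] := IH1 q1 r1.
  by exists ps1 => t s t' s' /H1 ->.
Qed.

(** After quantifier elimination, membership depends only on the signs of the
polynomials in the atoms. Those that vanish identically carry no information
and are dropped. *)
Lemma definable_signs A : definable A ->
  exists2 ps : seq {poly {poly R}}, forall p, p \in ps -> p != 0 &
    forall t s t' s', same_signs ps t s t' s' -> A [:: t; s] -> A [:: t'; s'].
Proof.
move=> [f fP].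
have /andP[qf rf] := ord.quantifier_elim_wf (@qe_rcf.wf_QE_wproj R) (ord.to_rform_rformula f).
have [ps psP] := qf_signs qf rf.
exists [seq p <- ps | p != 0]; first by move=> p; rewrite mem_filter => /andP[].
move=> t s t' s' H /fP /qe_rcf.rcf_satP; rewrite /qe_rcf.rcf_sat /ord.proj_sat.
rewrite (psP t s t' s'); last first.
  move=> p pp; have [->|p0] := eqVneq p 0; first by rewrite !horner0.
  by apply: H; rewrite mem_filter p0.
by move=> H'; apply/fP/qe_rcf.rcf_satP.
Qed.

End Definable.

(** * Definable sets of the line near zero *)
Section NearZero.
Variable R : realType.

Lemma poly_no_root_near0 (p : {poly R}) : p != 0 ->
  exists2 eps : R, 0 < eps & forall t, 0 < t < eps -> p.[t] != 0.
Proof.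
move=> p0; have rt := polyrcf.roots_on_rootsR p0.
have [eps eps0 epsP] : exists2 eps : R, 0 < eps & forall x, x \in polyrcf.rootsR p -> 0 < x -> eps <= x.
  elim: (polyrcf.rootsR p) => [|y s [e e0 eP]]; first by exists 1.
  have [y0|y0] := ltP 0 y; last first.
    exists e => // x; rewrite inE => /orP[/eqP -> y1|]; last exact: eP.
    by move: y0; rewrite leNgt y1.
  exists (Num.min e y); first by rewrite lt_min e0.
  by move=> x; rewrite inE ge_min => /orP[/eqP ->|/eP H /H ->//]; rewrite lexx orbT.
exists eps => // t /andP[t0 te]; apply/negP => pt.
have : t \in polyrcf.rootsR p by rewrite -rt in_itv.
by move=> /epsP /(_ t0); rewrite leNgt te.
Qed.

Lemma sgr_no_root (p : {poly R}) (a b : R) : a <= b ->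
  (forall t, a <= t <= b -> p.[t] != 0) -> Num.sg p.[a] = Num.sg p.[b].
Proof.
move=> ab H; have [neg|pos] := ltP (p.[a] * p.[b]) 0.
  have [x] := polyrcf.poly_ivt ab (ltW neg); rewrite in_itv /= => xab /eqP rx.
  by have := H x xab; rewrite rx eqxx.
have pa : p.[a] != 0 by apply: H; rewrite lexx.
have pb : p.[b] != 0 by apply: H; rewrite lexx andbT.
have : Num.sg (p.[a] * p.[b]) = 1 by rewrite gtr0_sg // lt_neqAle pos andbT eq_sym mulf_neq0.
rewrite sgrM => sab.
have sbb : Num.sg p.[b] * Num.sg p.[b] = 1 by rewrite -expr2 sqr_sg pb.
have : (Num.sg p.[a] - Num.sg p.[b]) * Num.sg p.[b] = 0 by rewrite mulrBl sab sbb subrr.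
by move/eqP; rewrite mulf_eq0 sgr_eq0 (negbTE pb) orbF subr_eq0 => /eqP.
Qed.

Lemma polys_no_root_near0 (ps : seq {poly R}) :
  exists2 eps : R, 0 < eps & forall p t, p \in ps -> p != 0 -> 0 < t < eps -> p.[t] != 0.
Proof.
elim: ps => [|p ps [e e0 eP]]; first by exists 1.
have [p0|p0] := eqVneq p 0.
  by exists e => // q t; rewrite inE => /orP[/eqP ->|]; [rewrite p0 eqxx|exact: eP].
have [e' e'0 e'P] := poly_no_root_near0 p0.
exists (Num.min e e'); first by rewrite lt_min e0.
move=> q t; rewrite inE lt_min => /orP[/eqP -> _|qs q0] /and3P[t0 te te'].
  by apply: e'P; rewrite t0.
by apply: eP; rewrite ?t0.
Qed.

(** The polynomials that decide membership have no root in some interval to the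
right of 0, where their signs are constant. *)
Lemma definable_near0 (A : seq R -> Prop) : definable A ->
  exists2 eps : R, 0 < eps & forall t t', 0 < t < eps -> 0 < t' < eps ->
    A [:: t; 0] -> A [:: t'; 0].
Proof.
move=> /definable_signs[ps _ psP].
have [e e0 eP] := polys_no_root_near0 [seq p.[0] | p <- ps].
exists e => // t t' te t'e; apply: psP => p pp; rewrite polyC0.
have [->|p0] := eqVneq p.[0] 0; first by rewrite !horner0.
have H := eP p.[0] _ (map_f _ pp) p0.
have [tt'|/ltW t't] := leP t t'; [|apply/esym]; apply: sgr_no_root => // u ?; apply: H; lra.
Qed.
End NearZero.

(** * Growth of definable functions at zero *)
Section Asymptotics.
Variable R : realType.

(** The largest term of a vanishing sum is balanced by the others, so the
largest of the others is at least a fraction [1 / #|I|] of it. *)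
Lemma two_dominant_terms (I : finType) (c M : I -> R) : (forall i, 0 < M i) ->
  (exists i, c i != 0) -> \sum_i c i * M i = 0 ->
  exists i k, [/\ i != k, c i != 0, c k != 0, `|c k| * M k <= `|c i| * M i &
    `|c i| * M i <= #|I|%:R * (`|c k| * M k)].
Proof.
move=> M0 [i0 ci0] sum0.
case: (@Order.TotalTheory.arg_maxP _ _ I i0 xpredT (fun i => `|c i| * M i)) => // i _ imax.
have ci : 0 < `|c i| * M i.
  by apply: lt_le_trans (imax i0 isT); rewrite mulr_gt0 ?normr_gt0.
have cin : c i != 0 by apply: contraTneq ci => ->; rewrite normr0 mul0r ltxx.
have I0 : (0 < #|I|)%N by apply/card_gt0P; exists i0.
have IR : 0 < #|I|%:R :> R by rewrite ltr0n.
suff [k ki kbig] : exists2 k, k != i & `|c i| * M i <= #|I|%:R * (`|c k| * M k).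
  exists i, k; split => //; [by rewrite eq_sym| |exact: imax].
  by apply: contraTneq (lt_le_trans ci kbig) => ->; rewrite normr0 mul0r mulr0 ltxx.
apply: contrapT => noK.
have small k : k != i -> `|c k| * M k <= `|c i| * M i / #|I|%:R.
  move=> ki; rewrite ler_pdivlMr // mulrC leNgt; apply/negP => big; apply: noK.
  by exists k => //; exact: ltW.
move: sum0; rewrite (bigD1 i) //= => /eqP; rewrite addr_eq0 => /eqP ciE.
have : `|c i| * M i <= \sum_(k | k != i) `|c i| * M i / #|I|%:R.
  rewrite -{1}(gtr0_norm (M0 i)) -normrM ciE normrN (le_trans (ler_norm_sum _ _ _)) //.
  by apply: ler_sum => k ki; rewrite normrM (gtr0_norm (M0 k)) small.
rewrite sumr_const cardC1 -[_ *+ _]mulr_natr mulrAC ler_pdivlMr // ler_pM2l // ler_nat.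
by rewrite leqNgt prednK ?leqnn.
Qed.

(** A substitute for Puiseux expansions. At a zero of [P] two of its monomials
are of the same size. They have different powers of [s], because distinct
monomials with the same power of [s] differ by a factor [t]; dividing by the
smaller power of [s] expresses a power of [s] by powers of [t]. *)
Lemma comparable_monomials (P : {poly {poly R}}) : P != 0 ->
  exists (T : finType) (al be de : T -> nat) (C eps : R),
  [/\ 1 <= C, 0 < eps, eps <= 1, forall i, (0 < al i)%N &
    forall t s, 0 < t < eps -> 0 < s -> P.[s%:P].[t] = 0 ->
      exists i, s ^+ al i * t ^+ be i <= C * t ^+ de i /\
                t ^+ de i <= C * (s ^+ al i * t ^+ be i)].
Proof.
move=> P0; pose b := (\max_(j < size P) size (P`_j)%R)%N.
pose I : finType := ('I_(size P) * 'I_b)%type.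
pose c (i : I) : R := (P`_i.1)`_i.2.
have PE t s : P.[s%:P].[t] = \sum_(i : I) c i * (t ^+ i.2 * s ^+ i.1).
  rewrite [P.[s%:P]]horner_coef horner_sum -(pair_bigA _ (fun (j : 'I_(size P)) (i : 'I_b) => (P`_j)`_i * (t ^+ i * s ^+ j))) /=.
  apply: eq_bigr => j _; rewrite hornerM -polyC_exp hornerC.
  rewrite (@horner_coef_wide _ b) ?mulr_suml; last by rewrite /b (leq_bigmax j).
  by apply: eq_bigr => i _; rewrite mulrA.
have cex : exists i, c i != 0.
  have Pl : lead_coef P != 0 by rewrite lead_coef_eq0.
  have s1 : ((size P).-1 < size P)%N by rewrite prednK // size_poly_gt0.
  have s2 : ((size (lead_coef P)).-1 < b)%N.
    rewrite prednK ?size_poly_gt0 // /b (leq_trans _ (leq_bigmax (Ordinal s1))) //=.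
  by exists (Ordinal s1, Ordinal s2); rewrite /c /= -/(lead_coef P) -/(lead_coef (lead_coef P)) lead_coef_eq0.
pose T : finType := {ik : I * I | (ik.2.1 < ik.1.1)%N}.
pose C : R := 1 + \sum_(i : I) \sum_(k : I) #|I|%:R * (`|c i| / `|c k|).
have term0 i k : 0 <= #|I|%:R * (`|c i| / `|c k|) by rewrite mulr_ge0 ?divr_ge0.
have ratioC i k : #|I|%:R * (`|c i| / `|c k|) <= C.
  apply: (@le_trans _ _ (\sum_(k : I) #|I|%:R * (`|c i| / `|c k|))).
    by rewrite (bigD1 k) //= lerDl sumr_ge0.
  apply: (@le_trans _ _ (\sum_(i : I) \sum_(k : I) #|I|%:R * (`|c i| / `|c k|))).
    by rewrite [leRHS](bigD1 i) //= lerDl sumr_ge0 // => j _; exact: sumr_ge0.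
  by rewrite /C lerDr.
have C1 : 1 <= C by rewrite lerDl; apply: sumr_ge0 => i _; exact: sumr_ge0.
have C0 : 0 < C by exact: lt_le_trans C1.
pose hi (x : T) : I := (sval x).1; pose lo (x : T) : I := (sval x).2.
exists T, (fun x => ((hi x).1 - (lo x).1)%N), (fun x => (hi x).2 : nat),
  (fun x => (lo x).2 : nat), C, C^-1; split => //.
- by rewrite invr_gt0.
- by rewrite invf_le1.
- by move=> x; rewrite subn_gt0; exact: (svalP x).
move=> t s /andP[t0 tC] s0; rewrite PE => sum0.
pose M (i : I) := t ^+ i.2 * s ^+ i.1.
have M0 i : 0 < M i by rewrite mulr_gt0 ?exprn_gt0.
have [i [k [ik ci ck Mki Mik]]] := two_dominant_terms M0 cex sum0.
have cI : 1 <= #|I|%:R :> R by rewrite ler1n; apply/card_gt0P; exists i.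
have ub1 : M k <= C * M i.
  apply: (@le_trans _ _ (`|c i| / `|c k| * M i)).
    by rewrite mulrAC ler_pdivlMr ?normr_gt0 // mulrC.
  rewrite ler_pM2r //; apply: le_trans (ratioC i k); rewrite ler_peMl // divr_ge0 //.
have ub2 : M i <= C * M k.
  apply: (@le_trans _ _ (#|I|%:R * (`|c k| / `|c i|) * M k)); last by rewrite ler_pM2r.
  have -> : #|I|%:R * (`|c k| / `|c i|) * M k = #|I|%:R * (`|c k| * M k) / `|c i| by ring.
  by rewrite ler_pdivlMr ?normr_gt0 // mulrC.
have tlt1 : t < 1 by apply: lt_le_trans tC _; rewrite invf_le1.
have Ct : C * t < 1 by rewrite mulrC -ltr_pdivlMr // mul1r.
have strict (u v r : nat) : (u < v)%N -> ~ (t ^+ u * s ^+ r <= C * (t ^+ v * s ^+ r)).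
  move=> uv; rewrite mulrA ler_pM2r ?exprn_gt0 //.
  rewrite -(subnKC uv) addSnnS exprD mulrCA ler_pMr ?exprn_gt0 // exprS mulrA.
  apply/negP; rewrite -ltNge; apply: le_lt_trans Ct.
  by rewrite ler_piMr ?exprn_ile1 // ?mulr_ge0 // ltW.
have main (i' k' : I) (lt_ki : (k'.1 < i'.1)%N) : M k' <= C * M i' -> M i' <= C * M k' ->
    exists x : T, s ^+ ((hi x).1 - (lo x).1) * t ^+ (hi x).2 <= C * t ^+ (lo x).2 /\
      t ^+ (lo x).2 <= C * (s ^+ ((hi x).1 - (lo x).1) * t ^+ (hi x).2).
  move=> h1 h2; exists (exist (fun ik : I * I => (ik.2.1 < ik.1.1)%N) (i', k') lt_ki); rewrite /hi /lo /=.
  have ME : M i' = s ^+ (i'.1 - k'.1) * t ^+ i'.2 * s ^+ k'.1.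
    by rewrite /M mulrAC -exprD subnK ?(ltnW lt_ki) // mulrC.
  move: h1 h2; rewrite ME /M !mulrA !ler_pM2r ?exprn_gt0 // => h1 h2; split => //.
have [ltki|ltik|eqik] := ltngtP k.1 i.1.
- exact: main ltki ub1 ub2.
- exact: main ltik ub2 ub1.
- exfalso; move: ub1 ub2; rewrite /M eqik.
  have [lt2|lt2|eq2] := ltngtP k.2 i.2; [move=> + _; exact: strict|move=> _; exact: strict|].
  have ikE : i = k by case: (i) (k) eqik eq2 => [i1 i2] [k1 k2] /= /val_inj -> /val_inj ->.
  by rewrite ikE eqxx in ik.
Qed.

Lemma pow_le_powR (t s C : R) (a b d : nat) : 0 < t -> 0 < s -> 1 <= C -> (0 < a)%N ->
  s ^+ a * t ^+ b <= C * t ^+ d -> s <= C * t `^ ((d%:R - b%:R) / a%:R).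
Proof.
move=> t0 s0 C1 a0 H; rewrite leNgt; apply/negP => lt.
have C0 : 0 <= C by lra.
have aR : a%:R != 0 :> R by rewrite pnatr_eq0 -lt0n.
have : (C * t `^ ((d%:R - b%:R) / a%:R)) ^+ a < s ^+ a.
  by rewrite ltrXn2r -?lt0n // ?nnegrE ?mulr_ge0 ?powR_ge0 // ltW.
have tE : (t `^ ((d%:R - b%:R) / a%:R)) ^+ a * t ^+ b = t ^+ d.
  rewrite -powR_mulrn ?powR_ge0 // -powRrM divfK // -powR_mulrn ?ltW // -powRD.
    by rewrite subrK powR_mulrn // ltW.
  by rewrite (gt_eqF t0) implybT.
rewrite -(ltr_pM2r (exprn_gt0 b t0)) exprMn -mulrA tE => /lt_le_trans /(_ H).
rewrite ltr_pM2r ?exprn_gt0 // ltNge => /negP; apply.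
by rewrite -{1}(expr1 C) ler_weXn2l.
Qed.

Lemma pow_ge_powR (t s C : R) (a b d : nat) : 0 < t -> 0 < s -> 1 <= C -> (0 < a)%N ->
  t ^+ d <= C * (s ^+ a * t ^+ b) -> C^-1 * t `^ ((d%:R - b%:R) / a%:R) <= s.
Proof.
move=> t0 s0 C1 a0 H; rewrite leNgt; apply/negP => lt.
have C0 : 0 < C by lra.
have aR : a%:R != 0 :> R by rewrite pnatr_eq0 -lt0n.
have : s ^+ a < (C^-1 * t `^ ((d%:R - b%:R) / a%:R)) ^+ a.
  by rewrite ltrXn2r -?lt0n // ?nnegrE ?mulr_ge0 ?powR_ge0 ?invr_ge0 // ltW.
have tE : (t `^ ((d%:R - b%:R) / a%:R)) ^+ a * t ^+ b = t ^+ d.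
  rewrite -powR_mulrn ?powR_ge0 // -powRrM divfK // -powR_mulrn ?ltW // -powRD.
    by rewrite subrK powR_mulrn // ltW.
  by rewrite (gt_eqF t0) implybT.
rewrite -(ltr_pM2r (exprn_gt0 b t0)) exprMn -mulrA tE.
have CC : C * C^-1 ^+ a <= 1.
  have Ci0 : 0 <= C^-1 by rewrite invr_ge0 ltW.
  have Ci1 : C^-1 <= 1 by rewrite invf_le1.
  by case: (a) a0 => // k _; rewrite exprS mulrA mulfV ?gt_eqF // mul1r exprn_ile1.
rewrite -(ltr_pM2l C0) => /(le_lt_trans H); rewrite mulrA ltNge => /negP; apply.
by rewrite ler_piMl // exprn_ge0 // ltW.
Qed.

(** On the graph of [psi] some polynomial [P] vanishes: if all polynomials that
decide membership in [A] were nonzero at [(t, psi t)], they would keep their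
signs slightly above it. Hence, for each small [t], one of finitely many powers
[t ^ al i] is comparable to [psi t]. The upper bound [U i] defines a condition
on [t] alone, so near 0 its truth does not depend on [t]. Among the exponents
whose upper bound holds, the largest gives the best upper bound, and also a
lower bound, since every comparable power has one of these exponents. *)
Lemma definable_growth_order (A : seq R -> Prop) (psi : R -> R) (t0 : R) :
  definable A -> 0 < t0 -> (forall t, 0 < t < t0 -> 0 < psi t) ->
  (forall t s, 0 < t < t0 -> (A [:: t; s] <-> s <= psi t)) ->
  exists al C eps : R, [/\ 1 <= C, 0 < eps, eps <= 1, eps <= t0 &
    forall t, 0 < t < eps -> C^-1 * t `^ al <= psi t <= C * t `^ al].
Proof.
move=> Adef t00 psi0 AE.
have [ps ps0 psP] := definable_signs Adef.
have root t : 0 < t < t0 -> exists2 p, p \in ps & p.[(psi t)%:P].[t] = 0.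
  move=> tI; apply: contrapT => noroot.
  have nz p : p \in ps -> p.[(psi t)%:P].[t] != 0.
    by move=> pp; apply/eqP => pz; apply: noroot; exists p.
  (* The polynomial p on the vertical line at t, recentred at psi t. *)
  pose sec (p : {poly {poly R}}) : {poly R} := (map_poly (horner_eval t) p) \Po ('X + (psi t)%:P).
  have secE p s : (sec p).[s] = p.[(psi t + s)%:P].[t].
    rewrite /sec horner_comp !hornerE addrC.
    rewrite -[RHS]/(horner_eval t p.[(psi t + s)%:P]) -horner_map /=; congr (_.[_]).
    by rewrite /horner_eval hornerC.
  have [e e0 eP] := polys_no_root_near0 [seq sec p | p <- ps].
  have : A [:: t; psi t + e / 2].
    apply: (psP t (psi t)); last by apply/AE.
    move=> p pp; have := secE p 0; rewrite addr0 => <-; rewrite -secE.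
    apply: sgr_no_root; first by lra.
    move=> u /andP[u0 ue]; have [->|un] := eqVneq u 0; first by rewrite secE addr0 nz.
    apply: eP; [exact: map_f| |by rewrite lt_neqAle eq_sym un u0 /=; lra].
    by apply: contraNneq (nz p pp) => sp; have := secE p 0; rewrite addr0 sp horner0 => <-.
  by move/(AE t _ tI); lra.
pose P := \prod_(p <- ps) p.
have P0 : P != 0.
  by rewrite /P big_seq; elim/big_ind: _ => [|a b a0 b0|p /ps0//]; [exact: oner_neq0|rewrite mulf_neq0].
have PR t : 0 < t < t0 -> P.[(psi t)%:P].[t] = 0.
  move=> /root[p pp pz]; rewrite /P (perm_big _ (perm_to_rem pp)) big_cons !hornerM pz mul0r //.
have [T [a [b [d [C [e1 [C1 e10 e11 a0 band]]]]]]] := comparable_monomials P0.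
pose U i t := psi t ^+ a i * t ^+ b i <= C * t ^+ d i.
have Unear i : exists2 e : R, 0 < e & forall t t', 0 < t < e -> t < t0 -> 0 < t' < e -> t' < t0 ->
    U i t -> U i t'.
  (* U i t with psi t replaced by all nonnegative s <= psi t, a first-order condition. *)
  pose B e := forall s, A (set_nth 0 e 1 s) -> 0 <= s -> s ^+ a i * e`_0 ^+ b i <= C * e`_0 ^+ d i.
  have Bdef : definable B.
    have : definable (fun e => A e -> 0 <= e`_1 -> e`_1 ^+ a i * e`_0 ^+ b i <= C * e`_0 ^+ d i).
      apply: definable_imp => //; apply: definable_imp.
        by apply: definable_le; [exact: term_const|exact: term_nth].
      by apply: definable_le; apply: term_mul; do ?[exact: term_const|apply: term_exp; exact: term_nth].
    move=> /(definable_all 1); apply: eq_definable => e; rewrite /B.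
    by split=> H s; have := H s; rewrite !nth_set_nth.
  have [e e0 eP] := definable_near0 Bdef; exists e => // t t' te tt0 te' tt0' Ut.
  have tI : 0 < t < t0 by case/andP: te => ->.
  have tI' : 0 < t' < t0 by case/andP: te' => ->.
  have := eP t t' te te' _ (psi t') _ (ltW (psi0 _ tI')); apply; last by apply/(AE t').
  move=> s /= /(AE _ _ tI) sle s0; apply: le_trans Ut.
  rewrite ler_wpM2r ?exprn_ge0 //; first by case/andP: tI => /ltW.
  by rewrite lerXn2r ?nnegrE // (ltW (psi0 _ tI)).
have [e2 e20 e2P] : exists2 e : R, 0 < e & forall i t t', 0 < t < e -> t < t0 -> 0 < t' < e -> t' < t0 ->
    U i t -> U i t'.
  suff [e e0 eP] : exists2 e : R, 0 < e & forall i t t', i \in enum T ->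
      0 < t < e -> t < t0 -> 0 < t' < e -> t' < t0 -> U i t -> U i t'.
    by exists e => // i t t'; apply: eP; rewrite mem_enum.
  elim: (enum T) => [|i s [e e0 eP]]; first by exists 1.
  have [e' e'0 e'P] := Unear i.
  exists (Num.min e e'); first by rewrite lt_min e0.
  move=> j t t'; rewrite inE !lt_min => /orP[/eqP ->|js] /and3P[? ? ?] ? /and3P[? ? ?] ?.
    by apply: e'P => //; apply/andP.
  by apply: eP => //; apply/andP.
pose eps := Num.min (Num.min e1 e2) t0.
have eps0 : 0 < eps by rewrite !lt_min e10 e20.
have epsI t : 0 < t < eps -> [/\ 0 < t < e1, 0 < t < e2, t < t0 & 0 < t < t0].
  by rewrite !lt_min => /and3P[-> /andP[-> ->] ->].
pose al i : R := ((d i)%:R - (b i)%:R) / (a i)%:R.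
have bandt t : 0 < t < eps -> exists2 i, U i t & C^-1 * t `^ al i <= psi t.
  move=> /epsI[te1 te2 tt0 tI]; have [i [U1 U2]] := band t _ te1 (psi0 _ tI) (PR _ tI).
  by exists i => //; apply: pow_ge_powR => //; [case/andP: tI|exact: psi0].
have h2 : 0 < eps / 2 < eps by lra.
have [i0 Ui0 _] := bandt _ h2.
pose Q i := `[< U i (eps / 2) >].
case: (@Order.TotalTheory.arg_maxP _ _ T i0 Q al) => [|i /asboolP Ui imax]; first exact/asboolP.
exists (al i), C, eps; split => //.
- by rewrite !ge_min e11.
- by rewrite !ge_min lexx orbT.
move=> t te; have [te1 te2 tt0 tI] := epsI t te; have [_ h2' h20 _] := epsI _ h2.
apply/andP; split; last first.
  have Uit : U i t by exact: (e2P i _ _ h2' h20 te2 tt0 Ui).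
  by apply: (pow_le_powR _ _ C1 (a0 i) Uit); [case/andP: tI|exact: psi0].
have [j Uj lbj] := bandt t te.
apply: le_trans lbj; rewrite ler_wpM2l ?invr_ge0 //; first lra.
have Qj : Q j by apply/asboolP; exact: (e2P j _ _ te2 tt0 h2' h20 Uj).
have := imax j Qj => alji.
have /andP[t0' tlt] := te1.
have t1 : 0 < t <= 1 by rewrite t0' (le_trans (ltW tlt)).
exact: ger_powR t1 _ _ alji.
Qed.

End Asymptotics.

(** * Continuity and distances *)
Section Continuity.
Variables (R : realType) (n : nat).

Lemma continuous_add (T : topologicalType) (f h : T -> R) :
  continuous f -> continuous h -> continuous (fun x => f x + h x).
Proof. by move=> fc hc x; apply: cvgD; [exact: fc|exact: hc]. Qed.

Lemma continuous_mul (T : topologicalType) (f h : T -> R) :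
  continuous f -> continuous h -> continuous (fun x => f x * h x).
Proof. by move=> fc hc x; apply: cvgM; [exact: fc|exact: hc]. Qed.

Lemma continuous_opp (T : topologicalType) (f : T -> R) :
  continuous f -> continuous (fun x => - f x).
Proof. by move=> fc x; apply: cvgN; exact: fc. Qed.

Lemma continuous_maxr (T : topologicalType) (f h : T -> R) :
  continuous f -> continuous h -> continuous (fun x => Num.max (f x) (h x)).
Proof. by move=> fc hc x; apply: continuous_max; [exact: fc|exact: hc]. Qed.

Lemma continuous_prod (T : topologicalType) I (r : seq I) (F : I -> T -> R) :
  (forall i, continuous (F i)) -> continuous (fun x => \prod_(i <- r) F i x).
Proof.
move=> Fc; elim: r => [|i r IH] x.
  by under eq_fun do rewrite big_nil; exact: cvg_cst.
by under eq_fun do rewrite big_cons; apply: cvgM; [exact: Fc|exact: IH].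
Qed.

Lemma continuous_peval (p : mpoly n R) : continuous (peval p).
Proof.
elim/mpolyind: p => [|c m p _ _ IH].
  have -> : peval (0 : mpoly n R) = fun=> 0 by apply/funext => x; exact: meval0.
  exact: cst_continuous.
have -> : peval (c *: mpolyX R m + p) =
    (fun x : 'rV[R]_n => c * \prod_(i < n) x ord0 i ^+ m i + peval p x).
  by apply/funext => x; rewrite pevalD pevalZ /peval mevalX.
apply: continuous_add => //; apply: continuous_mul; first exact: cst_continuous.
apply: continuous_prod => i y.
apply: (@continuous_comp _ _ _ (fun v : 'rV[R]_n => v ord0 i) (fun u : R => u ^+ m i)).
  exact: coord_continuous.
exact: exprn_continuous.
Qed.

Lemma compact_cube : compact (@cube R n).
Proof.
have := @rV_compact R n (fun=> `[-1, 1]%classic) (fun=> @segment_compact R _ _).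
congr compact; apply/seteqP; split=> x H i; have := H i; by rewrite /= in_itv.
Qed.

Lemma violation_ge m (g : 'I_m -> mpoly n R) x s :
  s <= violation g x <-> s <= 0 \/ exists j, s <= - peval (g j) x.
Proof.
rewrite /violation; split.
  move=> /bigmax_geP[->|[j _]]; first by left.
  by rewrite le_max => /orP[->|sj]; [left|right; exists j].
move=> [s0|[j sj]]; apply/bigmax_geP; first by left.
by right; exists j; rewrite // le_max sj orbT.
Qed.

Lemma continuous_violation m (g : 'I_m -> mpoly n R) : continuous (violation g).
Proof.
have -> : violation g = fun x => \big[Num.max/0]_(j <- enum 'I_m) Num.max 0 (- peval (g j) x).
  by apply/funext => x; rewrite /violation -big_enum.
elim: (enum 'I_m) => [|j r IH].
  by under eq_fun do rewrite big_nil; exact: cst_continuous.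
under eq_fun do rewrite big_cons.
apply: continuous_maxr => //; apply: continuous_maxr; first exact: cst_continuous.
by apply: continuous_opp; exact: continuous_peval.
Qed.

Lemma norm2_sq (x : 'rV[R]_n) : norm2 x ^+ 2 = \sum_(i < n) x ord0 i ^+ 2.
Proof. by rewrite /norm2 sqr_sqrtr // sumr_ge0 // => i _; exact: sqr_ge0. Qed.

Lemma norm2_ge0 (x : 'rV[R]_n) : 0 <= norm2 x.
Proof. exact: sqrtr_ge0. Qed.

Lemma norm2D (x y : 'rV[R]_n) : norm2 (x + y) <= norm2 x + norm2 y.
Proof.
have [x0|] := eqVneq (norm2 x) 0.
  have {}x0 : x = 0.
    apply/rowP => i; rewrite mxE; apply/eqP; rewrite -normr_le0 -x0; exact: coord_le_norm2.
  by rewrite x0 !add0r lerDr norm2_ge0.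
have [y0 _|yn xn] := eqVneq (norm2 y) 0.
  have {}y0 : y = 0.
    apply/rowP => i; rewrite mxE; apply/eqP; rewrite -normr_le0 -y0; exact: coord_le_norm2.
  by rewrite y0 !addr0 lerDl norm2_ge0.
have x0 : 0 < norm2 x by rewrite lt_neqAle eq_sym xn norm2_ge0.
have y0 : 0 < norm2 y by rewrite lt_neqAle eq_sym yn norm2_ge0.
rewrite -ler_sqr ?nnegrE ?addr_ge0 ?norm2_ge0 // norm2_sq.
set a := norm2 x in x0 xn *; set b := norm2 y in y0 yn *.
have -> : (a + b) ^+ 2 = (1 + b / a) * a ^+ 2 + (1 + a / b) * b ^+ 2 by field; rewrite xn yn.
rewrite !norm2_sq !mulr_sumr -big_split /=; apply: ler_sum => i _; rewrite mxE.
set u := x _ _; set v := y _ _; rewrite -subr_ge0.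
have -> : (1 + b / a) * u ^+ 2 + (1 + a / b) * v ^+ 2 - (u + v) ^+ 2 =
  (b * u - a * v) ^+ 2 / (a * b) by field; rewrite xn yn.
by rewrite divr_ge0 ?sqr_ge0 // mulr_ge0 // ltW.
Qed.

Lemma norm2Z (c : R) (x : 'rV[R]_n) : norm2 (c *: x) = `|c| * norm2 x.
Proof.
apply/eqP; rewrite -(@eqrXn2 _ 2) ?norm2_ge0 ?mulr_ge0 ?norm2_ge0 //.
rewrite exprMn !norm2_sq real_normK ?num_real // mulr_sumr; apply/eqP.
by apply: eq_bigr => i _; rewrite mxE exprMn.
Qed.

Lemma dist2_geP (S : set 'rV[R]_n) x t : S !=set0 ->
  t <= dist2 x S <-> forall y, S y -> t <= norm2 (x - y).
Proof.
move=> [y0 Sy0]; split.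
  move=> tx y Sy; apply: le_trans tx _; apply: ge_inf; last by exists y.
  by exists 0 => _ [z _ <-]; exact: norm2_ge0.
move=> H; apply: lb_le_inf; first by exists (norm2 (x - y0)), y0.
by move=> _ [y Sy <-]; exact: H.
Qed.

Lemma dist2_ge0 (S : set 'rV[R]_n) x : S !=set0 -> 0 <= dist2 x S.
Proof. by move=> S0; apply/dist2_geP => // y _; exact: norm2_ge0. Qed.

Lemma dist2_le (S : set 'rV[R]_n) x y : S y -> dist2 x S <= norm2 (x - y).
Proof. by move=> Sy; have /(dist2_geP _ _ (ex_intro _ y Sy)) := lexx (dist2 x S); apply. Qed.

Lemma dist2_lip (S : set 'rV[R]_n) x y : S !=set0 ->
  dist2 x S <= dist2 y S + norm2 (x - y).
Proof.
move=> S0; rewrite -lerBlDr; apply/dist2_geP => // z Sz; rewrite lerBlDr.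
apply: le_trans (dist2_le _ Sz) _.
by have -> : x - z = (y - z) + (x - y); [rewrite [RHS]addrC addrA subrK|exact: norm2D].
Qed.

End Continuity.

(** * The Lojasiewicz exponent *)
Section Lojasiewicz.
Variables (R : realType) (n m : nat) (g : 'I_m -> mpoly n R).
Hypothesis n0 : (0 < n)%N.
Hypothesis S0 : Sset g !=set0.
Hypothesis SC : Sset g `<=` cube.

Definition far_points (t : R) : set 'rV[R]_n := [set x | cube x /\ t <= dist2 x (Sset g)].
(** The growth order of this function at 0 is the Lojasiewicz exponent. *)
Definition least_violation (t : R) : R := inf [set violation g x | x in far_points t].

Lemma violation_eq0 x : violation g x <= 0 -> Sset g x.
Proof.
move=> v0 j; rewrite -oppr_le0; apply: le_trans v0.
by apply/violation_ge; right; exists j.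
Qed.

Lemma least_violationP t s : far_points t !=set0 ->
  s <= least_violation t <-> forall x, far_points t x -> s <= violation g x.
Proof.
move=> [x0 fx0]; split.
  move=> st x fx; apply: le_trans st _; apply: ge_inf; last by exists x.
  by exists 0 => _ [z _ <-]; exact: violation_ge0.
move=> H; apply: lb_le_inf; first by exists (violation g x0), x0.
by move=> _ [x fx <-]; exact: H.
Qed.

(** For [t > 0] the condition on the distance is the conjunction over the
feasible points [y] of the polynomial inequalities [t^2 <= |x - y|^2]. *)
Lemma closed_far_points t : 0 < t -> closed (far_points t).
Proof.
move=> t0.
have -> : far_points t = cube `&` \bigcap_(y in Sset g)
    (peval (\sum_(i < n) (mpolyX R (mnm1 i) - mpolyC n (y ord0 i)) ^+ 2) @^-1` [set u | t ^+ 2 <= u]).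
  apply/seteqP; split=> x [cx H]; split => //.
    move=> y Sy /=; rewrite peval_sum.
    have := (iffLR (dist2_geP _ _ S0) H y Sy) => ty.
    have : t ^+ 2 <= norm2 (x - y) ^+ 2 by rewrite ler_sqr ?nnegrE ?norm2_ge0 // ltW.
    rewrite norm2_sq; congr (_ <= _); apply: eq_bigr => i _.
    by rewrite !expr2 pevalM pevalB pevalX pevalC !mxE.
  apply/(dist2_geP _ _ S0) => y Sy; have := H y Sy; rewrite /= peval_sum => tH.
  rewrite -ler_sqr ?nnegrE ?norm2_ge0 ?(ltW t0) // norm2_sq; apply: le_trans tH _.
  rewrite le_eqVlt; apply/orP; left; apply/eqP; apply: eq_bigr => i _.
  by rewrite !expr2 pevalM pevalB pevalX pevalC !mxE.
apply: closedI.
  by apply: compact_closed; [exact: norm_hausdorff|exact: compact_cube].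
apply: closed_bigI => y Sy; apply: closed_comp; last exact: closed_ge.
by move=> x _; exact: continuous_peval.
Qed.

Lemma least_violation_gt0 t : 0 < t -> far_points t !=set0 -> 0 < least_violation t.
Proof.
move=> t0 ft.
have cf : compact (far_points t).
  apply: (subclosed_compact (closed_far_points t0) (@compact_cube R n)).
  by move=> x [].
have [|x /set_mem xf xmin] := compact_EVT_min (f := violation g) ft cf.
  by apply: continuous_subspaceT; exact: continuous_violation.
apply: (@lt_le_trans _ _ (violation g x)); last first.
  by apply/least_violationP => // y yf; apply: xmin; exact: mem_set.
rewrite lt_neqAle violation_ge0 andbT eq_sym; apply/eqP => v0.
have Sx : Sset g x by apply: violation_eq0; rewrite v0.
have [_ tx] := xf; have := le_trans tx (dist2_le x Sx).
by rewrite subrr -(scale0r 0) norm2Z normr0 mul0r leNgt t0.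
Qed.

(** A point stored in the environment from position [k] on. In the formula for
[least_violation], positions 0 and 1 hold [t] and the bound [s], the next [n] a
point [x] of the cube, and the following [n] a feasible point. *)
Definition env_vec (k : nat) (e : seq R) : 'rV[R]_n := \row_i e`_(k + i).

Lemma env_vec_update k e (y : 'rV[R]_n) : exists e',
  env_vec k e' = y /\ forall i, i \notin iota k n -> e`_i = e'`_i.
Proof.
pose ys := [seq y ord0 i | i <- enum 'I_n].
pose f i := if (k <= i < k + n)%N then ys`_(i - k) else e`_i.
have fE i : (mkseq f (maxn (size e) (k + n)))`_i = f i.
  have [lt|ge] := ltnP i (maxn (size e) (k + n)); first by rewrite nth_mkseq.
  rewrite nth_default ?size_mkseq // /f; move: ge; rewrite geq_max => /andP[ge1 ge2].
  by rewrite ltnNge ge2 andbF nth_default.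
exists (mkseq f (maxn (size e) (k + n))); split; last first.
  by move=> i; rewrite mem_iota fE /f => /negbTE ->.
apply/rowP => i; rewrite mxE fE /f leq_addr ltn_add2l ltn_ord /= addKn /ys.
by rewrite (nth_map i) ?size_enum_ord // nth_ord_enum.
Qed.

Lemma term_peval p k : term_fun (fun e => peval p (env_vec k e)).
Proof.
have [u uP] : term_fun (fun e => \sum_(mm <- msupp p) mcoeff mm p * \prod_(i <- enum 'I_n) e`_(k + i) ^+ mm i).
  apply: term_sum => mm; apply: term_mul; first exact: term_const.
  by apply: term_prod => i; apply: term_exp; exact: term_nth.
exists u => e; rewrite -uP /peval mevalE; apply: eq_bigr => mm _; congr (_ * _).
by rewrite -big_enum /=; apply: eq_bigr => i _; rewrite mxE.
Qed.

Lemma definable_Sset k : definable (fun e => Sset g (env_vec k e)).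
Proof.
apply: definable_all_ord => j; apply: definable_le; first exact: term_const.
exact: term_peval.
Qed.

Lemma definable_cube k : definable (fun e => @cube R n (env_vec k e)).
Proof.
have : definable (fun e : seq R => forall i : 'I_n, -1 <= e`_(k + i) /\ e`_(k + i) <= 1).
  apply: definable_all_ord => i; apply: definable_and; apply: definable_le;
    by [exact: term_const|exact: term_nth].
apply: eq_definable => e; split=> H i; have := H i; rewrite mxE; first by move=> /andP.
by move=> /andP.
Qed.

Lemma definable_violation_ge k : definable (fun e => e`_1 <= violation g (env_vec k e)).
Proof.
have : definable (fun e => ~ (~ (e`_1 <= 0) /\
    forall j, ~ (e`_1 <= - peval (g j) (env_vec k e)))).
  apply: definable_not; apply: definable_and.
    apply: definable_not; apply: definable_le; [exact: term_nth|exact: term_const].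
  apply: definable_all_ord => j; apply: definable_not; apply: definable_le; first exact: term_nth.
  by apply: term_opp; exact: term_peval.
apply: eq_definable => e; rewrite violation_ge; split.
  move=> H; apply: contrapT => H'; apply: H; split=> [e0|j ej]; apply: H'; first by left.
  by right; exists j.
by move=> [e0|[j ej]] [H1 H2]; [exact: H1|exact: H2 ej].
Qed.

Lemma definable_least_violation : exists2 A, definable A &
  forall t s, 0 < t -> far_points t !=set0 -> A [:: t; s] <-> s <= least_violation t.
Proof.
pose far e := forall e', (forall i, i \notin iota (2 + n) n -> e`_i = e'`_i) ->
  Sset g (env_vec (2 + n) e') ->
  e'`_0 ^+ 2 <= \sum_(i <- enum 'I_n) (e'`_(2 + i) - e'`_(2 + n + i)) ^+ 2.
exists (fun e => forall e', (forall i, i \notin iota 2 n -> e`_i = e'`_i) ->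
  cube (env_vec 2 e') /\ far e' -> e'`_1 <= violation g (env_vec 2 e')).
  apply: definable_all_block; apply: definable_imp; last exact: definable_violation_ge.
  apply: definable_and; first exact: definable_cube.
  apply: definable_all_block; apply: definable_imp; first exact: definable_Sset.
  apply: definable_le; first by apply: term_exp; exact: term_nth.
  apply: term_sum => i; apply: term_exp; apply: term_add; first exact: term_nth.
  by apply: term_opp; exact: term_nth.
move=> t s t0 ft; rewrite least_violationP //.
have notin0 k : (0 < k)%N -> (0 \notin iota k n)%N by move=> k0; rewrite mem_iota leqNgt k0.
have notin1 k : (1 < k)%N -> (1 \notin iota k n)%N by move=> k0; rewrite mem_iota leqNgt k0.
have farP e : e`_0 = t -> far e <-> t <= dist2 (env_vec 2 e) (Sset g).
  move=> et; rewrite (dist2_geP _ _ S0).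
  have sqE e' : \sum_(i <- enum 'I_n) (e'`_(2 + i) - e'`_(2 + n + i)) ^+ 2 =
      norm2 (env_vec 2 e' - env_vec (2 + n) e') ^+ 2.
    by rewrite norm2_sq -big_enum /=; apply: eq_bigr => i _; rewrite !mxE.
  have v2 e' : (forall i, i \notin iota (2 + n) n -> e`_i = e'`_i) -> env_vec 2 e' = env_vec 2 e.
    move=> ee; apply/rowP => i; rewrite !mxE ee // mem_iota.
    by rewrite leqNgt ltn_add2l ltn_ord.
  split=> [H y Sy|H e' ee Se'].
    have [e' [yE ee]] := env_vec_update (2 + n) e y.
    have := H e' ee; rewrite yE => /(_ Sy); rewrite sqE yE (v2 e' ee) -ee ?notin0 // et.
    by rewrite ler_sqr ?nnegrE ?norm2_ge0 // ltW.
  rewrite sqE (v2 e' ee) -ee ?notin0 // et ler_sqr ?nnegrE ?norm2_ge0 ?(ltW t0) //.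
  exact: H.
split=> [H x [cx dx]|H e' ee [ce' fe']].
  have [e' [xE ee]] := env_vec_update 2 [:: t; s] x.
  have et : e'`_0 = t by rewrite -ee ?notin0.
  have es : e'`_1 = s by rewrite -ee ?notin1.
  have := H e' ee; rewrite (farP _ et) xE es; apply; split=> //.
have et : e'`_0 = t by rewrite -ee ?notin0.
have -> : e'`_1 = s by rewrite -ee ?notin1.
by apply: H; split => //; apply/(farP _ et).
Qed.

Lemma peval_cube_bound (p : mpoly n R) x : cube x ->
  `|peval p x| <= \sum_(mm <- msupp p) `|mcoeff mm p|.
Proof.
move=> cx; rewrite /peval mevalE (le_trans (ler_norm_sum _ _ _)) //.
apply: ler_sum => mm _; rewrite normrM ler_piMr // normr_prod.
apply: prodr_ile1 => i _; rewrite normr_ge0 normrX exprn_ile1 //.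
by rewrite ler_norml; exact: cx.
Qed.

Lemma constraints_bounded : exists2 G0 : R, 0 < G0 & forall j x, cube x -> `|peval (g j) x| <= G0.
Proof.
exists (1 + \sum_(j < m) \sum_(mm <- msupp (g j)) `|mcoeff mm (g j)|).
  by rewrite ltr_pwDl // sumr_ge0 // => j _; exact: sumr_ge0.
move=> j x cx; apply: le_trans (peval_cube_bound (g j) cx) _.
rewrite (bigD1 j) //= addrCA lerDl addr_ge0 // sumr_ge0 // => i _; exact: sumr_ge0.
Qed.

Lemma violation_lip : exists2 B : R, 0 < B & forall x, cube x -> violation g x <= B * dist2 x (Sset g).
Proof.
have [G0 G00 gG] := constraints_bounded.
pose d := (1 + \sum_(j < m) pdeg (g j))%N.
have d0 : (0 < d)%N by [].
pose B := 32 * n%:R * d%:R ^+ 2 * G0.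
have B0 : 0 < B by rewrite !mulr_gt0 ?exprn_gt0 ?ltr0n.
exists B => // x cx; rewrite mulrC -ler_pdivrMr //; apply/(dist2_geP _ _ S0) => y Sy.
rewrite ler_pdivrMr // [_ * B]mulrC.
case: (violation_attained g x) => [->|[j [_ ->]]]; first by rewrite mulr_ge0 ?norm2_ge0 // ltW.
have dj : (pdeg (g j) <= d)%N by rewrite /d (bigD1 j) //= addnCA leq_addr.
have := cube_lipschitz d0 dj (gG j) cx (SC Sy); rewrite -/B ler_norml => /andP[+ _].
by have := Sy j; lra.
Qed.

(** Walk from a feasible point to [x0] in steps of length at most [t]. The first
point at distance at least [t] is at distance at most [2 t], as the distance is
1-Lipschitz. *)
Lemma exists_at_distance x0 t : cube x0 -> 0 < t -> t <= dist2 x0 (Sset g) ->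
  exists x, [/\ cube x, t <= dist2 x (Sset g) & dist2 x (Sset g) <= 2 * t].
Proof.
move=> cx0 t0 tx0; have [y0 Sy0] := S0.
pose D := norm2 (x0 - y0).
have tD : t <= D by exact: le_trans tx0 (dist2_le _ Sy0).
pose M := (Num.truncn (D / t)).+1.
have M0 : 0 < M%:R :> R by [].
have DM : D / M%:R <= t.
  rewrite ler_pdivrMr // mulrC -ler_pdivrMr //.
  have /andP[_ /ltW] : (Num.truncn (D / t))%:R <= D / t < M%:R.
    by apply: truncn_itv; rewrite divr_ge0 // ?norm2_ge0 // ltW.
  by [].
pose z k := y0 + (k%:R / M%:R) *: (x0 - y0).
have zc k : (k <= M)%N -> cube (z k).
  move=> kM i; rewrite !mxE.
  have : 0 <= (k%:R / M%:R : R) <= 1 by rewrite divr_ge0 //= ler_pdivrMr // mul1r ler_nat.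
  have := cx0 i; have := SC Sy0 i; move: (_ / _) (x0 _ _) (y0 _ _) => u a b.
  by move=> /andP[? ?] /andP[? ?] /andP[? ?]; apply/andP; split; nra.
pose P k := t <= dist2 (z k) (Sset g).
have PM : exists k, P k.
  by exists M; rewrite /P /z divff ?gt_eqF // scale1r addrC subrK.
case: (ex_minnP PM) => k Pk kmin; have kM : (k <= M)%N.
  by apply: kmin; rewrite /P /z divff ?gt_eqF // scale1r addrC subrK.
exists (z k); split => //; first exact: zc.
have k0 : (0 < k)%N.
  rewrite lt0n; apply: contraTneq Pk => ->; rewrite /P /z mul0r scale0r addr0 -ltNge.
  apply: le_lt_trans (dist2_le _ Sy0) _.
  by rewrite subrr -(scale0r 0) norm2Z normr0 mul0r.
have : dist2 (z k.-1) (Sset g) < t.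
  rewrite ltNge; apply/negP => /kmin; by rewrite leqNgt prednK ?leqnn.
have : norm2 (z k - z k.-1) <= t.
  apply: le_trans DM; rewrite /z opprD addrACA subrr add0r -scalerBl norm2Z.
  rewrite -mulrBl -{1}[k]prednK // -natr1 addrAC subrr add0r mul1r ger0_norm ?invr_ge0 ?ler0n //.
  by rewrite mulrC.
by have := dist2_lip (z k) (z k.-1) S0; lra.
Qed.

End Lojasiewicz.

Lemma powR_le_exponent (R : realType) (a b K eps : R) : 0 < eps ->
  (forall t, 0 < t < eps -> t `^ a <= K * t `^ b) -> b <= a.
Proof.
move=> e0 H; rewrite leNgt; apply/negP => ab.
have h2 : 0 < eps / 2 < eps by lra.
have K0 : 0 < K.
  have /andP[h0 _] := h2.
  by have := lt_le_trans (powR_gt0 a h0) (H _ h2); rewrite pmulr_lgt0 // powR_gt0.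
have ba0 : 0 < b - a by lra.
pose r := (2 * K)^-1 `^ (b - a)^-1.
have K2 : 0 < (2 * K)^-1 by rewrite invr_gt0 mulr_gt0.
have r0 : 0 < r by exact: powR_gt0.
pose t := Num.min (eps / 2) r.
have t0 : 0 < t by rewrite lt_min r0 andbT; lra.
have tE : t < eps by apply: (@le_lt_trans _ _ (eps / 2)); [rewrite ge_min lexx|lra].
have := H t; rewrite t0 tE => /(_ isT).
have -> : t `^ b = t `^ (b - a) * t `^ a by rewrite -powRD ?subrK // (gt_eqF t0) implybT.
rewrite mulrA -[X in X <= _]mul1r ler_pM2r ?powR_gt0 //.
have : t `^ (b - a) <= (2 * K)^-1.
  have -> : (2 * K)^-1 = r `^ (b - a) by rewrite /r -powRrM mulVf ?gt_eqF // powRr1 // ltW.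
  by apply: ge0_ler_powR; rewrite ?nnegrE ?(ltW ba0) ?(ltW t0) ?(ltW r0) // ge_min lexx orbT.
move=> /(ler_wpM2l (ltW K0)).
have -> : K * (2 * K)^-1 = 2^-1 by field; rewrite gt_eqF.
lra.
Qed.

Section LojasiewiczExponent.
Variables (R : realType) (n m : nat) (g : 'I_m -> mpoly n R).
Hypothesis n0 : (0 < n)%N.
Hypothesis S0 : Sset g !=set0.
Hypothesis SC : Sset g `<=` cube.

(** Let [al] be the growth order of the least violation. Its lower bound
makes [al] admissible (away from the feasible set the violation is bounded
below), and its upper bound makes every admissible exponent at least [al]. Since
the violation is Lipschitz and vanishes on the feasible set, the least violation
at distance [t] is [O(t)], so [al >= 1]. If the cube is feasible, all positive
exponents are admissible and the default value 1 applies. *)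
Theorem loj_exponent_admissible : 1 <= loj_exponent g /\
  exists2 c : R, 0 <= c & forall x, cube x -> dist2 x (Sset g) `^ loj_exponent g <= c * violation g x.
Proof.
have [[x0 cx0 dx0]|alld] := pselect (exists2 x, cube x & 0 < dist2 x (Sset g)); last first.
  have d0 x : cube x -> dist2 x (Sset g) = 0.
    move=> cx; apply/eqP; rewrite eq_le dist2_ge0 // andbT leNgt; apply/negP => dx.
    by apply: alld; exists x.
  have adm L : 0 < L -> exists2 c : R, 0 <= c &
      forall x, cube x -> dist2 x (Sset g) `^ L <= c * violation g x.
    by move=> L0; exists 0 => // x cx; rewrite d0 // powR0 ?gt_eqF // mul0r.
  have -> : loj_exponent g = 1.
    apply: xgetPN => L [[L0 _] Lmin].
    have h : loj_admissible g (L / 2) by split; [lra|apply: adm; lra].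
    by have := Lmin _ h; lra.
  by split => //; exact: adm.
have [A Adef AE] := definable_least_violation S0.
have far0 t : t <= dist2 x0 (Sset g) -> far_points g t !=set0 by move=> tx; exists x0.
have [al [C [eps [C1 e0 e1 ex growth]]]] : exists al C eps : R, [/\ 1 <= C, 0 < eps, eps <= 1,
    eps <= dist2 x0 (Sset g) &
    forall t, 0 < t < eps -> C^-1 * t `^ al <= least_violation g t <= C * t `^ al].
  apply: (definable_growth_order Adef dx0) => [t /andP[t0 tx]|t s /andP[t0 tx]].
    by apply: least_violation_gt0 => //; apply: far0; exact: ltW.
  by apply: AE => //; apply: far0; exact: ltW.
have C0 : 0 < C by lra.
have farI t : t < eps -> far_points g t !=set0 by move=> te; apply: far0; apply: ltW; exact: lt_le_trans ex.
have [B B0 Blip] := violation_lip n0 S0 SC.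
have al1 : 1 <= al.
  apply: (@powR_le_exponent _ al 1 (C * (B * 2)) eps e0) => t te; have /andP[t0 tlt] := te.
  have [x [cx tx xt]] := exists_at_distance S0 SC cx0 t0 (ltW (lt_le_trans tlt ex)).
  rewrite powRr1 ?(ltW t0) // -mulrA -ler_pdivrMl //.
  have /andP[+ _] := growth t te; move=> /le_trans; apply.
  have lv : least_violation g t <= violation g x.
    by apply: (iffLR (least_violationP _ (farI t tlt))).
  apply: le_trans lv _; apply: le_trans (Blip x cx) _.
  by rewrite -mulrA ler_pM2l.
have lower L : loj_admissible g L -> al <= L.
  move=> [L0 [c c0 Lc]]; apply: (@powR_le_exponent _ L al ((c + 1) * C) eps e0) => t te.
  have /andP[t0 tlt] := te; have c1 : 0 < c + 1 by lra.
  rewrite -mulrA -ler_pdivrMl //; have /andP[_ +] := growth t te; apply: le_trans.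
  apply/(least_violationP _ (farI t tlt)) => x [cx tx].
  rewrite ler_pdivrMl //; apply: (@le_trans _ _ (c * violation g x)).
    apply: le_trans (Lc x cx); apply: ge0_ler_powR; rewrite ?nnegrE ?(ltW L0) ?(ltW t0) //.
    exact: dist2_ge0.
  by rewrite ler_wpM2r ?violation_ge0 //; lra.
have adm : loj_admissible g al.
  split; first by lra.
  pose b : R := (2 * n%:R) `^ al; have b0 : 0 <= b by exact: powR_ge0.
  have h2 : 0 < eps / 2 < eps by lra.
  pose lv := least_violation g (eps / 2).
  have lv0 : 0 < lv by apply: least_violation_gt0 => //; [lra|apply: farI; lra].
  have blv : 0 <= b / lv by rewrite divr_ge0 // ltW.
  exists (C + b / lv); first by rewrite addr_ge0 // ltW.
  move=> x cx; have v0 := violation_ge0 g x.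
  have [d0|dn] := eqVneq (dist2 x (Sset g)) 0.
    by rewrite d0 powR0 ?mulr_ge0 ?addr_ge0 ?(ltW C0) // gt_eqF; lra.
  have dp : 0 < dist2 x (Sset g) by rewrite lt_neqAle eq_sym dn dist2_ge0.
  have [de|de] := ltP (dist2 x (Sset g)) eps.
    have dI : 0 < dist2 x (Sset g) < eps by rewrite dp.
    have /andP[gr _] := growth _ dI; rewrite ler_pdivrMl // in gr.
    apply: le_trans gr _; rewrite mulrDl; apply: (@le_trans _ _ (C * violation g x)); last first.
      by rewrite lerDl mulr_ge0.
    rewrite ler_pM2l //; apply: (iffLR (least_violationP _ (farI _ de))) => //.
  apply: (@le_trans _ _ (b / lv * violation g x)); last first.
    by rewrite ler_wpM2r // lerDr ltW.
  apply: (@le_trans _ _ (b / lv * lv)); last first.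
    rewrite ler_wpM2l // /lv.
    have e2 : eps / 2 < eps by lra.
    by apply: (iffLR (least_violationP _ (farI _ e2))) => //; split => //; lra.
  rewrite divfK ?gt_eqF //; have [y0 Sy0] := S0.
  apply: ge0_ler_powR; rewrite ?nnegrE ?dist2_ge0 ?mulr_ge0 ?ler0n //; first lra.
  apply: le_trans (dist2_le _ Sy0) _.
  rewrite -ler_sqr ?nnegrE ?norm2_ge0 ?mulr_ge0 ?ler0n // norm2_sq.
  apply: (@le_trans _ _ (\sum_(i < n) 4)).
    apply: ler_sum => i _; rewrite !mxE; have := cx i; have := SC Sy0 i.
    by move: (x _ _) (y0 _ _) => u v /andP[? ?] /andP[? ?]; nra.
  rewrite sumr_const card_ord -[_ *+ _]mulr_natr exprMn.
  have n1 : 1 <= n%:R :> R by rewrite ler1n.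
  by move: (n%:R) n1 => N N1; nra.
have := @xgetPex _ 1 (loj_admissible g `&` lbound (loj_admissible g)).
rewrite -/(loj_exponent g) => -[|[L0 [c c0 Lc]] _]; first by exists al.
split; last by exists c.
by apply: le_trans al1 _; apply: lower; split => //; exists c.
Qed.
End LojasiewiczExponent.

(** * The degree bound *)
Section Extrema.
Variables (R : realType) (n m : nat) (g : 'I_m -> mpoly n R) (f : mpoly n R).
Hypothesis S0 : Sset g !=set0.
Hypothesis fpos : forall x, Sset g x -> 0 < peval f x.

Lemma fmin_gt0 : compact (Sset g) -> 0 < fmin g f.
Proof.
move=> Sc; have [|x /set_mem Sx xmin] := compact_EVT_min (f := peval f) S0 Sc.
  by apply: continuous_subspaceT; exact: continuous_peval.
apply: lt_le_trans (fpos Sx) _; apply: lb_le_inf; first by exists (peval f x), x.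
by move=> _ [y Sy <-]; apply: xmin; exact: mem_set.
Qed.

Lemma fmin_le x : Sset g x -> fmin g f <= peval f x.
Proof.
move=> Sx; apply: ge_inf; last by exists x.
by exists 0 => _ [y Sy <-]; exact/ltW/fpos.
Qed.

Lemma supnorm_ge x : cube x -> `|peval f x| <= supnorm f.
Proof.
move=> cx; apply: ub_le_sup; last by exists x.
exists (\sum_(mm <- msupp f) `|mcoeff mm f|) => _ [y cy <-].
exact: peval_cube_bound.
Qed.

End Extrema.

Lemma exists_pow3 (R : realType) (B : R) : 1 <= B ->
  exists k : nat, B <= 3 ^+ k /\ 3 ^+ k <= 6 * B.
Proof.
move=> B1; pose Y := (Num.truncn B).+1.
have B0 : 0 <= B by lra.
have /andP[Y1 Y2] := truncn_itv B0.
have YB : Y%:R <= B + 1 :> R by rewrite /Y -natr1 lerD2r.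
exists (up_log 3 Y); split.
  by rewrite -natrX (le_trans (ltW Y2)) // ler_nat up_logP.
have : (3 ^ up_log 3 Y <= 3 * Y)%N.
  case: (ltnP 1 Y) => Yn; last by have -> : Y = 1%N by apply/eqP; rewrite eqn_leq Yn.
  have := @up_log_bounds 3 Y isT Yn; case: up_log => [|j] /=; first by rewrite expn0; lia.
  by rewrite expnS => /andP[/ltnW ? _]; rewrite leq_mul2l.
by rewrite -(ler_nat R) natrX natrM => /le_trans -> //; lra.
Qed.

Unset Implicit Arguments.
Set Strict Implicit.

Theorem theorem4 (R : realType) (n m : nat) (hn : (1 <= n)%N) (hm : (1 <= m)%N)
    (g : 'I_m -> mpoly n R)
    (S_nonempty : Sset g !=set0) (S_compact : compact (Sset g))
    (ball_in_Q : qmodule g (1 - \sum_(i < n) mpolyX R (mnm1 i) ^+ 2)) :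
  exists C C' : R, [/\ 0 < C, 0 < C' &
    forall (f : mpoly n R) (d : nat),
      pdeg f = d ->
      (forall x, Sset g x -> 0 < peval f x) ->
      forall r : R,
        C * ln n%:R * d%:R `^ (4 * loj_exponent g + 2)
            * kappa g f `^ (2 * loj_exponent g)
          + C' * d%:R `^ (2 * loj_exponent g) * kappa g f `^ loj_exponent g
          <= r ->
        qmodule_trunc g (r * n%:R) f].
Proof.
have SC : Sset g `<=` cube by exact: Sset_sub_cube.
have [L1 [c c0 loj]] := loj_exponent_admissible hn S_nonempty SC.
set L := loj_exponent g in L1 loj *.
have [G0 G00 gG] := constraints_bounded g.
have [K KP] := ball_qmodule_sub ball_in_Q.
have [Cc CcP] := ball_qmodule_positive_on_cube R hn.
(* The peaks have width 1 / N with N = 3 ^ k >= A0 * X0, where X0 is the product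
   of the powers of d and kappa. *)
pose A0 : R := 1 + 36 * m%:R * G0 * c * (128 * n%:R) `^ L.
have A01 : 1 <= A0 by rewrite lerDl !mulr_ge0 ?powR_ge0 // ltW.
pose dg := (1 + \sum_(j < m) pdeg (g j))%N.
have dgR : 1 <= dg%:R :> R by rewrite ler1n.
pose a : R := 18 * A0 * dg%:R.
have a1 : 1 <= a by rewrite /a; nra.
have ln2 : 0 < ln 2 :> R by rewrite ln_gt0 // ltr1n.
have Cc0 : 0 < (Cc + K + 1)%:R :> R by rewrite ltr0n addn1.
exists ((Cc + K + 1)%:R * a ^+ 2 / ln 2), ((3 + K)%:R * a); split.
- by rewrite divr_gt0 // mulr_gt0 // exprn_gt0 //; lra.
- by rewrite mulr_gt0 //; lra.
move=> f d fd fpos r hr.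
have hr' := hr.
have rn_ge (x : R) : 0 <= x -> x <= r -> x <= r * n%:R.
  move=> x0 xr; have r0 : 0 <= r by apply: (le_trans x0).
  by apply: (le_trans xr); rewrite ler_peMr ?ler1n.
have [d0|d0] := posnP d.
  have {}hr : 0 <= r.
    by move: hr; rewrite d0 !powR0 ?mulr0 ?mul0r ?addr0 //; apply: lt0r_neq0; lra.
  have fE : f = mpolyC n (mcoeff (mnm0) f).
    by apply: msize1_polyC; move: fd; rewrite /pdeg d0; case: mmeasure => [|[]].
  exists f, (fun=> 0); split.
  - split; last by move=> j; exact: sos0.
    rewrite fE; apply: sosC; have [x Sx] := S_nonempty.
    by move: (fpos x Sx); rewrite fE /peval mevalC mcoeffC eqxx mulr1 => /ltW.
  - by rewrite fd d0 rn_ge.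
  - by move=> j; rewrite mul0r pdeg0 rn_ge.
  - by rewrite big1 ?addr0 // => j _; rewrite mul0r.
set mu := fmin g f; set F := supnorm f.
have mu0 : 0 < mu by exact: fmin_gt0.
have fmu x : Sset g x -> mu <= peval f x by exact: fmin_le.
have fF x : cube x -> `|peval f x| <= F by exact: supnorm_ge.
set kap := kappa g f in hr hr' *.
have kapE : kap = F / mu by [].
have kap1 : 1 <= kap.
  rewrite kapE ler_pdivlMr // mul1r; have [x Sx] := S_nonempty.
  by apply: le_trans (fmu x Sx) _; apply: le_trans (ler_norm _) _; exact: fF (SC _ Sx).
have dR : 1 <= d%:R :> R by rewrite ler1n.
pose X0 : R := d%:R `^ (2 * L) * kap `^ L.
have dL1 : d%:R <= d%:R `^ (2 * L) by apply: le1r_powR => //; lra.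
have kL1 : kap <= kap `^ L by exact: le1r_powR.
have dX0 : d%:R <= X0 by rewrite /X0; nra.
have kX0 : kap <= X0 by rewrite /X0; nra.
have X01 : 1 <= X0 by lra.
have A0X0 : 1 <= A0 * X0 by nra.
have [k [kB kU]] := exists_pow3 A0X0.
set N : R := 3 ^+ k in kB kU.
have XN : X0 <= N by nra.
have big : 36 * m%:R * G0 * c * (128 * n%:R * d%:R ^+ 2 * (F / mu)) `^ L <= N.
  have k0 : 0 <= kap by lra.
  apply: (le_trans _ kB); rewrite -kapE.
  rewrite (powRM _ _ k0) ?mulr_ge0 ?sqr_ge0 //.
  rewrite (powRM _ _ (sqr_ge0 _)) ?mulr_ge0 //.
  have -> : (d%:R ^+ 2) `^ L = d%:R `^ (2 * L) :> R by rewrite powRrM powR_mulrn.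
  rewrite -[_ * _ * kap `^ L]mulrA mulrA -/X0 ler_pM2r ?(lt_le_trans ltr01 X01) //.
  by rewrite /A0 lerDr.
have fdl : (pdeg f <= d)%N by rewrite fd.
have [t [tsos tdeg tq]] := positive_perturbation hn hm S_nonempty SC G00 gG L1 c0 loj
  d0 fdl mu0 fmu fF big.
set q := f - \sum_(j < m) t j * g j in tq.
(* X bounds all degrees, and the ratio of the bounds of q on the cube. *)
pose X := (3 * 3 ^ k * dg)%N.
have XE : X%:R = 3 * N * dg%:R by rewrite /X !natrM natrX.
have X0' : (0 < X)%N by rewrite !muln_gt0 expn_gt0.
have Xa : X%:R <= a * X0 by rewrite XE /a; nra.
have tg j : (pdeg (t j * g j) <= X)%N.
  rewrite (leq_trans (pdegM _ _)) // (leq_trans (leq_add (tdeg j) (leqnn _))) //.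
  have : (pdeg (g j) <= dg)%N by rewrite /dg (bigD1 j) //= addnCA leq_addr.
  rewrite mulnA -mulSnr => gdg; apply: leq_mul => //.
  by rewrite ltn_pmul2r // expn_gt0.
have dX : (d <= X)%N.
  rewrite -(ler_nat R) XE; apply: (le_trans dX0); apply: (le_trans XN).
  by have := lt_le_trans (lt_le_trans ltr01 X01) XN; nra.
have qX : (pdeg q <= X)%N.
  apply: pdegD; first by rewrite fd.
  by rewrite -mulN1r -mpolyC1 -mpolyCN mul_mpolyC (leq_trans (pdegZ _ _)) //; apply: pdeg_sum.
have fE : f = q + \sum_(j < m) t j * g j by rewrite /q subrK.
have finish (E : nat) : (X <= E)%N -> ball_qmodule E q -> (E + K)%:R <= r * n%:R ->
    qmodule_trunc g (r * n%:R) f.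
  move=> XE' Qq Er; rewrite fE; apply: qmodule_truncD => //.
    by move=> j; apply: le_trans Er; rewrite ler_nat (leq_trans (tg j)) // (leq_trans XE') // leq_addr.
  exact: qmodule_trunc_le Er (KP _ _ Qq).
have X0sq : X0 ^+ 2 <= d%:R `^ (4 * L + 2) * kap `^ (2 * L).
  have -> : X0 ^+ 2 = d%:R `^ (4 * L) * kap `^ (2 * L).
    have -> : 4 * L = 2 * L + 2 * L by ring.
    have kE : kap `^ (2 * L) = kap `^ L * kap `^ L.
      by rewrite -powRD ?(gt_eqF (lt_le_trans ltr01 kap1)) ?implybT //; congr (_ `^ _); ring.
    rewrite kE powRD ?(gt_eqF (lt_le_trans ltr01 dR)) ?implybT // /X0; ring.
  by rewrite ler_pM2r ?powR_gt0 ?(lt_le_trans ltr01 kap1) // ler_powR //; lra.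
have X1 : 1 <= X%:R :> R by rewrite ler1n.
have [n1|n1] := leqP n 1.
  (* As ln 1 = 0, the degree has to be linear in X0. *)
  have nE : n = 1%N by apply/eqP; rewrite eqn_leq n1.
  apply: (finish (2 * X)%N); first by rewrite mul2n -addnn leq_addr.
    apply: ball_qmodule_positive_on_interval => // x cx.
    by have /andP[+ _] := tq x cx; apply: lt_le_trans; lra.
  apply: rn_ge => //; apply: le_trans hr'; rewrite nE ln1 mulr0 !mul0r add0r.
  have -> : (3 + K)%:R * a * d%:R `^ (2 * L) * kap `^ L = (3 + K)%:R * (a * X0).
    by rewrite mulrA /X0 mulrA.
  apply: (@le_trans _ _ ((3 + K)%:R * X%:R)); last by rewrite ler_pM2l.
  by rewrite -natrM ler_nat mulnDl leq_add ?leq_mul2r ?orbT // leq_pmulr.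
apply: (finish (Cc * X ^ 2 + X)%N); first by rewrite leq_addl.
  apply: ball_qmodule_le (CcP q X X (mu / 2) (F + N * mu / 2) qX X0' (leqnn _) _ _ tq).
  - by rewrite leq_addr.
  - by lra.
  - have FN : F <= N * mu by rewrite -ler_pdivrMr // -kapE; lra.
    have P0 : 0 < N * mu by rewrite mulr_gt0 // (lt_le_trans ltr01) // (le_trans X01).
    have -> : X%:R * (mu / 2) = 3 / 2 * (N * mu * dg%:R) by rewrite XE; ring.
    have : N * mu <= N * mu * dg%:R by rewrite ler_peMr // ltW.
    by lra.
apply: rn_ge => //; apply: le_trans hr'.
apply: (@le_trans _ _ ((Cc + K + 1)%:R * X%:R ^+ 2)).
  rewrite -natrX -natrM ler_nat !mulnDl mul1n -!addnA leq_add2l addnC.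
  by rewrite leq_add ?leq_pmulr ?expn_gt0 ?X0' // -mulnn leq_pmulr.
apply: (@le_trans _ _ ((Cc + K + 1)%:R * (a ^+ 2 * X0 ^+ 2))).
  by rewrite ler_pM2l // -exprMn ler_sqr ?nnegrE ?mulr_ge0 //; lra.
apply: (@le_trans _ _ ((Cc + K + 1)%:R * a ^+ 2 * (d%:R `^ (4 * L + 2) * kap `^ (2 * L)))).
  by rewrite mulrA ler_wpM2l // mulr_ge0 ?sqr_ge0.
set W := d%:R `^ _ * _.
have W0 : 0 <= W by rewrite mulr_ge0 ?powR_ge0.
have V0 : 0 <= (3 + K)%:R * a * d%:R `^ (2 * L) * kap `^ L.
  by rewrite !mulr_ge0 ?powR_ge0 //; lra.
apply: (@le_trans _ _ ((Cc + K + 1)%:R * a ^+ 2 / ln 2 * ln n%:R * W)); last first.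
  by rewrite /W (mulrA _ (d%:R `^ _)) lerDl.
have Ca0 : 0 <= (Cc + K + 1)%:R * a ^+ 2 by rewrite mulr_ge0 ?sqr_ge0.
rewrite ler_wpM2r // -mulrA ler_peMr // mulrC ler_pdivlMr // mul1r ler_ln ?posrE ?ltr0n // ler_nat //.
Qed.
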